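(* Let $X_1,X_2,\dots$ be i.i.d. random variables with $\mathsf EX_1=0$ and $0<\sigma^2=\mathsf DX_1<\infty$, and let $S_k=X_1+\dots+X_k$ ($S_0=0$). For each $n\in\mathbb N$ let $N_{r,\alpha,1/n^{\alpha}}$ have the generalized negative binomial distribution with parameters $r,\alpha,\mu=n^{-\alpha}$, independent of $X_1,X_2,\dots$. (i) Let $r>0$, $\alpha\in\mathbb R\setminus\{0\}$. Then, as $n\to\infty$, $$\frac{S_{N_{r,\alpha,1/n^{\alpha}}}}{\sigma\sqrt n}\Longrightarrow X\cdot\sqrt{G^*_{r,\alpha,1}},$$ with $X$ and $G^*_{r,\alpha,1}$ independent. (ii) If, in addition, $r\in(0,1]$ and $\alpha\in(0,1]$, then the limit law can be represented as $$X\sqrt{G^*_{r,\alpha,1}}\stackrel{d}{=}X\sqrt{\frac{W_1}{S_{\alpha,1}Z_{r,1}^{1/\alpha}}}\stackrel{d}{=}\frac{\Lambda}{\sqrt{2S_{\alpha,1}Z_{r,1}^{1/\alpha}}},$$ where in each term the factors are independent.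
   Context: $X$ is a standard normal random variable. The generalized gamma density is $g^*(x;r,\alpha,\lambda)=\frac{|\alpha|\lambda^r}{\Gamma(r)}x^{\alpha r-1}e^{-\lambda x^{\alpha}}$, $x\ge0$ ($r,\lambda>0$, $\alpha\ne0$), and $G^*_{r,\alpha,\lambda}$ is a random variable with this density. $N_{r,\alpha,\mu}$ has the generalized negative binomial distribution $\mathsf P(N_{r,\alpha,\mu}=k)=\frac1{k!}\int_0^\infty e^{-z}z^kg^*(z;r,\alpha,\mu)dz$, $k\ge0$. $W_1$ is standard exponential; $\Lambda$ has Laplace density $\frac12e^{-|x|}$. $G_{s,1}$ is gamma with density $\frac1{\Gamma(s)}x^{s-1}e^{-x}$ ($s>0$), $G_{0,1}:=0$. For $0<\alpha\le1$, $S_{\alpha,1}$ has characteristic function $\exp\{-|t|^{\alpha}\exp(-\tfrac12 i\pi\alpha\,\mathrm{sign}\,t)\}$ (degenerate at $1$ if $\alpha=1$). $Z_{r,1}=(G_{r,1}+G_{1-r,1})/G_{r,1}$ with independent gamma factors. *)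

(* Defs.v *)
From HB Require Import structures.
From mathcomp Require Import all_boot all_order all_algebra.
From mathcomp Require Import all_classical all_reals all_analysis.
Set Implicit Arguments. Unset Strict Implicit. Unset Printing Implicit Defensive.
Import Order.TTheory GRing.Theory Num.Theory Num.Def.
Import numFieldNormedType.Exports.
Local Open Scope classical_set_scope.
Local Open Scope ring_scope.

Section defs.
Context {R : realType}.

Definition GammaF (r : R) : R :=
  Rintegral lebesgue_measure `]0, +oo[ (fun x => x `^ (r - 1) * expR (- x)).

Definition gg_pdf (r alpha lambda : R) (x : R) : R :=
  if 0 < x then
    `|alpha| * lambda `^ r / GammaF r * x `^ (alpha * r - 1) * expR (- lambda * x `^ alpha)
  else 0.

Definition gnb_pmf (r alpha mu : R) (k : nat) : R :=
  (k`!%:R)^-1 *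
  Rintegral lebesgue_measure `]0, +oo[ (fun z => expR (- z) * z ^+ k * gg_pdf r alpha mu z).

Definition gamma_pdf (s : R) (x : R) : R :=
  if 0 < x then (GammaF s)^-1 * x `^ (s - 1) * expR (- x) else 0.

Definition exp1_pdf (x : R) : R := if 0 <= x then expR (- x) else 0.

Definition laplace_pdf (x : R) : R := 2^-1 * expR (- `|x|).

End defs.

Section prob_defs.
Context {R : realType} {d : measure_display} {T : measurableType d}.
Variable P : probability T R.

Definition has_pdf (Y : T -> R) (f : R -> R) : Prop :=
  forall B : set R, measurable B ->
    P (Y @^-1` B) = (\int[lebesgue_measure]_(x in B) (f x)%:E)%E.

Definition is_gamma (Y : T -> R) (s : R) : Prop :=
  if s == 0 then P (Y @^-1` [set 0]) = 1%E else has_pdf Y (gamma_pdf s).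

(* Y ~ S_{alpha,1}: its characteristic function E exp(itY) equals
   exp{-|t|^alpha exp(-i pi alpha sign(t)/2)}, written via real and imaginary parts *)
Definition has_stable_cf (Y : T -> R) (alpha : R) : Prop :=
  forall t : R,
    (\int[P]_w (cos (t * Y w))%:E =
      (expR (- `|t| `^ alpha * cos (pi * alpha / 2))
        * cos (sgr t * `|t| `^ alpha * sin (pi * alpha / 2)))%:E)%E /\
    (\int[P]_w (sin (t * Y w))%:E =
      (expR (- `|t| `^ alpha * cos (pi * alpha / 2))
        * sin (sgr t * `|t| `^ alpha * sin (pi * alpha / 2)))%:E)%E.

Definition mutually_independent (I : eqType) (Y : I -> T -> R) : Prop :=
  forall (J : seq I) (B : I -> set R), uniq J -> (forall i, measurable (B i)) ->
    P (\bigcap_(i in [set i | i \in J]) (Y i @^-1` B i)) =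
    (\prod_(i <- J) P (Y i @^-1` B i))%E.

Definition cdfR (Y : T -> R) (x : R) : R := fine (P (Y @^-1` `]-oo, x])).

End prob_defs.

Definition cvg_in_law {R : realType} {d d' : measure_display}
  {T : measurableType d} {T' : measurableType d'}
  (P : probability T R) (Y : nat -> T -> R) (P' : probability T' R) (Z : T' -> R) : Prop :=
  forall x : R, {for x, continuous (cdfR P' Z)} ->
    (fun n => cdfR P (Y n) x) @ \oo --> cdfR P' Z x.

Definition same_law {R : realType} {d d' : measure_display}
  {T : measurableType d} {T' : measurableType d'}
  (P : probability T R) (Y : T -> R) (P' : probability T' R) (Z : T' -> R) : Prop :=
  forall B : set R, measurable B -> P (Y @^-1` B) = P' (Z @^-1` B).

(* random sum S_{N(w)}(w) = X_1(w) + ... + X_{N(w)}(w) (indices shifted to start at 0) *)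
Definition random_sum {R : realType} {T : Type} (X : nat -> T -> R) (N : T -> R) (w : T) : R :=
  \sum_(k < Num.truncn (N w)) X k w.

(* Main.v *)
(* (i) Given the mixing variable [G], the index is Poisson with mean [n G], hence within [O(sqrt n)]
   of it.  For a smooth test function [f], Lindeberg's replacement argument bounds
   [E f(S_k / (sigma sqrt n)) - E f(sqrt (k / n) X)] by [k o(1/n)]; averaging over the Poisson index
   given [G = y] yields [E f(sqrt y X)] in the limit, and dominated convergence in [y] yields
   [E f(X sqrt G)].  Steep logistic functions are enough to recover distribution functions.

   (ii) The Laplace transform [E e^(-s S) = e^(-s^alpha)] follows from the characteristic function:
   [Re exp (- c v^alpha - y v)] is harmonic in the right half plane, so its value at [s] is a mean of
   its values on the imaginary axis (taken on circles, after a conformal map of the disc).  With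
   [V = S Z^(1/alpha)] one gets [P (W > x V) = E e^(-x V) = E e^(-x^alpha Z) = P (G > x)], that is,
   [W / V] has the law of [G]; moreover [Lambda] has the law of [X sqrt (2 W)]. *)
Require Import Defs.
From HB Require Import structures.
From mathcomp Require Import all_boot all_order all_algebra.
From mathcomp Require Import all_classical all_reals all_analysis.
From mathcomp Require Import measurable_realfun ring lra.
Set Implicit Arguments. Unset Strict Implicit. Unset Printing Implicit Defensive.
Import Order.TTheory GRing.Theory Num.Theory Num.Def.
Import numFieldNormedType.Exports.
Local Open Scope classical_set_scope.
Local Open Scope ring_scope.

(** * Independence and densities *)

(** The characteristic function of S gives no direct access to its sign. Averaging a cosine over the
    boundary values of the conformal map produces e^(-s |x|), so the mean value formula first yields
    E e^(-s |S + y|) = e^(-(s^alpha + y s)), and the shift y >= 0 is carried along only to force S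
    >= 0 by comparing y = 0 with y = 1. Circles of radius below 1 keep every integrand smooth and
    every domain compact; the boundary is reached by dominated convergence, with bound 1.

    The random variables of the statement live on unrelated probability spaces. In (ii), laws are
    compared through their tails, and for the Laplace term both tails reduce to one explicit
    integral, [mixture_tail]. In (i), the replacement argument handles the functions v |-> E f(v +
    U) instead of the variables: independent sums become iterated averages, and averages over
    different spaces commute, so no product space carrying both the summands and the normal variable
    is formed. Likewise no Poisson variable is constructed: [gnb_pmf] is an average of Poisson
    weights, and only these weights are used. *)

Lemma measurable_preimageT d1 d2 (T1 : measurableType d1) (T2 : measurableType d2)
    (f : T1 -> T2) (B : set T2) :
  measurable_fun setT f -> measurable B -> measurable (f @^-1` B).
Proof. by move=> mf mB; rewrite -[X in measurable X]setTI; exact: mf. Qed.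

Lemma measurable_sqrt (R : realType) : measurable_fun setT (Num.sqrt : R -> R).
Proof. by apply: continuous_measurable_fun; exact: sqrt_continuous. Qed.

Section independence.
Context {R : realType} {d : measure_display} {T : measurableType d}.
Variable P : probability T R.

Definition indep2 d1 d2 (T1 : measurableType d1) (T2 : measurableType d2)
    (U : T -> T1) (V : T -> T2) :=
  forall A B, measurable A -> measurable B ->
    P (U @^-1` A `&` V @^-1` B) = (P (U @^-1` A) * P (V @^-1` B))%E.

Section pairs.
Context d1 d2 (T1 : measurableType d1) (T2 : measurableType d2).
Variables (U : T -> T1) (V : T -> T2).
Hypotheses (mU : measurable_fun setT U) (mV : measurable_fun setT V).

Let U' : {mfun T >-> T1} := HB.pack U (isMeasurableFun.Build _ _ _ _ U mU).
Let V' : {mfun T >-> T2} := HB.pack V (isMeasurableFun.Build _ _ _ _ V mV).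
Let mUV : measurable_fun setT (fun w => (U w, V w)).
Proof. exact/measurable_fun_pair. Qed.
Let UV' : {mfun T >-> (T1 * T2)%type} :=
  HB.pack (fun w => (U w, V w)) (isMeasurableFun.Build _ _ _ _ _ mUV).

(** The law of the pair agrees with the product of the marginal laws on rectangles, hence
    everywhere; Tonelli then separates the variables. Both integrals range over the same space, so
    conditioning on [U] amounts to freezing [w]. *)
Lemma indep2_integral (f : T1 * T2 -> \bar R) : indep2 U V ->
  measurable_fun setT f -> (forall x, 0 <= f x)%E ->
  (\int[P]_w f (U w, V w) = \int[P]_w \int[P]_w' f (U w, V w'))%E.
Proof.
move=> iUV mf f0.
transitivity (\int[P]_w (f \o UV') w)%E; first by [].
rewrite -(@ge0_integral_distribution _ _ _ _ _ P UV' _ mf f0).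
rewrite (@eq_measure_integral _ _ _ _ (distribution P U' \x distribution P V')%E); last first.
  move=> A mA _; apply/esym.
  by apply: (@product_measure_unique _ _ _ _ R (distribution P U') (distribution P V')
    (distribution P UV') (fun B C => @iUV B C) A mA).
rewrite fubini_tonelli1// ge0_integral_distribution//; last 2 first.
- exact: measurable_fun_fubini_tonelli_F.
- by move=> x; apply: integral_ge0 => y _; exact: f0.
apply: eq_integral => w _ /=.
rewrite /fubini_F ge0_integral_distribution//.
exact: measurableT_comp.
Qed.

End pairs.

Section family.
Context (I : choiceType) (Y : I -> T -> R).
Hypothesis mY : forall i, measurable_fun setT (Y i).

Definition evt (K : seq I) (B : I -> set R) :=
  \bigcap_(i in [set i | i \in K]) (Y i @^-1` B i).

Lemma measurable_evt K B : (forall i, measurable (B i)) -> measurable (evt K B).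
Proof.
move=> mB; have -> : evt K B = \big[setI/setT]_(i <- K) (Y i @^-1` B i) by exact: bigcap_seq.
apply: bigsetI_measurable => i _.
by apply: (measurable_preimageT (mY i)).
Qed.

(** Think of [U] as built from the coordinates listed in [J]. Independence from all other
    coordinates jointly is an invariant that survives composition and the adjunction of one more
    coordinate, so compound variables can be built up one factor at a time. *)
Definition indep_outside d1 (T1 : measurableType d1) (J : seq I) (U : T -> T1) :=
  forall (K : seq I) (B : I -> set R), uniq K -> (forall i, measurable (B i)) ->
    {in K, forall k, k \notin J} -> forall A, measurable A ->
    P (U @^-1` A `&` evt K B) = (P (U @^-1` A) * P (evt K B))%E.

Lemma indep_outside_cst d1 (T1 : measurableType d1) (c : T1) :
  indep_outside [::] (fun=> c).
Proof.
move=> K B _ _ _ A _; have [cA|ncA] := pselect (A c).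
  rewrite (_ : _ @^-1` A = setT) ?setTI ?probability_setT ?mul1e//.
  by apply/seteqP; split.
rewrite (_ : _ @^-1` A = set0) ?set0I ?measure0 ?mul0e//.
by apply/seteqP; split.
Qed.

Lemma indep_outside_comp d1 d2 (T1 : measurableType d1) (T2 : measurableType d2)
    J (U : T -> T1) (g : T1 -> T2) : measurable_fun setT g ->
  indep_outside J U -> indep_outside J (g \o U).
Proof.
move=> mg iU K B uK mB KJ A mA; rewrite -[(g \o U) @^-1` A]/(U @^-1` (g @^-1` A)) iU//.
by apply: (measurable_preimageT mg).
Qed.

Lemma evt1 i B : evt [:: i] B = Y i @^-1` B i.
Proof.
rewrite /evt (_ : [set _ | _] = [set i]) ?bigcap_set1//.
by apply/seteqP; split => x /=; rewrite inE => /eqP.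
Qed.

Lemma indep_outside_indep2 d1 (T1 : measurableType d1) J (U : T -> T1) i :
  indep_outside J U -> i \notin J -> indep2 U (Y i).
Proof.
move=> iU iJ A B mA mB; have := iU [:: i] (fun=> B) isT (fun=> mB).
rewrite evt1 => -> // k; by rewrite inE => /eqP ->.
Qed.

Hypothesis indepY : mutually_independent P Y.

(** Both sides are finite measures in the set tested by the pair. They agree on rectangles, where
    the event on [Y i] can be moved into the event on the family, and a measure on a product is
    determined by rectangles. *)
Lemma indep_outside_pair d1 (T1 : measurableType d1) J (U : T -> T1) i :
  measurable_fun setT U ->
  indep_outside J U -> i \notin J -> indep_outside (i :: J) (fun w => (U w, Y i w)).
Proof.
move=> mU iU iJ K B uK mB KJ C mC.
have mE : measurable (evt K B) by exact: measurable_evt.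
have mUY : measurable_fun setT (fun w => (U w, Y i w)).
  by apply/measurable_fun_pair => //; exact: mY.
pose U' : {mfun T >-> T1} := HB.pack U (isMeasurableFun.Build _ _ _ _ U mU).
pose V' : {mfun T >-> R} := HB.pack (Y i) (isMeasurableFun.Build _ _ _ _ (Y i) (@mY i)).
pose UV : {mfun T >-> (T1 * R)%type} :=
  HB.pack (fun w => (U w, Y i w)) (isMeasurableFun.Build _ _ _ _ _ mUY).
have iK : i \notin K by apply/negP => /KJ; rewrite inE eqxx.
have i2 := indep_outside_indep2 iU iJ.
have PE0 : P (evt K B) \is a fin_num by exact: fin_num_measure.
pose c : {nonneg R} := NngNum (fine_ge0 (measure_ge0 P (evt K B))).
(* The factor P([evt K B]) is absorbed in the first marginal, so that the target is again a product
   measure; [m2] is the law of the pair restricted to [evt K B]. *)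
pose m1 := mscale c (distribution P U').
pose m2 := pushforward (mrestr P mE) UV.
have rect A D : measurable A -> measurable D ->
    m2 (A `*` D) = (m1 A * distribution P V' D)%E.
  move=> mA mD; rewrite /m2 /pushforward /mrestr /=.
  (* Putting [D] at index [i] turns the constraint on [Y i] into one more member of the family event
     over [i :: K], to which the hypothesis on [U] applies. *)
  pose B' j := if j == i then D else B j.
  have -> : UV @^-1` (A `*` D) `&` evt K B = U @^-1` A `&` evt (i :: K) B'.
    apply/seteqP; split => w /=.
      move=> [[Uw Yw] Ew]; split => // j /=; rewrite inE => /orP[/eqP ->|jK].
        by rewrite /B' eqxx.
      rewrite /B'; case: eqP => [ji|_]; last exact: Ew.
      by rewrite -ji jK in iK.
    move=> [Uw Ew]; split; first split => //.
      by have := Ew i; rewrite /= /B' eqxx => /(_ (mem_head _ _)).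
    move=> j /= jK; have := Ew j; rewrite /= inE jK orbT /B' => /(_ isT).
    by case: eqP => // ji; rewrite -ji jK in iK.
  have mB' j : measurable (B' j) by rewrite /B'; case: ifP.
  rewrite iU//=; last 2 first.
  - by rewrite iK.
  - move=> k; rewrite inE => /orP[/eqP -> //|/KJ]; by rewrite inE negb_or => /andP[].
  have -> : P (evt (i :: K) B') = (P (Y i @^-1` D) * P (evt K B))%E.
    rewrite /evt indepY//= ?iK//= big_cons {1}/B' eqxx indepY//; congr (_ * _)%E.
    rewrite !big_seq; apply: eq_bigr => j jK; rewrite /B'; case: eqP => // ji.
    by rewrite -ji jK in iK.
  rewrite /m1 /mscale /= fineK//= /distribution /pushforward /=.
  by rewrite muleCA [RHS]muleC; congr (_ * _)%E; exact: muleC.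
have H := @product_measure_unique _ _ _ _ R m1 (distribution P V') m2 rect C mC.
have H' := @product_measure_unique _ _ _ _ R (distribution P U') (distribution P V')
   (distribution P UV) (fun A B => i2 A B) C mC.
transitivity (m2 C); first by [].
apply: (etrans (esym (H mUY))).
transitivity (distribution P UV C * P (evt K B))%E; last by [].
rewrite -[distribution P UV C]H' muleC -[X in (X * _)%E](@fineK _ (P (evt K B)))//.
transitivity (mscale c (distribution P U' \x distribution P V')%E C); last by [].
apply: (@product_measure_unique _ _ _ _ R m1 (distribution P V')
  (mscale c (distribution P U' \x distribution P V')%E)) => //.
move=> A D mA mD /=; rewrite /mscale /m1 /= /mscale /= product_measure1E//.
by rewrite muleA.
Qed.

End family.
End independence.

Section density.
Local Open Scope ereal_scope.
Context {d : measure_display} {T : measurableType d} {R : realType}.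
Variables (mu nu : {measure set T -> \bar R}) (f : T -> R).
Hypotheses (mf : measurable_fun setT f) (f0 : forall x, (0 <= f x)%R).
Hypothesis nuE : forall B, measurable B -> nu B = \int[mu]_(x in B) (f x)%:E.

Import HBNNSimple.

Let integral_density_nnsfun (h : {nnsfun T >-> R}) :
  \int[nu]_x (h x)%:E = \int[mu]_x ((h x)%:E * (f x)%:E).
Proof.
under [LHS]eq_integral do rewrite fimfunE -fsumEFin//.
rewrite [LHS]ge0_integral_fsum//; last 2 first.
- by move=> r; exact/measurable_EFinP/measurableT_comp.
- by move=> n x _; rewrite EFinM nnfun_muleindic_ge0.
under [RHS]eq_integral.
  move=> x xD; rewrite muleC fimfunE -fsumEFin// ge0_mule_fsumr; last first.
    by move=> r; exact: (nnfun_muleindic_ge0 h r x).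
  over.
rewrite [RHS]ge0_integral_fsum//; last 2 first.
- move=> r; apply: emeasurable_funM; first exact/measurable_EFinP.
  exact/measurable_EFinP/measurableT_comp.
- by move=> n x _; apply: mule_ge0; [rewrite lee_fin|exact: (nnfun_muleindic_ge0 h n x)].
apply: eq_fsbigr => r _.
have [r0|r0] := leP 0%R r; last first.
  have -> : h @^-1` [set r] = set0.
    by apply/seteqP; split => // x /= hx; move: r0; rewrite -hx ltNge fun_ge0.
  rewrite [LHS]integral0_eq; last by move=> x _; rewrite indic0 mulr0.
  by rewrite [RHS]integral0_eq// => x _; rewrite indic0 mulr0 mule0.
under eq_integral do rewrite EFinM.
rewrite ge0_integralZl//; last exact/measurable_EFinP.
rewrite integral_indic// setIT.
under [RHS]eq_integral do rewrite EFinM muleCA.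
rewrite ge0_integralZl//; last 2 first.
- by apply: emeasurable_funM; exact/measurable_EFinP.
- by move=> x _; rewrite mule_ge0// lee_fin.
congr (_ * _); rewrite nuE// integral_mkcond; apply: eq_integral => x _.
by rewrite patchE indicE; case: ifPn; rewrite ?mule1 ?mule0.
Qed.

(** Monotone convergence along the simple approximations of [g], on both sides. *)
Lemma ge0_integral_density (g : T -> \bar R) :
  measurable_fun setT g -> (forall x, 0 <= g x) ->
  \int[nu]_x g x = \int[mu]_x (g x * (f x)%:E).
Proof.
move=> mg g0; pose g_ := nnsfun_approx measurableT mg.
transitivity (lim (\int[nu]_x (g_ n x)%:E @[n --> \oo])).
  rewrite -monotone_convergence//=.
  - apply: eq_integral => ? /[!inE] xD; apply/esym/cvg_lim => //=.
    exact: cvg_nnsfun_approx.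
  - by move=> n; exact/measurable_EFinP/measurable_funTS.
  - by move=> n ? _; rewrite lee_fin.
  - by move=> ? _ ? ? mn; rewrite lee_fin; exact/lefP/nd_nnsfun_approx.
transitivity (lim (\int[mu]_x ((g_ n x)%:E * (f x)%:E) @[n --> \oo])).
  by apply: congr_lim; apply/funext => n; exact: integral_density_nnsfun.
rewrite -monotone_convergence//=.
- apply: eq_integral => x _; apply/cvg_lim => //.
  by apply: cvgeZr => //; exact: cvg_nnsfun_approx.
- move=> n; apply: emeasurable_funM; last exact/measurable_EFinP.
  exact/measurable_EFinP/measurable_funTS.
- by move=> n ? _; rewrite mule_ge0// lee_fin.
- move=> x _ m n mn; rewrite lee_wpmul2r ?lee_fin//.
  exact/lefP/nd_nnsfun_approx.
Qed.

End density.

Section has_pdf_integral.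
Local Open Scope ereal_scope.
Context {R : realType} {d : measure_display} {T : measurableType d}.
Variable P : probability T R.

Lemma has_pdf_integral (Y : {RV P >-> R}) (f : R -> R) (g : R -> \bar R) :
  measurable_fun setT f -> (forall x, (0 <= f x)%R) -> has_pdf P Y f ->
  measurable_fun setT g -> (forall x, 0 <= g x) ->
  \int[P]_w g (Y w) = \int[lebesgue_measure]_x (g x * (f x)%:E).
Proof.
move=> mf f0 Yf mg g0.
(* Lebesgue measure lives on [measurableTypeR R]; giving [Y] this codomain puts its law and Lebesgue
   measure on the same type. *)
have mY : measurable_fun setT (Y : T -> measurableTypeR R).
  exact: (@measurable_funPT _ _ _ _ Y).
pose Y' : {mfun T >-> measurableTypeR R} :=
  HB.pack (Y : T -> measurableTypeR R) (isMeasurableFun.Build _ _ _ _ _ mY).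
rewrite -(@ge0_integral_distribution _ _ _ _ _ P Y' _ mg g0).
exact: (@ge0_integral_density _ _ R lebesgue_measure (distribution P Y') f).
Qed.

Lemma has_pdf_integral1 (Y : {RV P >-> R}) (f : R -> R) : has_pdf P Y f ->
  \int[lebesgue_measure]_x (f x)%:E = 1.
Proof. by move=> /(_ setT measurableT) <-; rewrite preimage_setT probability_setT. Qed.

End has_pdf_integral.

(** * Mean values of a harmonic function *)

Section pointwise_derivatives.
Context {R : realType}.
Implicit Types (f g : R -> R) (x a b c : R).

Lemma is_derive_derivable f x a : is_derive x 1 f a -> derivable f x 1.
Proof. by case. Qed.

Lemma is_derive_cvg f x a : is_derive x 1 f a -> f t @[t --> x] --> f x.
Proof. by case=> df _; exact/differentiable_continuous/derivable1_diffP. Qed.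

Lemma der_cst x c : is_derive x 1 (fun _ : R => c) 0.
Proof. exact: is_derive_cst. Qed.

Lemma der_id x : is_derive x 1 (fun t : R => t) 1.
Proof. exact: is_derive_id. Qed.

Lemma derD f g x a b : is_derive x 1 f a -> is_derive x 1 g b ->
  is_derive x 1 (fun t => f t + g t) (a + b).
Proof. by move=> ? ?; exact: is_deriveD. Qed.

Lemma derN f x a : is_derive x 1 f a -> is_derive x 1 (fun t => - f t) (- a).
Proof. by move=> ?; exact: is_deriveN. Qed.

Lemma derM f g x a b : is_derive x 1 f a -> is_derive x 1 g b ->
  is_derive x 1 (fun t => f t * g t) (a * g x + f x * b).
Proof.
move=> ? ?; apply: (is_derive_eq (is_deriveM _ _)).
by rewrite addrC mulrC.
Qed.

Lemma derX f n x a : is_derive x 1 f a ->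
  is_derive x 1 (fun t => f t ^+ n) (n%:R * f x ^+ n.-1 * a).
Proof.
move=> ?; rewrite (_ : (fun t => f t ^+ n) = f ^+ n); first exact: is_deriveX.
by apply/funext => t; rewrite exprfctE.
Qed.

Lemma derV f x a : f x != 0 -> is_derive x 1 f a ->
  is_derive x 1 (fun t => (f t)^-1) (- a / f x ^+ 2).
Proof.
move=> ? ?; apply: (is_derive_eq (is_deriveV _ _)) => //.
by rewrite /GRing.scale /= mulrC mulrN mulNr.
Qed.

Lemma der_inv x : x != 0 -> is_derive x 1 (@GRing.inv R) (- 1 / x ^+ 2).
Proof. by move=> x0; apply: (@derV (fun t => t)) => //; exact: der_id. Qed.

Lemma der_expR f x a : is_derive x 1 f a ->
  is_derive x 1 (fun t => expR (f t)) (expR (f x) * a).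
Proof. by move=> ?; exact: is_derive1_comp. Qed.

Lemma der_cos f x a : is_derive x 1 f a ->
  is_derive x 1 (fun t => cos (f t)) (- sin (f x) * a).
Proof. by move=> ?; exact: is_derive1_comp. Qed.

Lemma der_sin f x a : is_derive x 1 f a ->
  is_derive x 1 (fun t => sin (f t)) (cos (f x) * a).
Proof. by move=> ?; exact: is_derive1_comp. Qed.

Lemma der_atan f x a : is_derive x 1 f a ->
  is_derive x 1 (fun t => atan (f t)) ((1 + f x ^+ 2)^-1 * a).
Proof. by move=> ?; exact: is_derive1_comp. Qed.

Lemma der_ln f x a : 0 < f x -> is_derive x 1 f a ->
  is_derive x 1 (fun t => ln (f t)) ((f x)^-1 * a).
Proof. by move=> f0 ?; exact: (is_derive1_comp (is_derive1_ln f0)). Qed.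

Lemma der_powR f c x a : 0 < f x -> is_derive x 1 f a ->
  is_derive x 1 (fun t => f t `^ c) (c * f x `^ (c - 1) * a).
Proof.
move=> f0 df; have := is_derive1_powR c f0 => /is_derive1_comp dp.
exact: dp.
Qed.

End pointwise_derivatives.

(** Differentiation by syntax, the derivative being left as an existential variable. Functions of
    unknown shape are closed by a hypothesis; the nonvanishing and positivity conditions of
    quotients, logarithms and powers remain as goals. *)
Ltac der := repeat lazymatch goal with
  | |- is_derive _ _ (fun _ => ?c) _ => eapply der_cst
  | |- is_derive _ _ (fun t => t) _ => eapply der_id
  | |- is_derive _ _ (fun t => GRing.add (@?f t) (@?g t)) _ => eapply derD
  | |- is_derive _ _ (fun t => GRing.opp (@?f t)) _ => eapply derN
  | |- is_derive _ _ (fun t => GRing.mul (@?f t) (@?g t)) _ => eapply derM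
  | |- is_derive _ _ (fun t => GRing.exp (@?f t) _) _ => eapply derX
  | |- is_derive _ _ (fun t => GRing.inv (@?f t)) _ => eapply derV
  | |- is_derive _ _ (fun t => expR (@?f t)) _ => eapply der_expR
  | |- is_derive _ _ (fun t => cos (@?f t)) _ => eapply der_cos
  | |- is_derive _ _ (fun t => sin (@?f t)) _ => eapply der_sin
  | |- is_derive _ _ (fun t => atan (@?f t)) _ => eapply der_atan
  | |- is_derive _ _ (fun t => ln (@?f t)) _ => eapply der_ln
  | |- is_derive _ _ (fun t => powR (@?f t) _) _ => eapply der_powR
  | |- is_derive _ _ (GRing.mul ?c) _ => eapply (derM (der_cst _ c) (der_id _))
  | |- is_derive _ _ (GRing.add ?c) _ => eapply (derD (der_cst _ c) (der_id _))
  | |- is_derive _ _ GRing.opp _ => eapply (derN (der_id _))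
  | |- is_derive _ _ GRing.inv _ => eapply der_inv
  | |- is_derive _ _ expR _ => eapply (der_expR (der_id _))
  | |- is_derive _ _ cos _ => eapply (der_cos (der_id _))
  | |- is_derive _ _ sin _ => eapply (der_sin (der_id _))
  | |- is_derive _ _ _ _ => eassumption
  end.

Section circle.
Context {R : realType}.
Variables (s alpha c y : R).
Hypotheses (s0 : 0 < s) (a0 : 0 < alpha) (a1 : alpha <= 1) (c0 : 0 <= c) (y0 : 0 <= y).
Implicit Types (r t : R).

(* [logmod r t + i arg r t] is the logarithm of [s (1 + z) / (1 - z)] at [z = r e^(i t)]: a
   conformal map of the unit disc onto the right half plane sending 0 to s. *)
Let dp r t := 1 + r ^+ 2 + 2 * r * cos t.
Let dm r t := 1 + r ^+ 2 - 2 * r * cos t.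
Definition logmod r t := ln s + 2^-1 * (ln (dp r t) - ln (dm r t)).
Definition arg r t := atan (2 * r * sin t / (1 - r ^+ 2)).

(** With z = r e^(i t), [dp] and [dm] are |1 + z|^2 and |1 - z|^2, and (1 + z)(1 - conj z) = (1 -
    r^2) + 2 i r sin t. The identity is the squared modulus of this product, whose argument is
    [arg]. *)
Let dpdm r t : dp r t * dm r t = (1 - r ^+ 2) ^+ 2 + (2 * r * sin t) ^+ 2.
Proof. by have := cos2Dsin2 t; rewrite /dp /dm; move: (cos t) (sin t) => a b; nra. Qed.

Let sq_lt1 r : -1 < r < 1 -> 0 < 1 - r ^+ 2.
Proof. by move=> /andP[]; nra. Qed.

Let dp_gt0 r t : -1 < r < 1 -> 0 < dp r t.
Proof.
move=> /andP[r1 r2]; have := cos_geN1 t; have := cos_le1 t; rewrite /dp.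
move: (cos t) => a a1' aN1.
have p1 : 0 < (1 - r) ^+ 2 by rewrite exprn_gt0// subr_gt0.
have p2 : 0 < (1 + r) ^+ 2 by rewrite exprn_gt0//; lra.
by case: (lerP 0 r) => r0; nra.
Qed.

Let dm_gt0 r t : -1 < r < 1 -> 0 < dm r t.
Proof.
move=> r1; have := @dp_gt0 (- r) t; rewrite /dp /dm sqrrN mulrN mulNr; apply.
by move: r1 => /andP[? ?]; apply/andP; split; lra.
Qed.

(** Real and imaginary parts of the radial derivative of log((1 + z) / (1 - z)). The next four
    lemmas are the polar Cauchy-Riemann equations: the angular derivatives are [- (r * Tr)] and
    [r * Lr]. *)
Let Lr r t := 2 * cos t * (1 - r ^+ 2) / (dp r t * dm r t).
Let Tr r t := 2 * sin t * (1 + r ^+ 2) / (dp r t * dm r t).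

Let der_logmod_r r t : -1 < r < 1 -> is_derive r 1 (logmod ^~ t) (Lr r t).
Proof.
move=> r1; have P := dp_gt0 t r1; have M := dm_gt0 t r1.
rewrite /logmod /dp /dm; eapply is_derive_eq; first by der.
rewrite /Lr; move: (lt0r_neq0 P) (lt0r_neq0 M); rewrite /dp /dm => P0 M0.
rewrite /=; field; exact/andP.
Qed.

Let der_logmod_t r t : -1 < r < 1 -> is_derive t 1 (logmod r) (- (r * Tr r t)).
Proof.
move=> r1; have P := dp_gt0 t r1; have M := dm_gt0 t r1.
rewrite /logmod /dp /dm; eapply is_derive_eq; first by der.
rewrite /Tr; move: (lt0r_neq0 P) (lt0r_neq0 M); rewrite /dp /dm => P0 M0.
rewrite /=; field; exact/andP.
Qed.

Let den_neq0 r t : -1 < r < 1 -> (1 - r ^+ 2) ^+ 2 + (2 * r * sin t) ^+ 2 != 0.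
Proof. by move=> r1; apply: lt0r_neq0; rewrite ltr_pwDl ?exprn_gt0 ?sq_lt1 ?sqr_ge0. Qed.

Let der_arg_r r t : -1 < r < 1 -> is_derive r 1 (arg ^~ t) (Tr r t).
Proof.
move=> r1; have /lt0r_neq0 Q := sq_lt1 r1; have D := den_neq0 t r1.
rewrite /arg; eapply is_derive_eq; first by der.
by rewrite /Tr dpdm /=; field; rewrite Q D.
Qed.

Let der_arg_t r t : -1 < r < 1 -> is_derive t 1 (arg r) (r * Lr r t).
Proof.
move=> r1; have /lt0r_neq0 Q := sq_lt1 r1; have D := den_neq0 t r1.
rewrite /arg; eapply is_derive_eq; first by der.
by rewrite /Lr dpdm /=; field; rewrite Q D.
Qed.

(* [repart a b] and [impart a b] are the real and imaginary parts of [c v^alpha + y v] at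
   [v = e^(a + i b)]. *)
Definition repart a b := c * expR (alpha * a) * cos (alpha * b) + y * expR a * cos b.
Definition impart a b := c * expR (alpha * a) * sin (alpha * b) + y * expR a * sin b.
Let drepart a b a' b' : R := c * alpha * expR (alpha * a) * (a' * cos (alpha * b) - b' * sin (alpha * b))
  + y * expR a * (a' * cos b - b' * sin b).
Let dimpart a b a' b' : R := c * alpha * expR (alpha * a) * (a' * sin (alpha * b) + b' * cos (alpha * b))
  + y * expR a * (a' * sin b + b' * cos b).

Let der_repart (f g : R -> R) (x a' b' : R) :
  is_derive x 1 f a' -> is_derive x 1 g b' ->
  is_derive x 1 (fun t => repart (f t) (g t)) (drepart (f x) (g x) a' b').
Proof.
move=> df dg; rewrite /repart; eapply is_derive_eq; first by der.
by rewrite /drepart; ring.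
Qed.

Let der_impart (f g : R -> R) (x a' b' : R) :
  is_derive x 1 f a' -> is_derive x 1 g b' ->
  is_derive x 1 (fun t => impart (f t) (g t)) (dimpart (f x) (g x) a' b').
Proof.
move=> df dg; rewrite /impart; eapply is_derive_eq; first by der.
by rewrite /dimpart; ring.
Qed.

(** Real part of the holomorphic function e^(-(c v^alpha + y v)) pulled back to the disc; [him] is
    its imaginary part and [hre_r] its radial derivative. *)
Definition hre r t := expR (- repart (logmod r t) (arg r t)) * cos (impart (logmod r t) (arg r t)).
Let him r t := - (expR (- repart (logmod r t) (arg r t)) * sin (impart (logmod r t) (arg r t))).
Let hre_r r t := expR (- repart (logmod r t) (arg r t)) *
  (- drepart (logmod r t) (arg r t) (Lr r t) (Tr r t) * cos (impart (logmod r t) (arg r t))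
   - dimpart (logmod r t) (arg r t) (Lr r t) (Tr r t) * sin (impart (logmod r t) (arg r t))).

Let der_hre r t : -1 < r < 1 -> is_derive r 1 (hre ^~ t) (hre_r r t).
Proof.
move=> r1; rewrite /hre.
have dP := der_repart (der_logmod_r t r1) (der_arg_r t r1).
have dQ := der_impart (der_logmod_r t r1) (der_arg_r t r1).
apply: (is_derive_eq (derM (der_expR (derN dP)) (der_cos dQ))).
by rewrite /hre_r; ring.
Qed.

(** A Cauchy-Riemann equation again: it makes [r * hre_r] an exact angular derivative, so that its
    integral over an arc is a difference of boundary values. *)
Let der_him r t : -1 < r < 1 -> is_derive t 1 (him r) (r * hre_r r t).
Proof.
move=> r1; rewrite /him.
have dP := der_repart (der_logmod_t t r1) (der_arg_t t r1).
have dQ := der_impart (der_logmod_t t r1) (der_arg_t t r1).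
apply: (is_derive_eq (derN (derM (der_expR (derN dP)) (der_sin dQ)))).
by rewrite /hre_r /drepart /dimpart; ring.
Qed.

Let arg_lt r t : - (pi / 2) < arg r t < pi / 2.
Proof. by rewrite /arg atan_gtNpi2 atan_ltpi2. Qed.

(** For [alpha <= 1] the power v^alpha stays in the right half plane together with v. Hence the
    exponential is bounded by 1, which is the domination for the passage to the boundary. *)
Lemma repart_ge0 a b : - (pi / 2) <= b <= pi / 2 -> 0 <= repart a b.
Proof.
move=> /andP[b1 b2]; have ca : 0 <= cos (alpha * b).
  apply: cos_ge0_pihalf; rewrite -ler_norml normrM (gtr0_norm a0).
  by rewrite (@le_trans _ _ `|b|) ?ler_piMl// ler_norml b1.
have cb : 0 <= cos b by apply: cos_ge0_pihalf; rewrite b1.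
by rewrite addr_ge0 ?mulr_ge0 ?expR_ge0.
Qed.

Lemma hre_le1 r t : `|hre r t| <= 1.
Proof.
rewrite normrM ger0_norm ?expR_ge0// mulr_ile1 ?expR_ge0//.
  rewrite -[leRHS]expR0 ler_expR oppr_le0 repart_ge0//.
  by have /andP[? ?] := arg_lt r t; rewrite !ltW.
by rewrite ler_norml cos_geN1 cos_le1.
Qed.

Let hre_r_bound (r1 : R) : 0 < r1 < 1 ->
  exists K, forall r t, -r1 < r < r1 -> `|hre_r r t| <= K.
Proof.
move=> /andP[r0 r1lt].
(* For |r| < r1 both |1 + z|^2 and |1 - z|^2 lie between [e] and 4. This gives the bound [L] on
   [logmod] and the bound [M] on [Lr] and [Tr]; then [K] bounds the derivatives of the real and
   imaginary parts of the exponent. *)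
pose e := (1 - r1) ^+ 2.
have e0 : 0 < e by rewrite exprn_gt0// subr_gt0.
pose L := ln s + 2^-1 * (ln 4 - ln e).
pose M := 4 / (e * e).
pose K := c * alpha * expR (alpha * L) * (2 * M) + y * expR L * (2 * M).
exists (2 * K).
move=> r t /andP[ra rb].
have rr : -1 < r < 1 by lra.
have dple : dp r t <= 4.
  have := cos_geN1 t; have := cos_le1 t; rewrite /dp; move: (cos t) => a ? ?.
  by case: (lerP 0 r) => ?; nra.
have edp : e <= dp r t.
  have := cos_geN1 t; have := cos_le1 t; rewrite /dp /e; move: (cos t) => a ? ?.
  by case: (lerP 0 r) => ?; nra.
have edm : e <= dm r t.
  have := cos_geN1 t; have := cos_le1 t; rewrite /dm /e; move: (cos t) => a ? ?.
  by case: (lerP 0 r) => ?; nra.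
have lL : logmod r t <= L.
  rewrite /logmod /L lerD2l ler_wpM2l ?invr_ge0// lerB// ler_ln ?posrE//.
  - exact: dp_gt0.
  - exact: dm_gt0.
have ee : (dp r t * dm r t)^-1 <= (e * e)^-1.
  have ded : 0 < dp r t * dm r t by rewrite mulr_gt0 ?dp_gt0 ?dm_gt0.
  rewrite lef_pV2 ?posrE ?(mulr_gt0 e0 e0)//.
  by apply: ler_pM; rewrite // ltW.
have i0 : 0 <= (dp r t * dm r t)^-1 by rewrite invr_ge0 mulr_ge0// ltW ?dp_gt0 ?dm_gt0.
have bL : `|Lr r t| <= M.
  rewrite /Lr normrM [`|_^-1|]ger0_norm// /M ler_pM//.
  rewrite ler_norml; have := cos_geN1 t; have := cos_le1 t; move: (cos t) => a ? ?.
  by apply/andP; split; nra.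
have bT : `|Tr r t| <= M.
  rewrite /Tr normrM [`|_^-1|]ger0_norm// /M ler_pM//.
  rewrite ler_norml; have := sin_geN1 t; have := sin_le1 t; move: (sin t) => a ? ?.
  by apply/andP; split; nra.
have trig z : `|cos z| <= 1 by rewrite ler_norml cos_geN1 cos_le1.
have trig' z : `|sin z| <= 1 by rewrite ler_norml sin_geN1 sin_le1.
have comb a b a' b' : `|a| <= M -> `|b| <= M -> `|a'| <= 1 -> `|b'| <= 1 ->
    `|a * a' + b * b'| <= 2 * M.
  move=> aM bM a'1 b'1; rewrite (le_trans (ler_normD _ _))// !normrM.
  have : `|a| * `|a'| <= M * 1 by rewrite ler_pM.
  have : `|b| * `|b'| <= M * 1 by rewrite ler_pM.
  by lra.
set z := logmod r t; set b := arg r t.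
have outer p1 p2 : `|p1| <= 2 * M -> `|p2| <= 2 * M ->
    `|c * alpha * expR (alpha * z) * p1 + y * expR z * p2| <= K.
  move=> h1 h2; rewrite (le_trans (ler_normD _ _))// lerD//.
    rewrite normrM; apply: ler_pM => //; rewrite ger0_norm; last first.
      by rewrite !mulr_ge0 ?expR_ge0// ltW.
    apply: ler_wpM2l; first by rewrite mulr_ge0// ltW.
    by rewrite ler_expR ler_wpM2l// ltW.
  rewrite normrM; apply: ler_pM => //; rewrite ger0_norm ?mulr_ge0 ?expR_ge0//.
  by rewrite ler_wpM2l ?ler_expR.
have h1 : `|drepart z b (Lr r t) (Tr r t)| <= K.
  by apply: outer; rewrite -mulrN; apply: comb;
    by [exact: bL|exact: bT|exact: trig|rewrite normrN; exact: trig'].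
have h2 : `|dimpart z b (Lr r t) (Tr r t)| <= K.
  by apply: outer; apply: comb; by [exact: bL|exact: bT|exact: trig|exact: trig'].
rewrite /hre_r -/z -/b normrM.
apply: (@le_trans _ _ (1 * (K + K))); last by lra.
apply: ler_pM => //.
  rewrite ger0_norm ?expR_ge0// -[leRHS]expR0 ler_expR oppr_le0 repart_ge0//.
  by have /andP[? ?] := arg_lt r t; rewrite !ltW.
apply: (le_trans (ler_normB _ _)); apply: lerD; rewrite normrM ?normrN -[leRHS]mulr1.
  by apply: ler_pM => //; exact: trig.
by apply: ler_pM => //; exact: trig'.
Qed.

Let mu := @lebesgue_measure R.

Let within_cont_int (f : R -> R) (a b : R) : {in `[a, b], forall t, derivable f t 1} ->
  mu.-integrable `[a, b] (EFin \o f).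
Proof.
move=> df; apply: continuous_compact_integrable; first exact: segment_compact.
exact: derivable_within_continuous.
Qed.

Let derivable_hre_t r t : -1 < r < 1 -> derivable (hre r) t 1.
Proof.
move=> r1; rewrite /hre.
have dP := der_repart (der_logmod_t t r1) (der_arg_t t r1).
have dQ := der_impart (der_logmod_t t r1) (der_arg_t t r1).
exact: (is_derive_derivable (derM (der_expR (derN dP)) (der_cos dQ))).
Qed.

Let der_dparts (f g f' g' : R -> R) (x a b a' b' : R) :
  is_derive x 1 f a -> is_derive x 1 g b -> is_derive x 1 f' a' -> is_derive x 1 g' b' ->
  derivable (fun t => drepart (f t) (g t) (f' t) (g' t)) x 1 /\
  derivable (fun t => dimpart (f t) (g t) (f' t) (g' t)) x 1.
Proof.
by move=> df dg df' dg'; split; rewrite /drepart /dimpart; eapply is_derive_derivable; der.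
Qed.

Let derivable_hre_r_t r t : -1 < r < 1 -> derivable (hre_r r) t 1.
Proof.
move=> r1; have dL := der_logmod_t t r1; have dA := der_arg_t t r1.
have PM : dp r t * dm r t != 0 by rewrite mulf_neq0// gt_eqF ?dp_gt0 ?dm_gt0.
have [dLr dTr] : derivable (Lr r) t 1 /\ derivable (Tr r) t 1.
  by split; rewrite /Lr /Tr /dp /dm; eapply is_derive_derivable; der; exact: PM.
have [/derivableP dP /derivableP dQ] :=
  der_dparts dL dA (derivableP dLr) (derivableP dTr).
have dRe := der_repart dL dA; have dIm := der_impart dL dA.
by rewrite /hre_r; eapply is_derive_derivable; der.
Qed.

Let mean r := (\int[mu]_(t in `[0, pi]) hre r t)%R.

Let intm_hre r : -1 < r < 1 -> mu.-integrable `[0, pi] (EFin \o hre r).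
Proof. by move=> r1; apply: within_cont_int => t _; exact: derivable_hre_t. Qed.

Let der_mean r : -1 < r < 1 -> is_derive r 1 mean (\int[mu]_(t in `[0, pi]) hre_r r t)%R.
Proof.
(* Halfway between |r| and 1: an interval around [r] on which the radial derivative is uniformly
   bounded, as differentiation under the integral demands. *)
move=> r1; pose r2 := (1 + `|r|) / 2.
have rn : `|r| < 1 by rewrite ltr_norml.
have r20 : 0 < r2 < 1 by apply/andP; split; rewrite /r2; have := normr_ge0 r; lra.
have rr2 : -r2 < r < r2 by rewrite -ltr_norml /r2; lra.
have [K HK] := hre_r_bound r20.
have sub x : `](- r2), r2[%classic x -> -1 < x < 1.
  by rewrite /= in_itv/= => /andP[? ?]; apply/andP; split; lra.
have d1 x t : `](- r2), r2[%classic x -> (partial1of2 hre) x t = hre_r x t.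
  by move=> /sub xx; rewrite partial1of2E; have [_ ->] := der_hre t xx.
have Kint : mu.-integrable `[0, pi] (EFin \o (fun _ : R => K)).
  by apply: within_cont_int => t _; exact: derivable_cst.
have K0 : 0 <= K by apply: le_trans (HK 0 0 _) => //; apply/andP; split; lra.
have I1 x : `](- r2), r2[%classic x -> mu.-integrable `[0, pi] (EFin \o hre x).
  by move=> /sub; exact: intm_hre.
have I2 x t : `](- r2), r2[%classic x -> `[0, pi]%classic t -> derivable (hre ^~ t) x 1.
  by move=> /sub xx _; have := der_hre t xx => /is_derive_derivable.
have I3 x t : `](- r2), r2[%classic x -> `[0, pi]%classic t -> `|(partial1of2 hre) x t| <= K.
  by move=> xx _; rewrite d1//; apply: HK; move: xx; rewrite /= in_itv.
have rI : `](- r2), r2[%classic r by rewrite /= in_itv.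
have mI : measurable (`[0, pi]%classic : set (measurableTypeR R)) by exact: measurable_itv.
apply: DeriveDef; first exact: (derivable_under_integral mI rI I1 I2 (fun=> K0) Kint I3).
rewrite -derive1E (differentiation_under_integral mI rI I1 I2 (fun=> K0) Kint I3).
by apply: eq_Rintegral => t _; rewrite d1.
Qed.

(** At t = 0 and t = pi the point z is real, so v is a positive real and the imaginary part [him]
    vanishes. This is why half circles already have constant means. The equation for [him] carries a
    factor r, hence the restriction to r > 0. *)
Let int_hre_r r : 0 < r < 1 -> (\int[mu]_(t in `[0, pi]) hre_r r t)%R = 0.
Proof.
move=> /andP[r0 rlt1]; have r1 : -1 < r < 1 by apply/andP; split; lra.
have I : mu.-integrable `[0, pi] (EFin \o hre_r r).
  by apply: within_cont_int => t _; exact: derivable_hre_r_t.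
apply: (@mulfI _ r); first exact: lt0r_neq0.
rewrite mulr0 -RintegralZl//.
have him0 t : sin t = 0 -> cos t ^+ 2 = 1 -> him r t = 0.
  by move=> st _; rewrite /him /impart /arg st !mulr0 mul0r atan0 !mulr0 sin0 !mulr0 addr0 sin0 mulr0 oppr0.
have dhim t : derivable (him r) t 1 by have := der_him t r1 => /is_derive_derivable.
have cw : {within `[0, pi], continuous (fun t : R => r * hre_r r t)}.
  apply: derivable_within_continuous => t _.
  have H := derM (der_cst t r) (derivableP (@derivable_hre_r_t r t r1)).
  exact: is_derive_derivable H.
have dw : derivable_oo_LRcontinuous (him r) 0 pi.
  split; first by move=> t _.
    by apply: cvg_at_right_filter; exact/differentiable_continuous/derivable1_diffP.
  by apply: cvg_at_left_filter; exact/differentiable_continuous/derivable1_diffP.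
have dd : {in `]0, pi[, derive1 (him r) =1 (fun t : R => r * hre_r r t)}.
  by move=> t _; rewrite derive1E; have [_ ->] := der_him t r1.
rewrite /Rintegral (continuous_FTC2 (pi_gt0 R) cw dw dd).
by rewrite !him0 ?sin0 ?cos0 ?sinpi ?cospi ?sqrrN ?expr1n// subee.
Qed.

(** The mean has zero derivative on ]0, r[, so it equals its value at radius 0, where v = s for
    every angle. *)
Lemma mean_hre r : 0 <= r < 1 ->
  (\int[mu]_(t in `[0, pi]) hre r t)%R = pi * expR (- (c * s `^ alpha + y * s)).
Proof.
move=> /andP[r0 r1].
have -> : (\int[mu]_(t in `[0, pi]) hre r t)%R = mean 0.
  move: r0; rewrite le_eqVlt => /predU1P[<-//|r0].
  have [x xr E] : exists2 x, x \in `]0, r[ & mean r - mean 0 =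
      (\int[mu]_(t in `[0, pi]) hre_r x t)%R * (r - 0).
    apply: MVT => //.
      by move=> x; rewrite in_itv/= => /andP[? ?]; apply: der_mean; apply/andP; split; lra.
    apply: derivable_within_continuous => x; rewrite in_itv/= => /andP[x0 xr].
    have x1 : -1 < x < 1 by apply/andP; split; lra.
    by have := der_mean x1 => /is_derive_derivable.
  apply/eqP; rewrite -subr_eq0 E int_hre_r ?mul0r//.
  by move: xr; rewrite in_itv/= => /andP[-> xr]; lra.
rewrite /mean (@eq_Rintegral _ _ _ _ _ (cst (expR (- (c * s `^ alpha + y * s))))).
  rewrite Rintegral_cst//= lebesgue_measure_itv/= lte_fin pi_gt0 oppr0 adde0/=.
  by rewrite mulrC.
move=> t _; rewrite /hre.
have -> : logmod 0 t = ln s.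
  rewrite /logmod (_ : dp 0 t = 1); last by rewrite /dp; ring.
  by rewrite (_ : dm 0 t = 1) ?subrr ?mulr0 ?addr0// /dm; ring.
have -> : arg 0 t = 0 by rewrite /arg mulr0 !mul0r atan0.
rewrite /repart /impart mulr0 cos0 sin0 !mulr0 addr0 cos0 !mulr1.
by rewrite (@lnK _ s) ?posrE// /powR gt_eqF.
Qed.

(** For 0 < t < pi this is s cot(t / 2): the image of e^(i t) under the conformal map is i times
    this number. Accordingly [hbdry] is Re e^(-(c v^alpha + y v)) at v = i [bdry t]. *)
Definition bdry t := expR (ln s + 2^-1 * (ln (2 + 2 * cos t) - ln (2 - 2 * cos t))).

Definition hbdry t := expR (- (c * bdry t `^ alpha * cos (alpha * (pi / 2)))) *
  cos (c * bdry t `^ alpha * sin (alpha * (pi / 2)) + y * bdry t).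

Let hreE t l : expR (- repart l (pi / 2)) * cos (impart l (pi / 2)) =
  expR (- (c * expR l `^ alpha * cos (alpha * (pi / 2)))) *
  cos (c * expR l `^ alpha * sin (alpha * (pi / 2)) + y * expR l).
Proof.
rewrite /repart /impart cos_pihalf sin_pihalf mulr0 addr0 mulr1.
by rewrite /powR gt_eqF ?expR_gt0// expRK.
Qed.

(** The quotient is the tangent of [arg r t]; its divergence sends the argument to pi / 2, that is,
    the image point to the imaginary axis. *)
Let cvg_tan_arg t : 0 < sin t -> (2 * r * sin t / (1 - r ^+ 2)) @[r --> 1^'-] --> +oo.
Proof.
move=> st; apply/cvgryPge => A; near=> r.
have r1 : r < 1 by near: r; exact: nbhs_left_lt.
have A0 : 0 < `|A| + 1 by rewrite ltr_wpDl.
have r2 : 2^-1 < r by near: r; apply: nbhs_left_gt; lra.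
have r3 : 1 - sin t / (2 * (`|A| + 1)) < r.
    by near: r; apply: nbhs_left_gt; rewrite gtrBl divr_gt0// mulr_gt0.
have q : 0 < 1 - r ^+ 2 by apply: sq_lt1; apply/andP; split; lra.
rewrite ler_pdivlMr// (@le_trans _ _ (sin t))//; last by nra.
rewrite (@le_trans _ _ ((`|A| + 1) * (1 - r ^+ 2)))//.
    by apply: ler_wpM2r; [exact: ltW|have := ler_norm A; lra].
have {}r3 : 1 - r <= sin t / (2 * (`|A| + 1)) by lra.
rewrite ler_pdivlMr in r3; last by rewrite mulr_gt0.
by nra.
Unshelve. all: end_near. Qed.

Let cvg_hre t : 0 < t < pi -> hre r t @[r --> 1^'-] --> hbdry t.
Proof.
move=> t0p; rewrite /hbdry /bdry -hreE//.
have st : 0 < sin t by apply: sin_gt0_pi.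
have ct : -1 < cos t < 1.
  have := cos2Dsin2 t; have : 0 < sin t ^+ 2 by rewrite exprn_gt0.
  by move=> ? ?; apply/andP; split; nra.
have c1 (f : R -> R) : derivable f 1 1 -> f r @[r --> 1^'-] --> f 1.
  move=> df; apply: cvg_at_left_filter.
  exact/differentiable_continuous/derivable1_diffP.
have cL : logmod r t @[r --> 1^'-] -->
    ln s + 2^-1 * (ln (2 + 2 * cos t) - ln (2 - 2 * cos t)).
  have -> : ln s + 2^-1 * (ln (2 + 2 * cos t) - ln (2 - 2 * cos t)) = logmod 1 t.
    by rewrite /logmod /dp /dm !expr1n mulr1.
  apply: (c1 (logmod ^~ t)); rewrite /logmod /dp /dm; eapply is_derive_derivable; der; rewrite /= expr1n.
    by move: ct => /andP[]; lra.
  by move: ct => /andP[]; lra.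
have cA : arg r t @[r --> 1^'-] --> pi / 2.
  rewrite /arg.
  have : (2 * r * sin t / (1 - r ^+ 2)) @[r --> 1^'-] --> +oo.
    exact: cvg_tan_arg.
  by move=> /cvg_comp; apply; exact: cvgy_atan.
have cexp (g : R -> R) l : g r @[r --> 1^'-] --> l -> expR (g r) @[r --> 1^'-] --> expR l.
  by move=> h; apply: (cvg_comp g expR h); exact: continuous_expR.
have ccos (g : R -> R) l : g r @[r --> 1^'-] --> l -> cos (g r) @[r --> 1^'-] --> cos l.
  by move=> h; apply: (cvg_comp g cos h); exact: continuous_cos.
have csin (g : R -> R) l : g r @[r --> 1^'-] --> l -> sin (g r) @[r --> 1^'-] --> sin l.
  by move=> h; apply: (cvg_comp g sin h); exact: continuous_sin.
have cM k (g : R -> R) l : g r @[r --> 1^'-] --> l -> k * g r @[r --> 1^'-] --> k * l.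
  by move=> h; apply: cvgM => //; exact: cvg_cst.
rewrite /hre; apply: cvgM.
  apply: (cexp); apply: cvgN; apply: cvgD.
    apply: cvgM; first by apply: (cM); apply: (cexp); apply: (cM); exact: cL.
    by apply: (ccos); apply: (cM); exact: cA.
  apply: cvgM; first by apply: (cM); apply: (cexp); exact: cL.
  by apply: (ccos); exact: cA.
apply: (ccos); apply: cvgD.
  apply: cvgM; first by apply: (cM); apply: (cexp); apply: (cM); exact: cL.
  by apply: (csin); apply: (cM); exact: cA.
apply: cvgM; first by apply: (cM); apply: (cexp); exact: cL.
by apply: (csin); exact: cA.
Qed.

Lemma mean_hbdry :
  (\int[mu]_(t in `]0, pi[) hbdry t)%R = pi * expR (- (c * s `^ alpha + y * s)).
Proof.
pose rn (n : nat) : R := 1 - 2^-1 * harmonic n.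
have rn01 n : 0 <= rn n < 1.
  have h0 : 0 < harmonic n :> R by exact: harmonic_gt0.
  have h1 : harmonic n <= 1 :> R by rewrite /harmonic /= invf_le1// ler1n.
  by rewrite /rn; apply/andP; split; lra.
have rn1 n : -1 < rn n < 1.
  by have /andP[? ->] := rn01 n; rewrite andbT (lt_le_trans _ (_ : 0 <= _)).
have rncvg : rn n @[n --> \oo] --> (1 : R).
  rewrite -[X in _ --> X]subr0 -(mulr0 2^-1); apply: cvgB; first exact: cvg_cst.
  by apply: cvgM; [exact: cvg_cst|exact: cvg_harmonic].
have mI : measurable (`]0, pi[%classic : set (measurableTypeR R)) by exact: measurable_itv.
have E n : (\int[mu]_(t in `]0, pi[) hre (rn n) t)%R = pi * expR (- (c * s `^ alpha + y * s)).
  rewrite -(mean_hre (rn01 n)) Rintegral_itv_bndo_bndc ?Rintegral_itv_obnd_cbnd//.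
    apply: integrableS (intm_hre (rn1 n)) => //.
    by apply: subset_itvr; rewrite bnd_simp.
  apply: integrableS (intm_hre (rn1 n)) => //.
  exact: subset_itv_oo_cc.
have cv t : `]0, pi[%classic t -> hre (rn n) t @[n --> \oo] --> hbdry t.
  rewrite /= in_itv/= => t0p; have /cvg_at_leftP := cvg_hre t0p; apply; split => // n.
  by have /andP[] := rn1 n.
have mf n : measurable_fun `]0, pi[ (fun t : measurableTypeR R => (hre (rn n) t)%:E).
  have : mu.-integrable `]0, pi[ (EFin \o hre (rn n)).
    by apply: integrableS (intm_hre (rn1 n)) => //; exact: subset_itv_oo_cc.
  by move/measurable_int.
have [] := @dominated_convergence _ _ R mu `]0, pi[%classic mI
  (fun n t => (hre (rn n) t)%:E) (fun t => (hbdry t)%:E) (EFin \o cst 1) mf.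
- by apply: (emeasurable_fun_cvg (fun n t => (hre (rn n) t)%:E)) => // t tI; apply: cvg_EFin; [exact: nearW|exact: cv].
- by apply: aeW => t tI; apply: cvg_EFin; [exact: nearW|exact: cv].
- have : mu.-integrable `[0, pi] (EFin \o (fun _ : R => 1)).
    by apply: within_cont_int => t _; exact: derivable_cst.
  by apply: integrableS => //; exact: subset_itv_oo_cc.
- by apply: aeW => t n tI; rewrite /= lee_fin hre_le1.
move=> ih _.
have -> : (fun n => \int[mu]_(t in `]0%R, pi[) (hre (rn n) t)%:E)%E =
    cst (pi * expR (- (c * s `^ alpha + y * s)))%:E.
  apply/funext => n; rewrite /= -(E n) fineK//; apply: integrable_fin_num => //.
  by apply: integrableS (intm_hre (rn1 n)) => //; exact: subset_itv_oo_cc.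
move=> h; rewrite /Rintegral.
suff -> : (\int[mu]_(t in `]0%R, pi[) (hbdry t)%:E = (pi * expR (- (c * s `^ alpha + y * s)))%:E)%E by [].
by apply: (cvg_unique _ h (cvg_cst _)).
Qed.

End circle.

(** * Laplace transform and positivity of the stable variable *)

Section stable_laplace.
Context {R : realType} {d : measure_display} {T : measurableType d}.
Variable P : probability T R.
Local Notation mu := (@lebesgue_measure R).

Lemma bdry_gt0 (s t : R) : 0 < bdry s t.
Proof. exact: expR_gt0. Qed.

Lemma measurable_bdry (s : R) : measurable_fun setT (bdry s : measurableTypeR R -> R).
Proof.
have mc : measurable_fun setT (cos : R -> R).
  by apply: continuous_measurable_fun; exact: continuous_cos.
apply: measurableT_comp => //; apply: measurable_funD => //.
apply: measurable_funM => //; apply: measurable_funB.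
  apply: measurableT_comp => //; apply: measurable_funD => //.
  exact: measurable_funM.
apply: measurableT_comp => //; apply: measurable_funB => //.
exact: measurable_funM.
Qed.

(** The mean value formula with c = 0 and y = |x|. In other words, for t uniform on ]0, pi[ the
    variable s cot(t / 2) is half-Cauchy, with cosine transform e^(-s |x|). *)
Lemma Rintegral_cos_bdry (s x : R) : 0 < s ->
  (\int[mu]_(t in `]0, pi[) cos (x * bdry s t))%R = pi * expR (- (s * `|x|)).
Proof.
move=> s0; have := @mean_hbdry R s 1 0 `|x| s0 ltr01 (lexx _) (lexx _) (normr_ge0 x).
rewrite mul0r add0r [s * _]mulrC => <-; apply: eq_Rintegral => t _.
rewrite /hbdry !mul0r add0r oppr0 expR0 mul1r.
by case: (ger0P x) => // x0; rewrite mulNr cosN.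
Qed.

Let bounded_int (f : T -> R) : measurable_fun setT f -> (forall w, `|f w| <= 2) ->
  P.-integrable setT (EFin \o f).
Proof.
move=> mf f2; apply: measurable_bounded_integrable => //; first exact: fin_num_fun_lty.
by exists 2; split => // x /ltW x2 w _ /=; exact: le_trans (f2 w) x2.
Qed.

Variables (S : {RV P >-> R}) (alpha : R).
Hypotheses (a0 : 0 < alpha) (a1 : alpha <= 1) (Scf : has_stable_cf P S alpha).

Let mS : measurable_fun setT S. Proof. exact: measurable_funPT. Qed.

(** The addition formula expresses the cosine of a shifted argument by the real and imaginary parts
    of the characteristic function at [bdry s t]. The added 1 keeps the integrand nonnegative, so
    that Tonelli applies later. *)
Let inner_w (s y t : R) : 0 < s -> 0 <= y ->
  (\int[P]_w (1 + cos ((S w + y) * bdry s t))%:E = (1 + hbdry s alpha 1 y t)%:E)%E.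
Proof.
move=> s0 y0; set b := bdry s t; have b0 : 0 < b by exact: bdry_gt0.
have [Ec Es] := Scf b; rewrite gtr0_norm// in Ec Es.
have mbS : measurable_fun setT (fun w => b * S w) by exact: measurable_funM.
have mcb : measurable_fun setT (fun w => cos (b * S w)).
  apply: measurableT_comp mbS; apply: continuous_measurable_fun; exact: continuous_cos.
have msb : measurable_fun setT (fun w => sin (b * S w)).
  apply: measurableT_comp mbS; apply: continuous_measurable_fun; exact: continuous_sin.
have c1 z : `|cos z| <= 1 :> R by rewrite ler_norml cos_geN1 cos_le1.
have s1 z : `|sin z| <= 1 :> R by rewrite ler_norml sin_geN1 sin_le1.
have ic : P.-integrable setT (EFin \o (fun w => cos (b * S w))).
  by apply: bounded_int => // w; rewrite (le_trans (c1 _))// ler1n.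
have isn : P.-integrable setT (EFin \o (fun w => sin (b * S w))).
  by apply: bounded_int => // w; rewrite (le_trans (s1 _))// ler1n.
have i1 : P.-integrable setT (EFin \o (fun w : T => 1 : R)).
  by apply: bounded_int => // w; rewrite normr1 ler1n.
under eq_integral => w _.
  rewrite (_ : 1 + _ = 1 + (cos (b * y) * cos (b * S w) - sin (b * y) * sin (b * S w)))%R; last first.
    by rewrite [(S w + y) * b]mulrC mulrDr addrC [X in cos X]addrC cosD addrC.
  rewrite EFinD EFinB EFinM (EFinM (sin _)).
  over.
have ic' : P.-integrable setT (fun w => (cos (b * y))%:E * (cos (b * S w))%:E)%E by exact: integrableZl.
have isn' : P.-integrable setT (fun w => (sin (b * y))%:E * (sin (b * S w))%:E)%E by exact: integrableZl.
rewrite integralD//; last exact: integrableB.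
rewrite integralB// !integralZl// Ec Es.
have -> : (\int[P]_w 1%:E = 1%:E)%E by rewrite integral_cst//= mul1e probability_setT.
rewrite -!EFinM -EFinB -EFinD; congr (_%:E); congr (_ + _).
have -> : pi * alpha / 2 = alpha * (pi / 2) by ring.
rewrite /hbdry gtr0_sg// !mul1r -/b (mulrC y b) cosD mulNr.
by ring.
Qed.

(** The function 1 + cos((S + y) [bdry s t]) is integrated over t in ]0, pi[ and over the sample
    space in both orders. Integrating t first gives e^(-s |S + y|) by the half-Cauchy formula;
    integrating S first gives [hbdry], whose mean is known. *)
Lemma stable_abs_laplace (s y : R) : 0 < s -> 0 <= y ->
  (\int[P]_w (expR (- (s * `|S w + y|)))%:E = (expR (- (s `^ alpha + y * s)))%:E)%E.
Proof.
move=> s0 y0; pose I := `]0%R, (pi : R)[%classic : set (measurableTypeR R).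
have mI : measurable I by exact: measurable_itv.
pose f (z : measurableTypeR R * T) : \bar R :=
  ((\1_I z.1) * (1 + cos ((S z.2 + y) * bdry s z.1)))%:E.
have mc : measurable_fun setT (cos : R -> R).
  by apply: continuous_measurable_fun; exact: continuous_cos.
have f0 z : (0 <= f z)%E.
  by rewrite lee_fin mulr_ge0// -lerBlDl sub0r cos_geN1.
have mf : measurable_fun setT f.
  apply/measurable_EFinP; apply: measurable_funM.
    have m1 : measurable_fun setT (\1_I : measurableTypeR R -> R) by exact: measurable_indic.
    exact: (measurableT_comp m1 measurable_fst).
  apply: measurable_funD => //; apply: measurableT_comp => //.
  apply: measurable_funM; last exact: (measurableT_comp (measurable_bdry s) measurable_fst).
  by apply: measurable_funD => //; exact: (measurableT_comp mS measurable_snd).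
have muI : mu I = (pi)%:E by rewrite /I lebesgue_measure_itv/= lte_fin pi_gt0 oppr0 adde0.
have muIoo : (mu I < +oo)%E by rewrite muI ltry.
have bnd (g : measurableTypeR R -> R) : measurable_fun setT g -> (forall t, `|g t| <= 1) ->
    mu.-integrable I (EFin \o g).
  move=> mg g1; apply: (measurable_bounded_integrable mI muIoo); first exact: measurable_funTS.
  by exists 1; split => // x /ltW x2 w _ /=; exact: le_trans (g1 w) x2.
have int1 : mu.-integrable I (EFin \o (fun _ => 1)).
  by apply: bnd => // t; rewrite normr1.
have c1 z : `|cos z| <= 1 :> R by rewrite ler_norml cos_geN1 cos_le1.
have inner_t w : (\int[mu]_t f (t, w) = (pi + pi * expR (- (s * `|S w + y|)))%:E)%E.
  rewrite /f /=.
  transitivity (\int[mu]_(t in I) (1%:E + (cos ((S w + y) * bdry s t))%:E))%E.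
    rewrite [RHS]integral_mkcond; apply: eq_integral => t _; rewrite patchE indicE.
    by case: ifPn; rewrite ?mul1r ?mul0r.
  have icos : mu.-integrable I (EFin \o (fun t => cos ((S w + y) * bdry s t))).
    apply: bnd => //; apply: measurableT_comp => //.
    by apply: measurable_funM => //; exact: measurable_bdry.
  rewrite integralD// EFinD; congr (_ + _)%E.
    by rewrite integral_cst// mul1e; exact: muI.
  rewrite -(Rintegral_cos_bdry (S w + y) s0) fineK//.
  exact: integrable_fin_num icos.
have inner_w' t : (\int[P]_w f (t, w) = (\1_I t * (1 + hbdry s alpha 1 y t))%:E)%E.
  rewrite /f /=.
  under eq_integral do rewrite EFinM.
  have -> : (\1_I t * (1 + hbdry s alpha 1 y t))%:E =
      ((\1_I t)%:E * \int[P]_w (1 + cos ((S w + y) * bdry s t))%:E)%E by rewrite inner_w.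
  apply: ge0_integralZl => //.
    apply/measurable_EFinP; apply: measurable_funD => //; apply: measurableT_comp => //.
    by apply: measurable_funM => //; apply: measurable_funD.
have mh : measurable_fun setT (hbdry s alpha 1 y : measurableTypeR R -> R).
  have mb := measurable_bdry s.
  have mp : measurable_fun setT (fun t : measurableTypeR R => bdry s t `^ alpha).
    exact: (measurableT_comp (@measurable_powR R alpha) mb).
  apply: measurable_funM; apply: measurableT_comp => //.
    apply: measurableT_comp => //; apply: measurable_funM => //; exact: measurable_funM.
  apply: measurable_funD; last exact: measurable_funM.
  by apply: measurable_funM => //; exact: measurable_funM.
pose e w := expR (- (s * `|S w + y|)).
have me : measurable_fun setT e.
  apply: measurableT_comp => //; apply: measurableT_comp => //; apply: measurable_funM => //.
  by apply: measurableT_comp => //; exact: measurable_funD.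
have ie : P.-integrable setT (EFin \o e).
  apply: bounded_int => // w; rewrite ger0_norm ?expR_ge0// (@le_trans _ _ 1) ?ler1n//.
  by rewrite -expR0 ler_expR oppr_le0 mulr_ge0// ltW.
have h1 t : `|hbdry s alpha 1 y t| <= 1.
  rewrite /hbdry normrM ger0_norm ?expR_ge0// mulr_ile1 ?expR_ge0//.
  have p0 : 0 <= pi / 2 :> R by rewrite divr_ge0// pi_ge0.
  have cp : 0 <= cos (alpha * (pi / 2)).
    apply: cos_ge0_pihalf; rewrite -ler_norml ger0_norm; last by rewrite mulr_ge0// ltW.
    by rewrite -[leRHS]mul1r ler_wpM2r.
  by rewrite -[leRHS]expR0 ler_expR oppr_le0 !mulr_ge0// ?powR_ge0.
have L : (\int[mu]_t \int[P]_w f (t, w) = (pi + pi * expR (- (s `^ alpha + y * s)))%:E)%E.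
  under eq_integral do rewrite inner_w'.
  transitivity (\int[mu]_(t in I) (1%:E + (hbdry s alpha 1 y t)%:E))%E.
    rewrite [RHS]integral_mkcond; apply: eq_integral => t _; rewrite patchE indicE.
    by case: ifPn; rewrite ?mul1r ?mul0r.
  rewrite (integralD mI int1 (bnd _ mh h1)) EFinD; congr (_ + _)%E; first by rewrite integral_cst// mul1e; exact: muI.
  have := @mean_hbdry R s alpha 1 y s0 a0 a1 ler01 y0.
  rewrite mul1r => <-; rewrite fineK//.
  exact: (integrable_fin_num mI (bnd _ mh h1)).
have Rr : (\int[P]_w \int[mu]_t f (t, w) = (pi + pi * (\int[P]_w e w)%R)%:E)%E.
  under eq_integral do rewrite inner_t EFinD EFinM.
  have i1 : P.-integrable setT (EFin \o (fun w : T => pi : R)).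
    apply: measurable_bounded_integrable => //; first exact: fin_num_fun_lty.
    exact: bounded_cst.
  have iz : P.-integrable setT (fun w => (pi : R)%:E * (e w)%:E)%E by exact: integrableZl.
  rewrite (integralD measurableT i1 iz) integralZl//.
  have -> : (\int[P]_w (e w)%:E = (\int[P]_w e w)%R%:E)%E.
    by rewrite fineK//; exact: integrable_fin_num ie.
  by rewrite integral_cst//= probability_setT mule1.
have := @fubini_tonelli _ _ _ _ R mu P f mf f0.
rewrite L Rr => -[] /addrI /(mulfI (lt0r_neq0 (pi_gt0 R))) ->.
by rewrite /Rintegral fineK//; exact: integrable_fin_num ie.
Qed.

Let mneg : measurable (S @^-1` `]-oo, 0]).
Proof. by apply: (measurable_preimageT mS). Qed.

Let mneg' : measurable (S @^-1` `]-oo, 0[).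
Proof. by apply: (measurable_preimageT mS). Qed.

(* Comparing [|S|] with [|S + 1| - 1]: both have the same Laplace transform at 1,
   although the latter is smaller as soon as [S < 0]. *)
Let stable_ge0 : P (S @^-1` `]-oo, 0[) = 0%E.
Proof.
pose A w := expR (- (1 * `|S w + 0|)).
pose B w := expR 1 * expR (- (1 * `|S w + 1|)).
have mA : measurable_fun setT A.
  apply: measurableT_comp => //; apply: measurableT_comp => //; apply: measurable_funM => //.
  by apply: measurableT_comp => //; exact: measurable_funD.
have mB : measurable_fun setT B.
  apply: measurable_funM => //.
  apply: measurableT_comp => //; apply: measurableT_comp => //; apply: measurable_funM => //.
  by apply: measurableT_comp => //; exact: measurable_funD.
have AB w : A w <= B w.
  rewrite /A /B -expRD ler_expR !mul1r addr0.
  by have := ler_normD (S w) 1; rewrite normr1; lra.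
have ABlt w : S w < 0 -> A w < B w.
  move=> S0; rewrite /A /B -expRD ltr_expR !mul1r addr0 (ltr0_norm S0).
  by case: (ger0P (S w + 1)); lra.
have iB : (\int[P]_w (B w)%:E = (expR (- 1))%:E)%E.
  under eq_integral do rewrite EFinM.
  rewrite [LHS]ge0_integralZl//; last first.
    apply/measurable_EFinP; apply: measurableT_comp => //; apply: measurableT_comp => //.
    by apply: measurable_funM => //; apply: measurableT_comp => //; exact: measurable_funD.
  rewrite (stable_abs_laplace ltr01 ler01) -EFinM -expRD powR1.
  by congr (expR _)%:E; ring.
have iA : (\int[P]_w (A w)%:E = (expR (- 1))%:E)%E.
  by rewrite (stable_abs_laplace ltr01 (lexx 0)) powR1 mul0r addr0.
have intA : P.-integrable setT (EFin \o A).
  apply/integrableP; split; first exact/measurable_EFinP.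
  under eq_integral do rewrite /= ger0_norm ?expR_ge0//.
  by rewrite iA ltry.
have intB : P.-integrable setT (EFin \o B).
  apply/integrableP; split; first exact/measurable_EFinP.
  under eq_integral do rewrite /= ger0_norm ?mulr_ge0 ?expR_ge0//.
  by rewrite iB ltry.
(* [B - A] is nonnegative with zero integral, hence null almost everywhere, whereas it is strictly
   positive as soon as S < 0. *)
have : (\int[P]_w `|(B w - A w)%:E| = 0)%E.
  under eq_integral => w _ do rewrite gee0_abs ?lee_fin ?subr_ge0// EFinB.
  by rewrite integralB// iA iB subee.
move/ae_eq_integral_abs => [//||N [mN N0 sub]].
  by apply/measurable_EFinP; exact: measurable_funB.
apply/eqP; rewrite eq_le measure_ge0 andbT -N0 le_measure ?inE//.
move=> w /=; rewrite in_itv/= => S0; apply: sub => /= /(_ I)[] /eqP.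
by rewrite subr_eq0 gt_eqF// ABlt.
Qed.

Lemma stable_laplace (s : R) : 0 < s ->
  (\int[P]_w (expR (- (s * S w)))%:E = (expR (- (s `^ alpha)))%:E)%E.
Proof.
move=> s0; have := stable_abs_laplace s0 (lexx 0); rewrite mul0r addr0 => <-.
apply: ge0_ae_eq_integral => //.
- apply/measurable_EFinP; apply: measurableT_comp => //; apply: measurableT_comp => //.
  exact: measurable_funM.
- apply/measurable_EFinP; apply: measurableT_comp => //; apply: measurableT_comp => //.
  by apply: measurable_funM => //; apply: measurableT_comp => //; exact: measurable_funD.
exists (S @^-1` `]-oo, 0[); split => // w /= ne; rewrite in_itv/= ltNge; apply/negP => S0.
by apply: ne => _; rewrite addr0 ger0_norm.
Qed.

(** Since e^(-s S) >= 1 where S <= 0, the probability is at most e^(-s^alpha) for every s > 0, and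
    this tends to 0. *)
Lemma stable_gt0 : P (S @^-1` `]-oo, 0]) = 0%E.
Proof.
have le n : (P (S @^-1` `]-oo, 0%R]) <= (harmonic n)%:E)%E.
  (* With this s the bound is e^(-n), which is at most 1 / (n + 1) = [harmonic n]. *)
  pose s : R := n%:R `^ alpha^-1.
  have [->|n0] := eqVneq n 0%N; first by rewrite /harmonic /= invr1 probability_le1.
  have s0 : 0 < s by rewrite /s powR_gt0// ltr0n lt0n.
  rewrite (@le_trans _ _ (expR (- n%:R))%:E)//; last first.
    rewrite lee_fin expRN /harmonic /= lef_pV2 ?posrE ?expR_gt0//.
    by have := expR_ge1Dx (n%:R : R); rewrite -natr1; lra.
  have -> : n%:R = s `^ alpha :> R by rewrite /s -powRrM mulVf ?gt_eqF// powRr1.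
  rewrite -(stable_laplace s0) -[P _]mul1e -integral_cst//.
  rewrite integral_mkcond; apply: ge0_le_integral => //.
  - by move=> w _; rewrite patchE; case: ifP.
  - by apply/measurable_restrict => //; rewrite setTI; exact: measurable_cst.
  - apply/measurable_EFinP; apply: measurableT_comp => //; apply: measurableT_comp => //.
    exact: measurable_funM.
  move=> w _; rewrite patchE; case: ifPn => [|_]; last by rewrite lee_fin expR_ge0.
  rewrite inE /= in_itv/= => Sw; rewrite lee_fin -expR0 ler_expR oppr_ge0.
  by rewrite mulr_ge0_le0// ltW.
apply/eqP; rewrite eq_le measure_ge0 andbT.
have h : (harmonic n : R)%:E @[n --> \oo] --> 0%:E.
  by apply: cvg_EFin; [exact: nearW|exact: cvg_harmonic].
have <- : limn (fun n => (harmonic n : R)%:E) = 0%E by exact: cvg_lim h.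
apply: lime_ge; last exact: nearW.
by apply/cvg_ex; exists 0%:E.
Qed.

End stable_laplace.

(** * Stable and gamma laws *)

Section affine_change_of_variable.
Context {R : realType}.
Local Notation mu := (@lebesgue_measure R).

Let affine (a b : R) : measurableTypeR R -> measurableTypeR R := fun x => (a * x + b)%R.

Let measurable_affine a b : measurable_fun setT (affine a b).
Proof.
have : measurable_fun setT (fun x : R => a * x + b)%R by exact: measurable_funD.
by [].
Qed.

(** The rescaled image of Lebesgue measure gives half-open intervals their length, so it is Lebesgue
    measure. *)
Lemma ge0_integral_affine (a b : R) (f : R -> \bar R) : 0 < a ->
  measurable_fun setT f -> (forall x, 0 <= f x)%E ->
  (\int[mu]_x f x = a%:E * \int[mu]_x f (a * x + b)%R)%E.
Proof.
move=> a0 mf f0; have ma := measurable_affine a b.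
pose m := mscale (NngNum (ltW a0)) (pushforward mu (affine a b)).
have H : forall A, measurable A -> mu A = m ma A.
  apply: lebesgue_measure_unique => //= _ [[x y]] _ <-.
  rewrite /m /mscale /= /pushforward.
  have -> : affine a b @^-1` `]x, y] = `](x - b) / a, (y - b) / a]%classic.
    apply/seteqP; split => z /=; rewrite !in_itv/= /affine ltr_pdivrMr// ler_pdivlMr//;
      by rewrite ltrBlDr lerBrDr [z * a]mulrC.
  rewrite !lebesgue_measure_itv/= !lte_fin ltr_pM2r ?invr_gt0// ltrD2r.
  case: ifP => _; last by rewrite mule0.
  by rewrite -!EFinB -EFinM; congr (_%:E); field; rewrite gt_eqF.
transitivity (\int[m ma]_x f x)%E.
  by apply: eq_measure_integral => A mA _; first [exact: (H A mA)|exact: (esym (H A mA))].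
rewrite ge0_integral_mscale//= ; congr (_ * _)%E.
by rewrite ge0_integral_pushforward.
Qed.

End affine_change_of_variable.

Section laws.
Context {R : realType}.

Lemma same_lawP d d' (T : measurableType d) (T' : measurableType d')
    (P : probability T R) (P' : probability T' R) (Y : T -> R) (Z : T' -> R) :
  measurable_fun setT Y -> measurable_fun setT Z ->
  (forall a : R, P (Y @^-1` `]a, +oo[) = P' (Z @^-1` `]a, +oo[)) -> same_law P Y P' Z.
Proof.
move=> mY mZ H B mB.
pose Y' : {mfun T >-> R} := HB.pack Y (isMeasurableFun.Build _ _ _ _ Y mY).
pose Z' : {mfun T' >-> R} := HB.pack Z (isMeasurableFun.Build _ _ _ _ Z mZ).
pose G := [set A : set R | exists a : R, A = `]a, +oo[%classic].
apply: (@measure_unique _ R R G (fun n => `](- n%:R)%R, +oo[%classic)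
  _ _ _ _ (distribution P Y') (distribution P' Z')) => //.
- exact: RGenOInfty.measurableE.
- move=> _ _ [a ->] [b ->]; exists (Num.max a b); apply/seteqP; split => x /=;
    rewrite !in_itv/= !andbT gt_max; [by move=> [-> ->]|by move/andP].
- by move=> n; exists (- n%:R).
- apply/seteqP; split => // x _; exists (Num.truncn `|x|).+1 => //=.
  rewrite in_itv/= andbT ltrNl (@le_lt_trans _ _ `|x|)//; last exact: real_truncnS_gt.
  by rewrite -normrN ler_norm.
- by move=> _ [a ->]; exact: H.
- by move=> n; rewrite (@le_lt_trans _ _ 1%E) ?ltry// probability_le1.
Qed.

Lemma same_law_integral d d' (T : measurableType d) (T' : measurableType d')
    (P : probability T R) (P' : probability T' R) (Y : T -> R) (Z : T' -> R) (f : R -> \bar R) :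
  measurable_fun setT Y -> measurable_fun setT Z -> same_law P Y P' Z ->
  measurable_fun setT f -> (forall x, 0 <= f x)%E ->
  (\int[P]_w f (Y w) = \int[P']_w f (Z w))%E.
Proof.
move=> mY mZ H mf f0.
pose Y' : {mfun T >-> R} := HB.pack Y (isMeasurableFun.Build _ _ _ _ Y mY).
pose Z' : {mfun T' >-> R} := HB.pack Z (isMeasurableFun.Build _ _ _ _ Z mZ).
rewrite -(@ge0_integral_distribution _ _ _ _ _ P Y' _ mf f0).
rewrite -(@ge0_integral_distribution _ _ _ _ _ P' Z' _ mf f0).
by apply: eq_measure_integral => A mA _; exact: H.
Qed.

Lemma same_law_indep2 d d' (T : measurableType d) (T' : measurableType d')
    (P : probability T R) (P' : probability T' R) (U V : T -> R) (U' V' : T' -> R)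
    (g : R * R -> R) :
  measurable_fun setT U -> measurable_fun setT V ->
  measurable_fun setT U' -> measurable_fun setT V' -> measurable_fun setT g ->
  indep2 P U V -> indep2 P' U' V' -> same_law P U P' U' -> same_law P V P' V' ->
  same_law P (fun w => g (U w, V w)) P' (fun w => g (U' w, V' w)).
Proof.
move=> mU mV mU' mV' mg i i' sU sV B mB.
pose f (z : R * R) : \bar R := (\1_B (g z))%:E.
have mf : measurable_fun setT f.
  apply/measurable_EFinP; apply: measurableT_comp => //; exact: measurable_indic.
have f0 z : (0 <= f z)%E by rewrite lee_fin.
have E d1 (T1 : measurableType d1) (P1 : probability T1 R) (h : T1 -> R) : measurable_fun setT h ->
    P1 (h @^-1` B) = (\int[P1]_w (\1_B (h w))%:E)%E.
  move=> mh; rewrite -[h @^-1` B]setIT -integral_indic//.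
  by apply: (measurable_preimageT mh).
have mgUV : measurable_fun setT (fun w => g (U w, V w)).
  by apply: measurableT_comp => //; exact/measurable_fun_pair.
have mgUV' : measurable_fun setT (fun w => g (U' w, V' w)).
  by apply: measurableT_comp => //; exact/measurable_fun_pair.
rewrite !E//.
rewrite (indep2_integral mU mV i mf f0) (indep2_integral mU' mV' i' mf f0).
transitivity (\int[P]_w \int[P']_w' f (U w, V' w'))%E.
  apply: eq_integral => w _; apply: (same_law_integral (f := fun v => f (U w, v))) => //.
  exact: measurableT_comp.
apply: (same_law_integral (f := fun u => (\int[P']_w' f (u, V' w'))%E)) => //.
  pose V0 : {mfun T' >-> R} := HB.pack V' (isMeasurableFun.Build _ _ _ _ V' mV').
  have mf' : measurable_fun setT (fun z : R * T' => f (z.1, V' z.2)).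
    by apply: measurableT_comp => //; apply/measurable_fun_pair => //; exact: measurableT_comp.
  exact: (@measurable_fun_fubini_tonelli_F _ _ _ _ _ P' (fun z : R * T' => f (z.1, V' z.2)) mf').
by move=> u; apply: integral_ge0.
Qed.

End laws.

Section tails.
Context {R : realType}.
Local Notation mu := (@lebesgue_measure R).

Lemma integral_expR_tail (a : R) : (\int[mu]_(x in `]a, +oo[) (expR (- x))%:E = (expR (- a))%:E)%E.
Proof.
have dF (x : R) : is_derive x 1 (fun t : R => - expR (- t)) (expR (- x)).
  eapply is_derive_eq; first by der.
  by rewrite mulrN1 opprK.
rewrite integral_itv_obnd_cbnd; last first.
  by apply/measurable_EFinP; apply: measurableT_comp.
rewrite (@ge0_continuous_FTC2y _ _ (fun t : R => - expR (- t)) a 0).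
- by rewrite sub0e -EFinN opprK.
- by move=> x _; exact: expR_ge0.
- apply: continuous_subspaceT => x.
  by apply: (continuous_comp (@oppr_continuous _ _ _)); exact: continuous_expR.
- rewrite -[X in _ --> X]oppr0; apply: cvgN.
  exact: cvgr_expR.
- by move=> x _; have := dF x => /is_derive_derivable.
- apply: cvg_at_right_filter.
  exact: (is_derive_cvg (dF a)).
- by move=> x _; rewrite derive1E; have [_ ->] := dF x.
Qed.

Context {d : measure_display} {T : measurableType d}.
Variable P : probability T R.

Lemma exp1_tail (W : {RV P >-> R}) (a : R) : has_pdf P W exp1_pdf -> 0 <= a ->
  P (W @^-1` `]a, +oo[) = (expR (- a))%:E.
Proof.
move=> h a0; rewrite h// -integral_expR_tail; apply: eq_integral => x.
rewrite inE/= in_itv/= andbT /exp1_pdf => ax; by rewrite ltW// (le_lt_trans a0).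
Qed.

Lemma laplace_tail (L : {RV P >-> R}) (a : R) : has_pdf P L laplace_pdf -> 0 <= a ->
  P (L @^-1` `]a, +oo[) = (2^-1 * expR (- a))%:E.
Proof.
move=> h a0; rewrite h//.
transitivity (\int[mu]_(x in `]a, +oo[) ((2^-1)%:E * (expR (- x))%:E))%E.
  apply: eq_integral => x; rewrite inE/= in_itv/= andbT /laplace_pdf => ax.
  by rewrite ger0_norm// ltW// (le_lt_trans a0).
rewrite ge0_integralZl//; last first.
  by apply/measurable_EFinP; apply: measurable_funTS; apply: measurableT_comp.
by rewrite integral_expR_tail EFinM.
Qed.

End tails.

Section measurable_inverse.
Context {R : realType}.

Lemma measurable_inv : measurable_fun setT (fun x : R => x^-1).
Proof.
(* This form reduces the claim to the measurability of [powR]; both sides are 0 at 0, where the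
   inverse is discontinuous. *)
have -> : (fun x : R => x^-1) = (fun x => x * (x ^+ 2) `^ (- 1)).
  apply/funext => x; have [->|x0] := eqVneq x 0; first by rewrite invr0 mul0r.
  by rewrite powRN powRr1 ?sqr_ge0//; field.
apply: measurable_funM => //; apply: (measurableT_comp (@measurable_powR R (- 1))).
exact: measurable_funX.
Qed.

Lemma measurable_funV d (T : measurableType d) (f : T -> R) :
  measurable_fun setT f -> measurable_fun setT (fun w => (f w)^-1).
Proof. by move=> mf; exact: (measurableT_comp measurable_inv mf). Qed.

Lemma measurable_fun_powR d (T : measurableType d) (f : T -> R) (p : R) :
  measurable_fun setT f -> measurable_fun setT (fun w => f w `^ p).
Proof. by move=> mf; exact: (measurableT_comp (@measurable_powR R p) mf). Qed.

End measurable_inverse.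

Section gamma.
Context {R : realType}.
Local Notation mu := (@lebesgue_measure R).
Implicit Types (s x : R).

Lemma GammaF_ge0 s : 0 <= GammaF s.
Proof. by apply: Rintegral_ge0 => x _; rewrite mulr_ge0 ?powR_ge0 ?expR_ge0. Qed.

Lemma gamma_pdf_ge0 s x : 0 <= gamma_pdf s x.
Proof.
by rewrite /gamma_pdf; case: ifP => // _; rewrite !mulr_ge0 ?invr_ge0 ?GammaF_ge0 ?powR_ge0 ?expR_ge0.
Qed.

Lemma measurable_gamma_pdf s : measurable_fun setT (gamma_pdf s).
Proof.
apply: measurable_fun_if => //; first exact: measurable_fun_ltr.
apply: measurable_funTS; apply: measurable_funM; last exact: measurableT_comp.
by apply: measurable_funM => //; exact: measurable_fun_powR.
Qed.

Lemma gamma_pdf_scale s (k x : R) : 0 < k ->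
  expR (- ((k - 1) * x)) * gamma_pdf s x = k `^ (1 - s) * gamma_pdf s (k * x).
Proof.
move=> k0; rewrite /gamma_pdf pmulr_rgt0//; case: ifPn => x0; last by rewrite !mulr0.
rewrite powRM ?ltW// -[in RHS](opprB s 1) powRN.
have -> : expR (- (k * x)) = expR (- ((k - 1) * x)) * expR (- x).
  by rewrite -expRD; congr expR; ring.
by move: (GammaF s)^-1 => g; field; apply: lt0r_neq0; exact: powR_gt0.
Qed.

(** The factor e^(-y) (1 + y / x)^(s - 1) is what remains of the Laplace transform of Z once the
    second gamma variable has been integrated out; multiplied by the density it translates the
    density by y. *)
Lemma gamma_pdf_shift s x (y : R) : 0 <= y ->
  (if 0 < x then expR (- y) * (1 + y / x) `^ (s - 1) * gamma_pdf s x else 0) =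
  if 0 < x then gamma_pdf s (x + y) else 0.
Proof.
move=> y0; case: ifPn => // x0; rewrite /gamma_pdf x0 ltr_wpDr//.
have -> : x + y = (1 + y / x) * x by field; rewrite gt_eqF.
have xy : 0 <= 1 + y / x by rewrite addr_ge0// divr_ge0// ltW.
rewrite powRM ?(ltW x0)//.
have -> : expR (- ((1 + y / x) * x)) = expR (- y) * expR (- x).
  by rewrite -expRD; congr expR; field; rewrite gt_eqF.
by ring.
Qed.

Context {d : measure_display} {T : measurableType d}.
Variable P : probability T R.

(** The half line is open because for s = 0 all the mass sits at 0. *)
Lemma is_gamma_lt0 (Y : {RV P >-> R}) s : is_gamma P Y s -> P (Y @^-1` `]-oo, 0[) = 0%E.
Proof.
rewrite /is_gamma; case: ifPn => [_ H|_ H].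
  apply/eqP; rewrite eq_le measure_ge0 andbT.
  have mA : measurable (Y @^-1` [set 0]) by exact: measurable_funPTI.
  rewrite -[leRHS](subee (x := 1%E))// -[X in (_ <= X - _)%E]H -H.
  have := probability_setC P mA; rewrite H subee// => <-.
  apply: le_measure; rewrite ?inE; [exact: measurable_funPTI|exact: measurableC|].
  by move=> w /=; rewrite in_itv/= => Y0 E; rewrite E ltxx in Y0.
rewrite H//; apply: integral0_eq => x /=; rewrite in_itv/= => x0.
by rewrite /gamma_pdf ltNge ltW.
Qed.

Lemma is_gamma_gt0 (Y : {RV P >-> R}) s : 0 < s -> is_gamma P Y s -> P (Y @^-1` `]-oo, 0]) = 0%E.
Proof.
move=> s0; rewrite /is_gamma gt_eqF// => H.
rewrite H//; apply: integral0_eq => x /=; rewrite in_itv/= => x0.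
by rewrite /gamma_pdf ltNge x0.
Qed.

(** Exponential tilting of a gamma density is a rescaling. The degenerate case s = 0 obeys the same
    formula, which lets the case r = 1, where the second gamma factor is 0, be treated with the
    others. *)
Lemma gamma_laplace (Y : {RV P >-> R}) s (c : R) : 0 <= s -> 0 <= c -> is_gamma P Y s ->
  (\int[P]_w (expR (- (c * Y w)))%:E = ((1 + c) `^ (- s))%:E)%E.
Proof.
move=> s0 c0; rewrite /is_gamma; case: ifPn => [/eqP -> H|sn0 H].
  have mY : measurable_fun setT Y by exact: measurable_funPT.
  rewrite oppr0 powRr0 -(@probability_setT _ _ _ P) -[P setT]mul1e -integral_cst//.
  apply: ge0_ae_eq_integral => //.
    by apply/measurable_EFinP; apply: measurableT_comp => //; apply: measurableT_comp => //; exact: measurable_funM.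
  have mA : measurable (Y @^-1` [set 0]) by exact: measurable_funPTI.
  exists (~` (Y @^-1` [set 0])); split; first exact: measurableC.
    by have := probability_setC P mA; rewrite H subee// => E; exact: E.
  move=> w /= ne Y0; apply: ne => _; by rewrite Y0 mulr0 oppr0 expR0.
rewrite (has_pdf_integral (f := gamma_pdf s) (g := fun x => (expR (- (c * x)))%:E))//; last 3 first.
- exact: measurable_gamma_pdf.
- exact: gamma_pdf_ge0.
- by apply/measurable_EFinP; apply: measurableT_comp => //; apply: measurableT_comp => //; exact: measurable_funM.
have k0 : 0 < 1 + c by rewrite ltr_wpDr.
under eq_integral => x _.
  rewrite -EFinM -{1}[c](addrK 1) [c + 1]addrC gamma_pdf_scale// EFinM.
  over.
have mg := measurable_gamma_pdf s.
rewrite ge0_integralZl//; last 3 first.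
- by apply/measurable_EFinP; apply: (measurableT_comp mg); exact: measurable_funM.
- by move=> x _; rewrite lee_fin gamma_pdf_ge0.
- by rewrite lee_fin powR_ge0.
have := @ge0_integral_affine R (1 + c) 0 (fun x => (gamma_pdf s x)%:E) k0.
rewrite (has_pdf_integral1 H) => A.
have {}A : (1 = (1 + c)%:E * \int[mu]_x (gamma_pdf s ((1 + c) * x))%:E)%E.
  rewrite A; last 2 first.
  - exact/measurable_EFinP.
  - by move=> x; rewrite lee_fin gamma_pdf_ge0.
  by under eq_integral do rewrite addr0.
have -> : ((1 + c) `^ (1 - s))%:E = ((1 + c) `^ (- s) * (1 + c))%:E :> \bar R.
  rewrite [1 - s]addrC powRD; last by rewrite (lt0r_neq0 k0) implybT.
  by rewrite powRr1// ltW.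
by rewrite EFinM -muleA -A mule1.
Qed.

(** Given A = x > 0, the exponent is -y - (y / x) B, so averaging over B gives e^(-y) (1 + y / x)^(r
    - 1). Against the density of A this is the density translated by y, and the translation turns
    the integral into a tail. *)
Lemma gamma_ratio_laplace (A B : {RV P >-> R}) (r y : R) : 0 < r -> r <= 1 -> 0 <= y ->
  is_gamma P A r -> is_gamma P B (1 - r) -> indep2 P A B ->
  (\int[P]_w (expR (- (y * ((A w + B w) / A w))))%:E =
   \int[mu]_(t in `]y, +oo[) (gamma_pdf r t)%:E)%E.
Proof.
move=> r0 r1 y0 gA gB iAB.
have mA : measurable_fun setT A by exact: measurable_funPT.
have mB : measurable_fun setT B by exact: measurable_funPT.
pose f (z : R * R) : \bar R := (expR (- (y * ((z.1 + z.2) / z.1))))%:E.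
have mf : measurable_fun setT f.
  apply/measurable_EFinP; apply: measurableT_comp => //; apply: measurableT_comp => //.
  apply: measurable_funM => //; apply: measurable_funM; first exact: measurable_funD.
  exact: measurable_funV.
have f0 z : (0 <= f z)%E by rewrite lee_fin expR_ge0.
rewrite (indep2_integral (f := f) mA mB iAB mf f0).
pose H x := (\int[P]_w f (x, B w))%E.
have mH : measurable_fun setT H.
  have mf' : measurable_fun setT (fun z : R * T => f (z.1, B z.2)).
    by apply: measurableT_comp => //; apply/measurable_fun_pair => //; exact: measurableT_comp.
  exact: (@measurable_fun_fubini_tonelli_F _ _ _ _ _ P (fun z : R * T => f (z.1, B z.2)) mf').
have H0 x : (0 <= H x)%E by exact: integral_ge0.
have mg := measurable_gamma_pdf r.
rewrite -/(H _) (has_pdf_integral (f := gamma_pdf r) (g := H))//; last 2 first.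
- exact: gamma_pdf_ge0.
- by move: gA; rewrite /is_gamma gt_eqF.
have HE x : 0 < x -> H x = (expR (- y) * (1 + y / x) `^ (r - 1))%:E.
  move=> x0; rewrite /H /f /=.
  have E w : - (y * ((x + B w) / x)) = - y + - ((y / x) * B w) by field; rewrite gt_eqF.
  under eq_integral do rewrite E expRD EFinM.
  rewrite ge0_integralZl//; last first.
    apply/measurable_EFinP; apply: measurableT_comp => //; apply: measurableT_comp => //.
    exact: measurable_funM.
  rewrite (gamma_laplace (s := 1 - r))//.
  - by rewrite opprB EFinM.
  - by rewrite subr_ge0.
  - by rewrite divr_ge0// ltW.
pose g t := if y < t then gamma_pdf r t else 0.
have mg' : measurable_fun setT g.
  by apply: measurable_fun_if => //; [exact: measurable_fun_ltr|exact: measurable_funTS].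
transitivity (\int[mu]_x (g (1 * x + y))%:E)%E.
  apply: eq_integral => x _; rewrite /g mul1r ltrDr.
  have [x0|x0] := ltP 0 x; last first.
    by rewrite /gamma_pdf ltNge x0/= mule0.
  by have := gamma_pdf_shift r x y0; rewrite x0 => <-; rewrite HE.
transitivity (\int[mu]_x (g x)%:E)%E.
  rewrite [RHS](@ge0_integral_affine R 1 y (fun x => (g x)%:E))// ?mul1e//.
    exact/measurable_EFinP.
  by move=> x; rewrite lee_fin /g; case: ifP => // _; exact: gamma_pdf_ge0.
rewrite [RHS]integral_mkcond; apply: eq_integral => x _; rewrite patchE /g.
rewrite mem_setE in_itv/= andbT.
by case: ifP.
Qed.

End gamma.

Section generalized_gamma.
Context {R : realType}.
Local Notation mu := (@lebesgue_measure R).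

Lemma measurable_gg_pdf (r alpha l : R) : measurable_fun setT (gg_pdf r alpha l).
Proof.
apply: measurable_fun_if => //; first exact: measurable_fun_ltr.
apply: measurable_funTS; apply: measurable_funM.
  by apply: measurable_funM => //; exact: measurable_fun_powR.
apply: measurableT_comp => //; apply: measurable_funM => //; exact: measurable_fun_powR.
Qed.

Lemma gg_pdf_ge0 (r alpha l x : R) : 0 <= gg_pdf r alpha l x.
Proof.
by rewrite /gg_pdf; case: ifP => // _; rewrite !mulr_ge0 ?invr_ge0 ?GammaF_ge0 ?powR_ge0 ?expR_ge0.
Qed.

Lemma cvg_powR_lt0 (p : R) : p < 0 -> u `^ p @[u --> +oo] --> (0 : R).
Proof.
move=> p0; apply/cvgrPdist_le => e e0; near=> t.
have t0 : 0 < t by near: t; exact: nbhs_pinfty_gt.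
rewrite sub0r normrN ger0_norm ?powR_ge0// /powR gt_eqF//.
rewrite -[leRHS](@lnK _ e) ?posrE// ler_expR mulrC -ler_ndivrMr//.
rewrite -[leLHS]expRK ler_ln ?posrE; [|exact: expR_gt0|exact: t0].
by near: t; apply: nbhs_pinfty_ge; exact: num_real.
Unshelve. all: end_near. Qed.

Lemma cvgy_powR (p : R) : 0 < p -> u `^ p @[u --> +oo] --> +oo.
Proof.
move=> p0; apply/cvgryPge => A; near=> t.
have t0 : 0 < t by near: t; exact: nbhs_pinfty_gt.
have A0 : 0 < `|A| + 1 by rewrite ltr_wpDl.
rewrite (@le_trans _ _ (`|A| + 1))//; first by have := ler_norm A; lra.
rewrite /powR gt_eqF// -[leLHS]lnK ?posrE// ler_expR mulrC -ler_pdivrMr//.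
rewrite -[leLHS]expRK ler_ln ?posrE; [|exact: expR_gt0|exact: t0].
by near: t; apply: nbhs_pinfty_ge; exact: num_real.
Unshelve. all: end_near. Qed.

(** The substitution u = t^alpha: the power alpha of a generalized gamma variable with scale 1 is a
    gamma variable. *)
Lemma gg_pdf_tail (r alpha x : R) : 0 < alpha -> alpha <= 1 -> 0 < x ->
  (\int[mu]_(t in `]x, +oo[) (gg_pdf r alpha 1 t)%:E =
   \int[mu]_(t in `](x `^ alpha)%R, +oo[) (gamma_pdf r t)%:E)%E.
Proof.
move=> a0 a1 x0.
pose F (t : R) := t `^ alpha.
have dF (t : R) : 0 < t -> is_derive t 1 F (alpha * t `^ (alpha - 1)).
  by move=> t0; exact: is_derive1_powR.
have F'E (t : R) : 0 < t -> derive1 F t = alpha * t `^ (alpha - 1).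
  by move=> t0; rewrite derive1E; have [_ ->] := dF t t0.
have cpow (p t : R) : 0 < t -> u `^ p @[u --> t] --> t `^ p.
  by move=> t0; exact: (is_derive_cvg (is_derive1_powR p t0)).
have cF' (t : R) : 0 < t -> derive1 F u @[u --> t] --> derive1 F t.
  move=> t0; rewrite F'E//.
  have : alpha * u `^ (alpha - 1) @[u --> t] --> alpha * t `^ (alpha - 1).
    by apply: cvgM; [exact: cvg_cst|exact: cpow].
  apply: cvg_trans; apply: near_eq_cvg; near=> u.
  by rewrite F'E//; near: u; exact: lt_nbhsr.
have cgamma (t : R) : 0 < t -> {for t, continuous (gamma_pdf r)}.
  move=> t0; have E : gamma_pdf r t = (GammaF r)^-1 * t `^ (r - 1) * expR (- t).
    by rewrite /gamma_pdf t0.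
  change (gamma_pdf r u @[u --> t] --> gamma_pdf r t); rewrite E.
  have : (GammaF r)^-1 * u `^ (r - 1) * expR (- u) @[u --> t] -->
      (GammaF r)^-1 * t `^ (r - 1) * expR (- t).
    apply: cvgM; last by apply: (continuous_comp (@oppr_continuous _ _ _)); exact: continuous_expR.
    by apply: cvgM; [exact: cvg_cst|exact: cpow].
  apply: cvg_trans; apply: near_eq_cvg; near=> u.
  by rewrite /gamma_pdf ifT//; near: u; exact: lt_nbhsr.
rewrite !integral_itv_obnd_cbnd; last 2 first.
- by apply/measurable_EFinP; apply: measurable_funTS; exact: measurable_gamma_pdf.
- by apply/measurable_EFinP; apply: measurable_funTS; exact: measurable_gg_pdf.
have Fx0 : 0 < F x by exact: powR_gt0.
apply/esym; apply: (etrans (@increasing_ge0_integration_by_substitutiony R F (gamma_pdf r) x _ _ _ _ _ _ _ _)).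
- move=> a b; rewrite !in_itv/= !andbT => xa xb ab.
  by apply: gt0_ltr_powR => //; rewrite nnegrE ltW//; exact: lt_le_trans x0 _.
- by move=> t; rewrite in_itv/= andbT => xt; apply: cF'; exact: lt_trans xt.
- apply/cvg_ex; exists (derive1 F x); exact: (cvg_at_right_filter (cF' x x0)).
(* The substitution rule wants the derivative alpha t^(alpha - 1) to converge at infinity: it is
   constant for alpha = 1 and tends to 0 for alpha < 1. *)
- move: a1; rewrite le_eqVlt => /predU1P[a1|a1].
    apply/cvg_ex; exists alpha.
    have : (fun _ : R => alpha) u @[u --> +oo] --> alpha by exact: cvg_cst.
    apply: cvg_trans; apply: near_eq_cvg; near=> t.
    by rewrite F'E ?a1 ?subrr ?powRr0 ?mulr1//; near: t; exact: nbhs_pinfty_gt.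
  apply/cvg_ex; exists (alpha * 0).
  have : alpha * u `^ (alpha - 1) @[u --> +oo] --> alpha * 0.
    by apply: cvgM; [exact: cvg_cst|apply: cvg_powR_lt0; rewrite subr_lt0].
  apply: cvg_trans; apply: near_eq_cvg; near=> u.
  by rewrite F'E//; near: u; exact: nbhs_pinfty_gt.
- split; last by apply: cvg_at_right_filter; exact: cpow.
  move=> t; rewrite in_itv/= andbT => xt.
  by have := dF t (lt_trans x0 xt) => /is_derive_derivable.
- exact: cvgy_powR.
- apply/continuous_within_itvcyP; split.
    by move=> t; rewrite in_itv/= andbT => xt; apply: cgamma; exact: lt_trans xt.
  by apply: cvg_at_right_filter; exact: cgamma.
- by move=> t _; exact: gamma_pdf_ge0.
- apply: eq_integral => t; rewrite inE/= in_itv/= andbT => xt.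
  have t0 : 0 < t by exact: lt_le_trans xt.
  rewrite (_ : ((gamma_pdf r \o F) * derive1 F) t = gamma_pdf r (F t) * derive1 F t)// F'E//.
  rewrite /gg_pdf /gamma_pdf /F t0 ifT ?powR_gt0// gtr0_norm// powR1 mulr1 mulN1r.
  have -> : t `^ (alpha * r - 1) = (t `^ alpha) `^ (r - 1) * t `^ (alpha - 1).
    rewrite -powRrM -powRD; last by rewrite (lt0r_neq0 t0) implybT.
    by congr (_ `^ _); ring.
  by congr (_%:E); ring.
Unshelve. all: end_near. Qed.

End generalized_gamma.

Section quotient_law.
Context {R : realType} {d : measure_display} {T : measurableType d}.
Variable P : probability T R.
Local Notation mu := (@lebesgue_measure R).

Lemma integral_indic_preimage (Y : T -> R) (B : set R) : measurable_fun setT Y -> measurable B ->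
  P (Y @^-1` B) = (\int[P]_w (\1_B (Y w))%:E)%E.
Proof.
move=> mY mB; rewrite -[Y @^-1` B]setIT -integral_indic//.
by apply: (measurable_preimageT mY).
Qed.

Variables (r alpha : R) (S A B : {RV P >-> R}).
Hypotheses (r0 : 0 < r) (r1 : r <= 1) (a0 : 0 < alpha) (a1 : alpha <= 1).
Hypotheses (Scf : has_stable_cf P S alpha) (gA : is_gamma P A r) (gB : is_gamma P B (1 - r)).
Let Z w := (A w + B w) / A w.
Hypotheses (iAB : indep2 P A B) (iZS : indep2 P Z S).

Definition stable_ratio w := S w * ((A w + B w) / A w) `^ alpha^-1.
Local Notation V := stable_ratio.

Let mA : measurable_fun setT A. Proof. exact: measurable_funPT. Qed.
Let mB : measurable_fun setT B. Proof. exact: measurable_funPT. Qed.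
Let mS : measurable_fun setT S. Proof. exact: measurable_funPT. Qed.
Let mZ : measurable_fun setT Z.
Proof. by apply: measurable_funM; [exact: measurable_funD|exact: measurable_funV]. Qed.

Lemma measurable_stable_ratio : measurable_fun setT V.
Proof. by apply: measurable_funM => //; exact: measurable_fun_powR. Qed.

(** Off this null event Z > 0, so that powers of Z obey the usual rules. The value B = 0 is kept,
    since it is the almost sure one when r = 1. *)
Let null := A @^-1` `]-oo, 0] `|` B @^-1` `]-oo, 0[.

Let null0 : measurable null /\ P null = 0%E.
Proof.
have m1 : measurable (A @^-1` `]-oo, 0]) by exact: measurable_funPTI.
have m2 : measurable (B @^-1` `]-oo, 0[) by exact: measurable_funPTI.
split; first exact: measurableU.
have n1 : P (A @^-1` `]-oo, 0]) = 0%E by exact: is_gamma_gt0 gA.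
have n2 : P (B @^-1` `]-oo, 0[) = 0%E by exact: is_gamma_lt0 gB.
exact: (etrans (measureU0 m1 m2 n2) n1).
Qed.

Let Z_gt0 w : ~ null w -> 0 < Z w.
Proof.
move=> nw; have A0 : 0 < A w by rewrite ltNge; apply/negP => h; apply: nw; left; rewrite /= in_itv.
have B0 : 0 <= B w by rewrite leNgt; apply/negP => h; apply: nw; right; rewrite /= in_itv.
by rewrite divr_gt0// ltr_wpDr.
Qed.

Lemma stable_ratio_gt0 : P (V @^-1` `]-oo, 0]) = 0%E.
Proof.
have [mn n0] := null0.
have mS0 : measurable (S @^-1` `]-oo, 0]) by exact: measurable_funPTI.
have mV0 : measurable (V @^-1` `]-oo, 0]).
  exact: (measurable_preimageT measurable_stable_ratio).
apply/eqP; rewrite eq_le measure_ge0 andbT.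
have <- : P (S @^-1` `]-oo, 0] `|` null) = 0%E.
  exact: (etrans (measureU0 mS0 mn n0) (stable_gt0 a0 a1 Scf)).
apply: le_measure; rewrite ?inE//; first exact: measurableU.
move=> w /=; rewrite in_itv/= => V0.
have [|/Z_gt0 z0] := pselect (null w); [by right|left].
rewrite /= in_itv/= leNgt; apply/negP => S0; move: V0; rewrite leNgt => /negP; apply.
by rewrite mulr_gt0// powR_gt0.
Qed.

Lemma stable_ratio_laplace (x : R) : 0 < x ->
  (\int[P]_w (expR (- (x * V w)))%:E =
   \int[mu]_(t in `](x `^ alpha)%R, +oo[) (gamma_pdf r t)%:E)%E.
Proof.
move=> x0.
rewrite -(gamma_ratio_laplace r0 r1 (powR_ge0 x alpha) gA gB iAB).
pose f (z : R * R) : \bar R := (expR (- (x * (z.2 * z.1 `^ alpha^-1))))%:E.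
have mf : measurable_fun setT f.
  apply/measurable_EFinP; apply: measurableT_comp => //; apply: measurableT_comp => //.
  apply: measurable_funM => //; apply: measurable_funM => //.
  exact: measurable_fun_powR.
have f0 z : (0 <= f z)%E by rewrite lee_fin expR_ge0.
transitivity (\int[P]_w f (Z w, S w))%E; first by [].
rewrite (indep2_integral (f := f) mZ mS iZS mf f0).
have [mn n0] := null0.
apply: ge0_ae_eq_integral => //.
- pose S0 : {mfun T >-> R} := HB.pack (S : T -> R) (isMeasurableFun.Build _ _ _ _ _ mS).
  have mf' : measurable_fun setT (fun z : T * T => f (Z z.1, S z.2)).
    by apply: measurableT_comp => //; apply/measurable_fun_pair => //; exact: measurableT_comp.
  exact: (@measurable_fun_fubini_tonelli_F _ _ _ _ _ P (fun z : T * T => f (Z z.1, S z.2)) mf').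
- apply/measurable_EFinP; apply: measurableT_comp => //; apply: measurableT_comp => //.
  exact: measurable_funM.
- by move=> w _; apply: integral_ge0.
exists null; split => // w /= ne; apply: contrapT => /Z_gt0 z0; apply: ne => _.
rewrite /f /=.
have E w' : - (x * (S w' * Z w `^ alpha^-1)) = - ((x * Z w `^ alpha^-1) * S w') by ring.
under eq_integral do rewrite E.
rewrite (stable_laplace a0 a1 Scf) ?mulr_gt0 ?powR_gt0//.
(* Here (x Z^(1/alpha))^alpha = x^alpha Z: the stable law turns the scale Z^(1/alpha) into Z
   itself. *)
rewrite powRM ?powR_ge0 ?(ltW x0)// -powRrM mulVf ?gt_eqF// powRr1//.
exact: ltW.
Qed.

Lemma quotient_tail (W : {RV P >-> R}) (x : R) : has_pdf P W exp1_pdf -> indep2 P V W -> 0 < x ->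
  P ((fun w => W w / V w) @^-1` `]x, +oo[) =
   (\int[mu]_(t in `](x `^ alpha)%R, +oo[) (gamma_pdf r t)%:E)%E.
Proof.
move=> We iVW x0; rewrite -stable_ratio_laplace//.
have mV := measurable_stable_ratio.
have mW : measurable_fun setT W by exact: measurable_funPT.
have mWV : measurable_fun setT (fun w => W w / V w).
  by apply: measurable_funM => //; exact: measurable_funV.
rewrite integral_indic_preimage//.
pose f (z : R * R) : \bar R := (\1_(`]x, +oo[%classic) (z.2 / z.1))%:E.
have mf : measurable_fun setT f.
  apply/measurable_EFinP.
  have m1 : measurable_fun setT (\1_(`]x, +oo[%classic) : R -> R) by exact: measurable_indic.
  apply: (measurableT_comp m1); apply: measurable_funM => //; exact: measurable_funV.
have f0 z : (0 <= f z)%E by rewrite lee_fin.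
rewrite (indep2_integral (f := f) mV mW iVW mf f0).
have mV0 : measurable (V @^-1` `]-oo, 0]).
  exact: (measurable_preimageT measurable_stable_ratio).
apply: ge0_ae_eq_integral => //.
- have mf' : measurable_fun setT (fun z : T * T => f (V z.1, W z.2)).
    by apply: measurableT_comp => //; apply/measurable_fun_pair => //; exact: measurableT_comp.
  exact: (@measurable_fun_fubini_tonelli_F _ _ _ _ _ P (fun z : T * T => f (V z.1, W z.2)) mf').
- apply/measurable_EFinP; apply: measurableT_comp => //; apply: measurableT_comp => //.
  exact: measurable_funM.
- by move=> w _; apply: integral_ge0.
(* Only for V > 0 does W / V > x mean W > x V, an event of conditional probability e^(-x V). *)
exists (V @^-1` `]-oo, 0]); split => //; first exact: stable_ratio_gt0.
move=> w /= ne; rewrite in_itv/= leNgt; apply/negP => V0; apply: ne => _.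
rewrite -(exp1_tail We); last by rewrite mulr_ge0// ltW.
rewrite integral_indic_preimage//; apply: eq_integral => w' _; rewrite /f /=.
by rewrite !indicE !mem_setE !in_itv/= !andbT ltr_pdivlMr.
Qed.

End quotient_law.

(** * Normal mixtures *)

Section normal_mixture.
Context {R : realType}.
Local Notation mu := (@lebesgue_measure R).
Local Notation phi := (@normal_pdf R 0 1).

Lemma std_normal_pdfE (x : R) : phi x = normal_peak 1 * expR (- (x ^+ 2 / 2)).
Proof.
rewrite normal_pdfE ?oner_eq0// /normal_fun subr0 expr1n mulr2n.
by congr (_ * expR _); rewrite mulNr.
Qed.

Let Phi (x : R) := (\int[mu]_(t in `]-oo, x]) phi t)%R.

Let int_phi : mu.-integrable setT (EFin \o phi).
Proof. exact: integrable_normal_pdf. Qed.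

Let int_phiS (A : set R) : measurable A -> mu.-integrable A (EFin \o phi).
Proof. by move=> mA; apply: integrableS int_phi. Qed.

Let der_Phi (x : R) : is_derive x 1 Phi (phi x).
Proof.
have x1 : x < x + 1 by rewrite ltrDl.
have I : mu.-integrable [set` Interval -oo%O (BRight (x + 1))] (EFin \o phi).
  by apply: int_phiS; exact: measurable_itv.
have := continuous_FTC1 x1 I => /= FTC.
have {}FTC := FTC (ltNyr x) (@continuous_normal_pdf R 0 1 (oner_neq0 R) x).
case: FTC => d1 d2; split; first exact: d1.
by rewrite -derive1E; exact: d2.
Qed.

Let mid : measurable_fun setT (idfun : measurableTypeR R -> R).
Proof. exact: measurable_id. Qed.
Let idRV : {mfun (measurableTypeR R) >-> R} :=
  HB.pack (idfun : measurableTypeR R -> R) (isMeasurableFun.Build _ _ _ _ _ mid).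

Let PhiE x : cdf (P := normal_prob 0 1) idRV x = (Phi x)%:E.
Proof.
rewrite /cdf /distribution /pushforward /= /normal_prob /Phi /Rintegral fineK//.
by apply: integrable_fin_num; [exact: measurable_itv|apply: int_phiS; exact: measurable_itv].
Qed.

Let Phi_y : Phi x @[x --> +oo] --> (1 : R).
Proof.
have := (@cvg_cdfy1 _ _ _ (normal_prob 0 1) idRV).
have -> : cdf (P := normal_prob 0 1) idRV = EFin \o Phi by apply/funext => x; exact: PhiE.
by move/fine_cvg.
Qed.

Let Phi_Ny : Phi x @[x --> -oo] --> (0 : R).
Proof.
have := (@cvg_cdfNy0 _ _ _ (normal_prob 0 1) idRV).
have -> : cdf (P := normal_prob 0 1) idRV = EFin \o Phi by apply/funext => x; exact: PhiE.
by move/fine_cvg.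
Qed.

(* [x |-> (e^-b Phi (x - b / x) + e^b Phi (x + b / x)) / 2] is a primitive of the integrand. *)
Lemma integral_normal_pdf_expR (b : R) : 0 < b ->
  (\int[mu]_(x in `]0%R, +oo[) (phi x * expR (- (b ^+ 2 / (2 * x ^+ 2))))%:E =
   (2^-1 * expR (- b))%:E)%E.
Proof.
move=> b0.
pose Psi (x : R) : R := 2^-1 * (expR (- b) * Phi (x - b / x) + expR b * Phi (x + b / x)).
(* The value at 0 is the limit from the right, where x - b / x and x + b / x tend to minus and plus
   infinity. At infinity both tend to plus infinity, so the increment is (e^(-b) + e^b) / 2 - e^b /
   2 = e^(-b) / 2. *)
pose F (x : R) : R := if 0 < x then Psi x else 2^-1 * expR b.
pose f (x : R) : R := if 0 < x then phi x * expR (- (b ^+ 2 / (2 * x ^+ 2))) else 0.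
have dPsi (x : R) : 0 < x -> is_derive x 1 Psi (phi x * expR (- (b ^+ 2 / (2 * x ^+ 2)))).
  move=> x0; have xn0 := lt0r_neq0 x0.
  have d1 : is_derive x 1 (fun t : R => t - b / t) (1 + b / x ^+ 2).
    by eapply is_derive_eq; [der; exact: xn0|rewrite /=; field].
  have d2 : is_derive x 1 (fun t : R => t + b / t) (1 - b / x ^+ 2).
    by eapply is_derive_eq; [der; exact: xn0|rewrite /=; field].
  have p1 := @is_derive1_comp R Phi (fun t : R => t - b / t) x _ _ (der_Phi _) d1.
  have p2 := @is_derive1_comp R Phi (fun t : R => t + b / t) x _ _ (der_Phi _) d2.
  apply: (is_derive_eq (derM (der_cst x 2^-1)
    (derD (derM (der_cst x (expR (- b))) p1) (derM (der_cst x (expR b)) p2)))).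
  (* The cross term of (x - b / x)^2 / 2 is -b and cancels the factor e^(-b), and likewise with the
     signs reversed. The inner derivatives 1 + b / x^2 and 1 - b / x^2 then add up to 2. *)
  have e1 : expR (- b) * phi (x - b / x) = phi x * expR (- (b ^+ 2 / (2 * x ^+ 2))).
    rewrite !std_normal_pdfE mulrCA -!mulrA -!expRD; congr (_ * expR _).
    by field.
  have e2 : expR b * phi (x + b / x) = phi x * expR (- (b ^+ 2 / (2 * x ^+ 2))).
    rewrite !std_normal_pdfE mulrCA -!mulrA -!expRD; congr (_ * expR _).
    by field.
  transitivity (2^-1 * (expR (- b) * phi (x - b / x) * (1 + b / x ^+ 2) +
      expR b * phi (x + b / x) * (1 - b / x ^+ 2))); first by rewrite /=; ring.
  rewrite e1 e2; by move: (phi x * _) => z; field.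
have near_pos (x : R) : 0 < x -> \forall u \near x, 0 < u by exact: lt_nbhsr.
have dF (x : R) : 0 < x -> is_derive x 1 F (f x).
  move=> x0; rewrite /f x0; apply: near_eq_is_derive (dPsi x x0).
  by near=> u; rewrite /F ifT//; near: u; exact: near_pos.
have fc (x : R) : 0 < x -> {for x, continuous f}.
  move=> x0; have xn0 := lt0r_neq0 x0.
  have [dd H] : exists dd, is_derive x 1
      (fun x : R => normal_peak 1 * expR (- (x ^+ 2 / 2)) * expR (- (b ^+ 2 / (2 * x ^+ 2)))) dd.
    by eexists; der; apply: mulf_neq0; rewrite ?expf_neq0// pnatr_eq0.
  have := is_derive_cvg H; rewrite -std_normal_pdfE.
  have -> : phi x * expR (- (b ^+ 2 / (2 * x ^+ 2))) = f x by rewrite /f x0.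
  apply: cvg_trans; apply: near_eq_cvg; near=> u.
  rewrite /f ifT ?std_normal_pdfE//; near: u; exact: near_pos.
have f0 (x : R) : 0 <= f x by rewrite /f; case: ifP => // _; rewrite mulr_ge0 ?normal_pdf_ge0 ?expR_ge0.
have cpsi (G : set_system R) (l1 l2 : R) : Filter G -> Phi (x - b / x) @[x --> G] --> l1 ->
    Phi (x + b / x) @[x --> G] --> l2 ->
    Psi x @[x --> G] --> 2^-1 * (expR (- b) * l1 + expR b * l2).
  move=> FG h1 h2; apply: cvgM; first exact: cvg_cst.
  by apply: cvgD; apply: cvgM => //; exact: cvg_cst.
have Fy : F x @[x --> +oo] --> 2^-1 * (expR (- b) * 1 + expR b * 1).
  have : Psi x @[x --> +oo] --> 2^-1 * (expR (- b) * 1 + expR b * 1).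
    apply: cpsi.
      apply: (cvg_comp (fun x : R => x - b / x) Phi _ Phi_y).
      apply/cvgryPge => A; near=> x.
      have x1 : 1 <= x by near: x; apply: nbhs_pinfty_ge; exact: num_real.
      have xA : A + b <= x by near: x; apply: nbhs_pinfty_ge; exact: num_real.
      have : b / x <= b by rewrite ler_pdivrMr ?(lt_le_trans ltr01)// ler_peMr// ltW.
      by lra.
    apply: (cvg_comp (fun x : R => x + b / x) Phi _ Phi_y).
    apply/cvgryPge => A; near=> x.
    have x0 : 0 < x by near: x; apply: nbhs_pinfty_gt; exact: num_real.
    have xA : A <= x by near: x; apply: nbhs_pinfty_ge; exact: num_real.
    by rewrite (le_trans xA)// lerDl divr_ge0 ?ltW.
  apply: cvg_trans; apply: near_eq_cvg; near=> u.
  by rewrite /F ifT//; near: u; apply: nbhs_pinfty_gt; exact: num_real.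
have F0 : F x @[x --> 0^'+] --> F 0.
  rewrite [in X in _ --> X]/F ltxx.
  have : Psi x @[x --> 0^'+] --> 2^-1 * (expR (- b) * 0 + expR b * 1).
    apply: cpsi.
      apply: (cvg_comp (fun x : R => x - b / x) Phi _ Phi_Ny).
      apply/cvgrNyPle => A; near=> x.
      have x0 : 0 < x by near: x; exact: nbhs_right_gt.
      have A0 : 0 < `|A| + 1 by rewrite ltr_wpDl.
      have x1 : x <= 1 by near: x; apply: nbhs_right_le; exact: ltr01.
      have xA : x <= b / (`|A| + 1) by near: x; apply: nbhs_right_le; rewrite divr_gt0.
      have : `|A| + 1 <= b / x by rewrite ler_pdivlMr// mulrC -ler_pdivlMr.
      by have := ler_norm (- A); rewrite normrN; lra.
    apply: (cvg_comp (fun x : R => x + b / x) Phi _ Phi_y).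
    apply/cvgryPge => A; near=> x.
    have x0 : 0 < x by near: x; exact: nbhs_right_gt.
    have A0 : 0 < `|A| + 1 by rewrite ltr_wpDl.
    have xA : x <= b / (`|A| + 1) by near: x; apply: nbhs_right_le; rewrite divr_gt0.
    have : `|A| + 1 <= b / x by rewrite ler_pdivlMr// mulrC -ler_pdivlMr.
    by have := ler_norm A; lra.
  rewrite mulr0 add0r mulr1.
  apply: cvg_trans; apply: near_eq_cvg; near=> u.
  by rewrite /F ifT//; near: u; exact: nbhs_right_gt.
have f00 : f x @[x --> 0^'+] --> f 0.
  rewrite [in X in _ --> X]/f ltxx.
  have k0 : 0 < normal_peak 1 :> R by rewrite normal_peak_gt0// oner_neq0.
  have b2 : 0 < b ^+ 2 by rewrite exprn_gt0.
  apply/cvgrPdist_le => e e0.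
  have E0 : 0 < e * b ^+ 2 / (2 * normal_peak 1) by rewrite divr_gt0// mulr_gt0.
  near=> x.
  have x0 : 0 < x by near: x; exact: nbhs_right_gt.
  have x1 : x <= 1 by near: x; apply: nbhs_right_le; exact: ltr01.
  have xe : x <= e * b ^+ 2 / (2 * normal_peak 1).
    by near: x; exact: nbhs_right_le.
  rewrite sub0r normrN ger0_norm// /f x0.
  have h1 : phi x <= normal_peak 1 by apply: normal_pdf_ub; exact: oner_neq0.
  have h2 : expR (- (b ^+ 2 / (2 * x ^+ 2))) <= 2 * x ^+ 2 / b ^+ 2.
    have z0 : 0 < b ^+ 2 / (2 * x ^+ 2) by rewrite divr_gt0// mulr_gt0// exprn_gt0.
    rewrite expRN -[leRHS]invrK invf_div lef_pV2 ?posrE ?expR_gt0//.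
    by apply: le_trans (expR_ge1Dx _); rewrite lerDr.
  apply: (@le_trans _ _ (normal_peak 1 * (2 * x ^+ 2 / b ^+ 2))).
    by apply: ler_pM; [exact: normal_pdf_ge0|exact: expR_ge0|exact: h1|exact: h2].
  rewrite mulrA ler_pdivrMr//.
  rewrite ler_pdivlMr ?mulr_gt0// in xe.
  apply: le_trans xe.
  have x2 : x ^+ 2 <= x by rewrite expr2 ler_piMr// ltW.
  have -> : x * (2 * normal_peak 1) = normal_peak 1 * (2 * x) by ring.
  apply: ler_wpM2l; first exact: ltW.
  by apply: ler_wpM2l.
transitivity (\int[mu]_(x in `]0%R, +oo[) (f x)%:E)%E.
  by apply: eq_integral => x; rewrite inE/= in_itv/= andbT /f => ->.
have fcont : {within `[0, +oo[, continuous f}.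
  apply/continuous_within_itvcyP; split => // x; rewrite in_itv/= andbT; exact: fc.
rewrite integral_itv_obnd_cbnd; last first.
  apply/measurable_EFinP/measurable_funTS; apply: measurable_fun_if => //.
    exact: measurable_fun_ltr.
  apply: measurable_funTS; apply: measurable_funM; first exact: measurable_normal_pdf.
  apply: measurableT_comp => //; apply: measurableT_comp => //; apply: measurable_funM => //.
  by apply: measurable_funV; apply: measurable_funM => //; exact: measurable_funX.
rewrite (@ge0_continuous_FTC2y _ f F 0 _ _ fcont Fy _ F0)//.
- rewrite /F ltxx -EFinB; congr (_%:E); ring.
- by move=> x x0; have := dF x x0 => /is_derive_derivable.
- move=> x; rewrite in_itv/= andbT => x0; rewrite derive1E.
  by have [_ ->] := dF x x0.
Unshelve. all: end_near. Qed.

(** Since phi' = -x phi, a primitive of x^2 phi is Phi - x phi, and x phi vanishes at 0 and at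
    infinity. *)
Lemma integral_sqr_normal_pdf :
  (\int[mu]_(x in `]0%R, +oo[) (x ^+ 2 * phi x)%:E = \int[mu]_(x in `]0%R, +oo[) (phi x)%:E)%E.
Proof.
have dphi (x : R) : is_derive x 1 (phi : R -> R) (- x * phi x).
  have -> : phi = fun x : R => normal_peak 1 * expR (- (x ^+ 2 / 2)).
    by apply/funext => y; exact: std_normal_pdfE.
  eapply is_derive_eq; first by der.
  by rewrite /= expr1; field.
have cphi (x : R) : {for x, continuous (phi : R -> R)} by exact: is_derive_cvg (dphi x).
have dF (x : R) : is_derive x 1 (fun x : R => Phi x - x * phi x) (x ^+ 2 * phi x).
  eapply is_derive_eq.
    eapply derD; first exact: der_Phi.
    by eapply derN; eapply derM; [der|exact: dphi].
  by rewrite /=; ring.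
have Fy : x * phi x @[x --> +oo] --> (0 : R).
  have k0 : 0 < normal_peak 1 :> R by rewrite normal_peak_gt0// oner_neq0.
  apply/cvgrPdist_le => e e0; near=> x.
  have x0 : 0 < x by near: x; apply: nbhs_pinfty_gt; exact: num_real.
  have xe : normal_peak 1 * 2 / e <= x by near: x; apply: nbhs_pinfty_ge; exact: num_real.
  have p0 : 0 <= x * phi x by rewrite mulr_ge0 ?normal_pdf_ge0// ltW.
  rewrite sub0r normrN ger0_norm// std_normal_pdfE.
  have h2 : expR (- (x ^+ 2 / 2)) <= 2 / x ^+ 2.
    rewrite expRN -[leRHS]invrK invf_div lef_pV2 ?posrE ?expR_gt0 ?divr_gt0 ?exprn_gt0//.
    by apply: le_trans (expR_ge1Dx _); rewrite lerDr.
  apply: (@le_trans _ _ (x * (normal_peak 1 * (2 / x ^+ 2)))).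
    by rewrite !ler_pM2l.
  have -> : x * (normal_peak 1 * (2 / x ^+ 2)) = normal_peak 1 * 2 / x by field; rewrite gt_eqF.
  by rewrite ler_pdivrMr// [e * x]mulrC -ler_pdivrMr.
have mf : measurable_fun setT (phi : R -> R) by exact: measurable_normal_pdf.
rewrite integral_itv_obnd_cbnd; last first.
  by apply/measurable_EFinP/measurable_funTS; apply: measurable_funM => //; exact: measurable_funX.
rewrite integral_itv_obnd_cbnd; last by apply/measurable_EFinP/measurable_funTS.
rewrite (@ge0_continuous_FTC2y _ _ (fun x : R => Phi x - x * phi x) 0 (1 - 0)).
- rewrite (@ge0_continuous_FTC2y _ _ Phi 0 1); first by rewrite mul0r !subr0.
  + by move=> x _; exact: normal_pdf_ge0.
  + by apply: continuous_subspaceT => x; exact: cphi.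
  + exact: Phi_y.
  + by move=> x _; have := der_Phi x => /is_derive_derivable.
  + by apply: cvg_at_right_filter; exact: (is_derive_cvg (der_Phi 0)).
  + by move=> x _; rewrite derive1E; have [_ ->] := der_Phi x.
- by move=> x x0; rewrite mulr_ge0 ?sqr_ge0 ?normal_pdf_ge0.
- apply: continuous_subspaceT => x.
  have H : is_derive x 1 (fun t : R => t ^+ 2 * phi t) (x * 2 * phi x + x ^+ 2 * (- x * phi x)).
    eapply is_derive_eq; first by eapply derM; [der|exact: dphi].
    by rewrite /= expr1; ring.
  exact: is_derive_cvg H.
- by apply: cvgB => //; exact: Phi_y.
- by move=> x _; have := dF x => /is_derive_derivable.
- by apply: cvg_at_right_filter; exact: (is_derive_cvg (dF 0)).
- by move=> x _; rewrite derive1E; have [_ ->] := dF x.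
Unshelve. all: end_near. Qed.

End normal_mixture.

(** * Comparing laws through their tails *)

Section tails_determine_law.
Context {R : realType} {d d' : measure_display} {T : measurableType d} {T' : measurableType d'}.
Variables (P : probability T R) (P' : probability T' R).

(** Open right rays determine a law. For a < 0 they are increasing limits of closed rays from
    negative points, which are complements of left tails; for a = 0 they are limits of rays from
    positive points. No information at 0 is needed. *)
Lemma same_law_tails (Y : T -> R) (Z : T' -> R) :
  measurable_fun setT Y -> measurable_fun setT Z ->
  (forall a : R, 0 < a -> P (Y @^-1` `]a, +oo[) = P' (Z @^-1` `]a, +oo[)) ->
  (forall a : R, 0 < a -> P (Y @^-1` `]-oo, (- a)[) = P' (Z @^-1` `]-oo, (- a)[)) ->
  same_law P Y P' Z.
Proof.
move=> mY mZ Hp Hn; apply: same_lawP => //.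
have cvgF d1 (T1 : measurableType d1) (P1 : probability T1 R) (h : T1 -> R) (side : bool) (a k : R) :
    measurable_fun setT h -> 0 < k ->
    P1 (h @^-1` [set` Interval (BSide side (a + k * harmonic n)) +oo%O]) @[n --> \oo] -->
    P1 (h @^-1` `]a, +oo[).
  move=> mh k0; pose F n := h @^-1` [set` Interval (BSide side (a + k * harmonic n)) +oo%O].
  have mF n : measurable (F n).
    by apply: (measurable_preimageT mh); exact: measurable_itv.
  have <- : \bigcup_n F n = h @^-1` `]a, +oo[.
    apply/seteqP; split => w /=.
      move=> [n _]; rewrite /F /= !in_itv/= !andbT; case: (side) => /=.
        by apply: lt_le_trans; rewrite ltrDl mulr_gt0// invr_gt0.
      by apply: lt_trans; rewrite ltrDl mulr_gt0// invr_gt0.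
    rewrite in_itv/= andbT => aw.
    have [N HN] : exists N, k * harmonic N < h w - a.
      have e0 : 0 < (h w - a) / k by rewrite divr_gt0// subr_gt0.
      have /cvgrPdist_lt/(_ _ e0)[N _ /(_ N (leqnn _))] := @cvg_harmonic R.
      rewrite sub0r normrN ger0_norm ?harmonic_ge0// => HN; exists N.
      by rewrite mulrC -ltr_pdivlMr.
    exists N => //; rewrite /F /= in_itv/= andbT.
    have {}HN : a + k * harmonic N < h w by lra.
    by case: (side); [exact: ltW|].
  apply: nondecreasing_cvg_mu; [exact: mF|by apply: bigcup_measurable => n _; exact: mF|].
  move=> n m nm; apply/subsetPset => w /=; rewrite !in_itv/= !andbT.
  have le : a + k * harmonic m <= a + k * harmonic n.
    rewrite lerD2l; apply: ler_wpM2l; first exact: ltW.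
    by rewrite /harmonic /= lef_pV2 ?posrE ?ltr0n// ler_nat ltnS.
  by case: (side) => /=; [exact: le_trans|exact: le_lt_trans].
have Hle (a : R) : a < 0 -> P (Y @^-1` `[a, +oo[) = P' (Z @^-1` `[a, +oo[).
  move=> a0; have := Hn (- a); rewrite opprK oppr_gt0 => /(_ a0) E.
  have C d1 (T1 : measurableType d1) (h : T1 -> R) : h @^-1` `[a, +oo[ = ~` (h @^-1` `]-oo, a[).
    by apply/seteqP; split => w /=; rewrite !in_itv/= andbT leNgt => /negP.
  rewrite !C.
  have m1 : measurable (Y @^-1` `]-oo, a[) by apply: (measurable_preimageT mY).
  have m2 : measurable (Z @^-1` `]-oo, a[) by apply: (measurable_preimageT mZ).
  by rewrite (probability_setC P m1) (probability_setC P' m2) E.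
move=> a; have [a0|a0|->] := ltgtP a 0.
(* With this step all points a + k / (n + 1) are at most a / 2, hence still negative. *)
- have k0 : 0 < - a / 2 by lra.
  have c1 := cvgF _ _ P Y true a _ mY k0.
  have c2 := cvgF _ _ P' Z true a _ mZ k0.
  have E n : P (Y @^-1` `[a + - a / 2 * harmonic n, +oo[) = P' (Z @^-1` `[a + - a / 2 * harmonic n, +oo[).
    apply: Hle; have h1 : harmonic n <= 1 :> R by rewrite /harmonic /= invf_le1// ler1n.
    have := ler_wpM2l (ltW k0) h1; lra.
  apply: (cvg_unique _ c1) => //; apply: cvg_trans c2; apply: near_eq_cvg.
  by apply: nearW => n; exact: (esym (E n)).
- exact: Hp.
- have c1 := cvgF _ _ P Y false 0 1 mY ltr01.
  have c2 := cvgF _ _ P' Z false 0 1 mZ ltr01.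
  have E n : P (Y @^-1` `]0 + 1 * harmonic n, +oo[) = P' (Z @^-1` `]0 + 1 * harmonic n, +oo[).
    by apply: Hp; rewrite add0r mul1r harmonic_gt0.
  apply: (cvg_unique _ c1) => //; apply: cvg_trans c2; apply: near_eq_cvg.
  by apply: nearW => n; exact: (esym (E n)).
Qed.

End tails_determine_law.

Section even_density.
Context {R : realType} {d : measure_display} {T : measurableType d}.
Variable P : probability T R.

Lemma has_pdf_opp (Y : T -> R) (f : R -> R) : measurable_fun setT f -> (forall x, 0 <= f x) ->
  (forall x, f (- x) = f x) -> has_pdf P Y f -> has_pdf P (fun w => - Y w) f.
Proof.
move=> mf f0 fN H B mB.
have mN : measurable ((-%R : R -> R) @^-1` B).
  by apply: (measurable_preimageT (@oppr_measurable _ setT)).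
have -> : (fun w => - Y w) @^-1` B = Y @^-1` ((-%R : R -> R) @^-1` B) by [].
rewrite H//.
have mo : measurable_fun setT (-%R : measurableTypeR R -> measurableTypeR R).
  by have : measurable_fun setT (-%R : R -> R) by exact: oppr_measurable.
transitivity (\int[pushforward lebesgue_measure (-%R : measurableTypeR R -> measurableTypeR R) ]_(x in B) (f x)%:E)%E.
  rewrite ge0_integral_pushforward//=.
  - by apply: eq_integral => x _ /=; rewrite fN.
  - by apply/measurable_EFinP; exact: measurable_funTS.
  - by move=> x _; rewrite lee_fin.
by apply: eq_measure_integral => A mA _; exact: lebesgue_measureN.
Qed.

End even_density.

Section mixture_tails.
Context {R : realType}.
Local Notation mu := (@lebesgue_measure R).
Local Notation phi := (@normal_pdf R 0 1).

(** The common tail at a > 0. Given X = x > 0, the event X sqrt(G) > a is G > a^2 / x^2, whose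
    probability is the gamma tail at (a^2 / x^2)^alpha. *)
Definition mixture_tail (r alpha a : R) : \bar R :=
  (\int[mu]_(x in `]0%R, +oo[) ((phi x)%:E *
     \int[mu]_(t in `]((a ^+ 2 / x ^+ 2) `^ alpha)%R, +oo[) (gamma_pdf r t)%:E))%E.

Section laplace_side.
Context {d : measure_display} {T : measurableType d}.
Variable P : probability T R.
Variables (r alpha : R) (S A B : {RV P >-> R}).
Hypotheses (r0 : 0 < r) (r1 : r <= 1) (a0 : 0 < alpha) (a1 : alpha <= 1).
Hypotheses (Scf : has_stable_cf P S alpha) (gA : is_gamma P A r) (gB : is_gamma P B (1 - r)).
Hypotheses (iAB : indep2 P A B) (iZS : indep2 P (fun w => (A w + B w) / A w) S).
Local Notation V := (stable_ratio alpha S A B).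

(** No normal or exponential variable is at hand on this space. Given V, the tail e^(-b) / 2 with b
    = a sqrt(2 V) is rewritten as a Gaussian integral of e^(-(a^2 / x^2) V); exchanging the
    integrals leaves the Laplace transform of V at a^2 / x^2. *)
Lemma laplace_quotient_tail (L : {RV P >-> R}) (a : R) : has_pdf P L laplace_pdf ->
  indep2 P V L -> 0 < a ->
  P ((fun w => L w / Num.sqrt (2 * V w)) @^-1` `]a, +oo[) = mixture_tail r alpha a.
Proof.
move=> Ld iVL a_gt0.
have mV := measurable_stable_ratio alpha S A B.
have mL : measurable_fun setT L by exact: measurable_funPT.
have ms := @measurable_sqrt R.
have mq : measurable_fun setT (fun w => L w / Num.sqrt (2 * V w)).
  apply: measurable_funM => //; apply: measurable_funV; apply: (measurableT_comp ms).
  exact: measurable_funM.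
rewrite integral_indic_preimage//.
pose f (z : R * R) : \bar R := (\1_(`]a, +oo[%classic) (z.2 / Num.sqrt (2 * z.1)))%:E.
have mf : measurable_fun setT f.
  apply/measurable_EFinP.
  have m1 : measurable_fun setT (\1_(`]a, +oo[%classic) : R -> R) by exact: measurable_indic.
  apply: (measurableT_comp m1); apply: measurable_funM => //; apply: measurable_funV.
  by apply: (measurableT_comp ms); exact: measurable_funM.
have f0 z : (0 <= f z)%E by rewrite lee_fin.
rewrite (indep2_integral (f := f) mV mL iVL mf f0).
pose h (z : T * measurableTypeR R) : \bar R :=
  (if 0 < z.2 then phi z.2 * expR (- (a ^+ 2 / z.2 ^+ 2 * V z.1)) else 0)%:E.
have mh : measurable_fun setT h.
  apply/measurable_EFinP; apply: measurable_fun_if => //.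
    by apply: measurable_fun_ltr => //; exact: measurable_snd.
  apply: measurable_funTS; apply: measurable_funM.
    by apply: (measurableT_comp (measurable_normal_pdf 0 1)); exact: measurable_snd.
  apply: measurableT_comp => //; apply: measurableT_comp => //; apply: measurable_funM.
    apply: measurable_funM => //; apply: measurable_funV; apply: measurable_funX.
    exact: measurable_snd.
  exact: (measurableT_comp mV measurable_fst).
have h0 z : (0 <= h z)%E.
  by rewrite lee_fin; case: ifP => // _; rewrite mulr_ge0 ?normal_pdf_ge0 ?expR_ge0.
have hE w : (\int[mu]_x h (w, x) =
    \int[mu]_(x in `]0%R, +oo[) (phi x * expR (- (a ^+ 2 / x ^+ 2 * V w)))%:E)%E.
  rewrite [RHS]integral_mkcond; apply: eq_integral => x _.
  by rewrite patchE mem_setE in_itv/= andbT /h /=; case: ifP.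
have mV0 : measurable (V @^-1` `]-oo, 0]).
  by apply: (measurable_preimageT mV).
transitivity (\int[P]_w \int[mu]_x h (w, x))%E.
  apply: ge0_ae_eq_integral => //.
  - have mf' : measurable_fun setT (fun z : T * T => f (V z.1, L z.2)).
      by apply: measurableT_comp => //; apply/measurable_fun_pair => //; exact: measurableT_comp.
    exact: (@measurable_fun_fubini_tonelli_F _ _ _ _ _ P (fun z : T * T => f (V z.1, L z.2)) mf').
  - exact: (@measurable_fun_fubini_tonelli_F _ _ _ _ _ mu h mh).
  - by move=> w _; apply: integral_ge0.
  - by move=> w _; apply: integral_ge0.
  exists (V @^-1` `]-oo, 0]); split => //; first exact: (stable_ratio_gt0 r0 a0 a1 Scf gA gB).
  move=> w /= ne; rewrite in_itv/= leNgt; apply/negP => V0; apply: ne => _.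
  rewrite hE.
  pose b := a * Num.sqrt (2 * V w).
  have s0 : 0 < Num.sqrt (2 * V w) by rewrite sqrtr_gt0 mulr_gt0.
  have b0 : 0 < b by rewrite mulr_gt0.
  transitivity (P (L @^-1` `]b, +oo[)).
    rewrite integral_indic_preimage//; apply: eq_integral => w' _; rewrite /f /=.
    by rewrite !indicE !mem_setE !in_itv/= !andbT ltr_pdivlMr.
  rewrite (laplace_tail Ld (ltW b0)) -integral_normal_pdf_expR//.
  apply: eq_integral => x; rewrite inE/= in_itv/= andbT => x0.
  congr ((_ * expR (- _))%:E).
  have V2 : 0 <= 2 * V w by rewrite ltW// mulr_gt0.
  rewrite /b exprMn (sqr_sqrtr V2); move: (V w) (x : R) x0 => v z z0.
  by field; exact: lt0r_neq0.
rewrite (@fubini_tonelli _ _ _ _ R P mu h mh h0).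
rewrite /mixture_tail [RHS]integral_mkcond; apply: eq_integral => x _.
rewrite patchE mem_setE in_itv/= andbT /h /=; case: ifPn => x0; last by rewrite integral0.
under eq_integral do rewrite EFinM.
rewrite ge0_integralZl//; last 2 first.
- by apply/measurable_EFinP; apply: measurableT_comp => //; apply: measurableT_comp => //; exact: measurable_funM.
- by rewrite lee_fin normal_pdf_ge0.
congr (_ * _)%E; apply: stable_ratio_laplace => //.
by rewrite divr_gt0// exprn_gt0.
Qed.

End laplace_side.

Section gamma_side.
Context {d : measure_display} {T : measurableType d}.
Variable P : probability T R.

Lemma normal_mixture_tail (r alpha : R) (X G : {RV P >-> R}) (a : R) :
  0 < alpha -> alpha <= 1 -> has_pdf P X phi -> has_pdf P G (gg_pdf r alpha 1) ->
  indep2 P X G -> 0 < a ->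
  P ((fun w => X w * Num.sqrt (G w)) @^-1` `]a, +oo[) = mixture_tail r alpha a.
Proof.
move=> al0 al1 Xd Gd iXG a_gt0.
have mX : measurable_fun setT X by exact: measurable_funPT.
have mG : measurable_fun setT G by exact: measurable_funPT.
have ms := @measurable_sqrt R.
have mXG : measurable_fun setT (fun w => X w * Num.sqrt (G w)).
  by apply: measurable_funM => //; exact: (measurableT_comp ms).
rewrite integral_indic_preimage//.
pose f (z : R * R) : \bar R := (\1_(`]a, +oo[%classic) (z.1 * Num.sqrt z.2))%:E.
have mf : measurable_fun setT f.
  apply/measurable_EFinP.
  have m1 : measurable_fun setT (\1_(`]a, +oo[%classic) : R -> R) by exact: measurable_indic.
  apply: (measurableT_comp m1); apply: measurable_funM => //.
  exact: (measurableT_comp ms).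
have f0 z : (0 <= f z)%E by rewrite lee_fin.
rewrite (indep2_integral (f := f) mX mG iXG mf f0).
pose H x := (\int[P]_w f (x, G w))%E.
have mH : measurable_fun setT H.
  have mf' : measurable_fun setT (fun z : R * T => f (z.1, G z.2)).
    by apply: measurableT_comp => //; apply/measurable_fun_pair => //; exact: measurableT_comp.
  exact: (@measurable_fun_fubini_tonelli_F _ _ _ _ _ P (fun z : R * T => f (z.1, G z.2)) mf').
have H0 x : (0 <= H x)%E by exact: integral_ge0.
rewrite -/(H _) (has_pdf_integral (f := phi) (g := H))//; last 2 first.
- exact: measurable_normal_pdf.
- by move=> x; exact: normal_pdf_ge0.
rewrite /mixture_tail [RHS]integral_mkcond; apply: eq_integral => x _.
rewrite patchE mem_setE in_itv/= andbT muleC; case: ifPn => x0; last first.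
  rewrite /H integral0_eq ?mule0// => w _; rewrite /f /= indicE mem_setE in_itv/= andbT.
  rewrite ltNge (@le_trans _ _ 0)//; last exact: ltW.
  by rewrite mulr_le0_ge0 ?sqrtr_ge0// leNgt.
congr (_ * _)%E; rewrite -gg_pdf_tail//; last by rewrite divr_gt0// exprn_gt0.
rewrite -Gd// integral_indic_preimage//; apply: eq_integral => w _.
rewrite /f /= !indicE !mem_setE !in_itv/= !andbT; congr (_%:R%:E); congr nat_of_bool.
rewrite -expr_div_n [x * _]mulrC -ltr_pdivrMr//.
have ax : 0 <= a / x by rewrite divr_ge0// ltW.
(* For G <= 0 the square root is 0 by convention, and both inequalities fail. *)
have [G0|G0] := ltP 0 (G w).
  by rewrite -[RHS]ltr_sqrt// sqrtr_sqr ger0_norm.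
rewrite ler0_sqrtr// ltNge ax/= ltNge (le_trans G0)// sqr_ge0.
by [].
Qed.

End gamma_side.
End mixture_tails.

Section independent_family.
Context {R : realType} {d : measure_display} {T : measurableType d}.
Variable P : probability T R.
Context (I : choiceType) (Y : I -> T -> R).
Hypotheses (mY : forall i, measurable_fun setT (Y i)) (indepY : mutually_independent P Y).

Lemma indep_outside1 i : indep_outside P Y [:: i] (Y i).
Proof.
have := indep_outside_pair mY indepY (measurable_cst (0 : R)) (indep_outside_cst P Y (0 : R)) (isT : i \notin [::]).
by move=> /(indep_outside_comp (@measurable_snd _ _ R R)).
Qed.

(** Coordinates are adjoined in the order A, B, S, with the ratio Z formed before S enters; the
    final list records the coordinates that V depends on, so anything else in the family is
    independent of V. *)
Lemma stable_ratio_indep (alpha : R) (S A B : {RV P >-> R}) (iS iA iB : I) :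
  iB != iA -> iS != iB -> iS != iA ->
  Y iS = S -> Y iA = A -> Y iB = B ->
  [/\ indep2 P A B, indep2 P (fun w => (A w + B w) / A w) S &
    indep_outside P Y [:: iS; iB; iA] (stable_ratio alpha S A B)].
Proof.
move=> BA SB SA ES EA EB.
have mA := mY iA; have mB := mY iB; have mS := mY iS.
have iBn : iB \notin [:: iA] by rewrite inE.
have oA := @indep_outside1 iA.
have oAB := indep_outside_pair mY indepY mA oA iBn.
pose ratio (z : R * R) := (z.1 + z.2) / z.1.
have mr : measurable_fun setT ratio.
  by apply: measurable_funM; [exact: measurable_funD|exact: measurable_funV].
have oZ := indep_outside_comp mr oAB.
have iSn : iS \notin [:: iB; iA] by rewrite !inE negb_or SB.
have mZ : measurable_fun setT (ratio \o (fun w => (Y iA w, Y iB w))).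
  by apply: measurableT_comp => //; exact/measurable_fun_pair.
have oZS := indep_outside_pair mY indepY mZ oZ iSn.
pose V (z : R * R) := z.2 * z.1 `^ alpha^-1.
have mV : measurable_fun setT V.
  by apply: measurable_funM => //; exact: measurable_fun_powR.
have oV := indep_outside_comp mV oZS.
have i1 := indep_outside_indep2 oA iBn.
have i2 := indep_outside_indep2 oZ iSn.
rewrite EA EB in i1; rewrite /comp EA EB ES in i2; rewrite /comp EA EB ES in oV.
by split.
Qed.

End independent_family.

(** * The two representations of the limit law *)

Section representations.
Context {R : realType}.
Variables (r alpha : R).
Hypotheses (hr : 0 < r) (r1 : r <= 1) (a0 : 0 < alpha) (a1 : alpha <= 1).
Context (d1 : measure_display) (T1 : measurableType d1) (P1 : probability T1 R).
Variables (X1 G1 : {RV P1 >-> R}).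
Hypotheses (hX1 : has_pdf P1 X1 (normal_pdf 0 1)) (hG1 : has_pdf P1 G1 (gg_pdf r alpha 1)).
Hypothesis i1 : mutually_independent P1 (fun b : bool => if b then X1 : T1 -> R else G1 : T1 -> R).

Let mX1 : measurable_fun setT X1. Proof. exact: measurable_funPT. Qed.
Let mG1 : measurable_fun setT G1. Proof. exact: measurable_funPT. Qed.
Let ms := @measurable_sqrt R.

Let iX1G1 : indep2 P1 X1 G1 /\ indep2 P1 G1 X1.
Proof.
have mY b : measurable_fun setT (if b then X1 : T1 -> R else G1 : T1 -> R) by case: b.
split.
  by have := indep_outside_indep2 (@indep_outside1 _ _ _ _ _ _ mY i1 true) (_ : false \notin [:: true]); apply.
by have := indep_outside_indep2 (@indep_outside1 _ _ _ _ _ _ mY i1 false) (_ : true \notin [:: false]); apply.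
Qed.

Lemma gamma_mixture_exponential (d2 : measure_display) (T2 : measurableType d2) (P2 : probability T2 R)
    (X2 W2 S2 Ga2 Gb2 : {RV P2 >-> R}) :
  has_pdf P2 X2 (normal_pdf 0 1) -> has_pdf P2 W2 exp1_pdf ->
  has_stable_cf P2 S2 alpha -> is_gamma P2 Ga2 r -> is_gamma P2 Gb2 (1 - r) ->
  mutually_independent P2 (fun i : 'I_5 =>
    nth (X2 : T2 -> R) [:: X2 : T2 -> R; W2 : T2 -> R; S2 : T2 -> R; Ga2 : T2 -> R; Gb2 : T2 -> R] i) ->
  same_law P1 (fun w => X1 w * Num.sqrt (G1 w))
    P2 (fun w => X2 w * Num.sqrt (W2 w / (S2 w * ((Ga2 w + Gb2 w) / Ga2 w) `^ alpha^-1))).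
Proof.
move=> hX2 hW2 hS2 hA2 hB2 i2.
have mX2 : measurable_fun setT X2 by exact: measurable_funPT.
have mW2 : measurable_fun setT W2 by exact: measurable_funPT.
set Y := (fun i : 'I_5 => _) in i2.
have mY i : measurable_fun setT (Y i).
  by case: i => [[|[|[|[|[|]]]]] ?] //=; exact: measurable_funPT.
pose o k (lt : (k < 5)%N) : 'I_5 := Ordinal lt.
have [iAB iZS oV] := @stable_ratio_indep R _ _ P2 'I_5 Y mY i2 alpha S2 Ga2 Gb2
  (@o 2%N isT) (@o 3%N isT) (@o 4%N isT) isT isT isT erefl erefl erefl.
have mV := measurable_stable_ratio alpha S2 Ga2 Gb2.
have iW : @o 1%N isT \notin [:: @o 2%N isT; @o 4%N isT; @o 3%N isT] by [].
have iVW := indep_outside_indep2 oV iW.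
have oVW := indep_outside_pair mY i2 mV oV iW.
have mq : measurable_fun setT (fun z : R * R => z.2 / z.1).
  by apply: measurable_funM => //; exact: measurable_funV.
have oQ := indep_outside_comp mq oVW.
have iQX := indep_outside_indep2 oQ (_ : @o 0%N isT \notin _).
have {}iQX := iQX isT.
set Q := _ \o _ in iQX.
have mQ : measurable_fun setT Q.
  by apply: measurableT_comp => //; exact/measurable_fun_pair.
have sQ : same_law P1 G1 P2 Q.
  apply: same_law_tails => // a apos.
    rewrite hG1// gg_pdf_tail//; apply/esym.
    exact: (quotient_tail hr r1 a0 a1 hS2 hA2 hB2 iAB iZS hW2 iVW apos).
  (* Neither law charges the negative axis: the density of G vanishes there, and W / V < 0 forces V
     <= 0 or W < 0, both null events. *)
  rewrite hG1// integral0_eq; last first.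
    by move=> x /=; rewrite in_itv/= => xa; rewrite /gg_pdf ltNge (@le_trans _ _ (- a)) ?oppr_le0 ?ltW.
  apply/esym/eqP; rewrite eq_le measure_ge0 andbT.
  have n1 := stable_ratio_gt0 hr a0 a1 hS2 hA2 hB2.
  have n2 : P2 (W2 @^-1` `]-oo, 0[) = 0%E.
    rewrite hW2// integral0_eq// => x /=; rewrite in_itv/= => x0.
    by rewrite /exp1_pdf leNgt x0.
  have m1 : measurable (stable_ratio alpha S2 Ga2 Gb2 @^-1` `]-oo, 0]).
    by apply: (measurable_preimageT mV).
  have m2 : measurable (W2 @^-1` `]-oo, 0[) by exact: measurable_funPTI.
  rewrite -n1 -(measureU0 m1 m2 n2); apply: le_measure; rewrite ?inE.
  - by apply: (measurable_preimageT mQ).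
  - exact: measurableU.
  move=> w /=; rewrite !in_itv/= => Qa.
  have [V0|V0] := leP (stable_ratio alpha S2 Ga2 Gb2 w) 0; [by left|right].
  rewrite ltNge; apply/negP => W0; move: Qa; apply/negP; rewrite -leNgt; apply: (@le_trans _ _ 0).
    by rewrite oppr_le0 ltW.
  by rewrite /Q /=; apply: divr_ge0 => //; apply: ltW.
apply: (@same_law_indep2 R _ _ _ _ P1 P2 G1 X1 Q X2 (fun z => z.2 * Num.sqrt z.1)) => //.
- by apply: measurable_funM => //; exact: (measurableT_comp ms).
- exact: iX1G1.2.
- by move=> B mB; rewrite hX1// hX2.
Qed.

(** Right tails are both [mixture_tail]. Left tails are right tails of the products with -X and
    -Lambda, which have the same even densities and the same independence. *)
Lemma gamma_mixture_laplace (d3 : measure_display) (T3 : measurableType d3) (P3 : probability T3 R)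
    (L3 S3 Ga3 Gb3 : {RV P3 >-> R}) :
  has_pdf P3 L3 laplace_pdf ->
  has_stable_cf P3 S3 alpha -> is_gamma P3 Ga3 r -> is_gamma P3 Gb3 (1 - r) ->
  mutually_independent P3 (fun i : 'I_4 =>
    nth (L3 : T3 -> R) [:: L3 : T3 -> R; S3 : T3 -> R; Ga3 : T3 -> R; Gb3 : T3 -> R] i) ->
  same_law P1 (fun w => X1 w * Num.sqrt (G1 w))
    P3 (fun w => L3 w / Num.sqrt (2 * S3 w * ((Ga3 w + Gb3 w) / Ga3 w) `^ alpha^-1)).
Proof.
move=> hL hS hA hB i3.
have mL : measurable_fun setT L3 by exact: measurable_funPT.
set Y := (fun i : 'I_4 => _) in i3.
have mY i : measurable_fun setT (Y i).
  by case: i => [[|[|[|[|]]]] ?] //=; exact: measurable_funPT.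
pose o k (lt : (k < 4)%N) : 'I_4 := Ordinal lt.
have [iAB iZS oV] := @stable_ratio_indep R _ _ P3 'I_4 Y mY i3 alpha S3 Ga3 Gb3
  (@o 1%N isT) (@o 2%N isT) (@o 3%N isT) isT isT isT erefl erefl erefl.
have mV := measurable_stable_ratio alpha S3 Ga3 Gb3.
have iL : @o 0%N isT \notin [:: @o 1%N isT; @o 3%N isT; @o 2%N isT] by [].
have iVL := indep_outside_indep2 oV iL.
have -> : (fun w => L3 w / Num.sqrt (2 * S3 w * ((Ga3 w + Gb3 w) / Ga3 w) `^ alpha^-1)) =
    (fun w => L3 w / Num.sqrt (2 * stable_ratio alpha S3 Ga3 Gb3 w)).
  by apply/funext => w; rewrite /stable_ratio mulrA.
have mX1N : measurable_fun setT (fun w => - X1 w) by exact: measurableT_comp.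
have mLN : measurable_fun setT (fun w => - L3 w) by exact: measurableT_comp.
pose XN : {RV P1 >-> R} := HB.pack (fun w => - X1 w) (isMeasurableFun.Build _ _ _ _ _ mX1N).
pose LN : {RV P3 >-> R} := HB.pack (fun w => - L3 w) (isMeasurableFun.Build _ _ _ _ _ mLN).
have hXN : has_pdf P1 XN (normal_pdf 0 1).
  apply: has_pdf_opp hX1; [exact: measurable_normal_pdf|by move=> x; exact: normal_pdf_ge0|].
  by move=> x; rewrite !std_normal_pdfE sqrrN.
have hLN : has_pdf P3 LN laplace_pdf.
  apply: has_pdf_opp hL.
  - apply: measurable_funM => //; apply: measurableT_comp => //.
    exact: (measurableT_comp (@oppr_measurable R setT) (@normr_measurable R setT)).
  - by move=> x; rewrite /laplace_pdf mulr_ge0 ?expR_ge0.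
  - by move=> x; rewrite /laplace_pdf normrN.
have opp2 d (T : measurableType d) (P : probability T R) e2 (T' : measurableType e2) (U : T -> R) (V : T -> T') :
    indep2 P U V -> indep2 P (fun w => - U w) V.
  move=> i B C mB mC; apply: (i (-%R @^-1` B) C) => //.
  by apply: (measurable_preimageT (@oppr_measurable _ setT)).
have opp2' d (T : measurableType d) (P : probability T R) e2 (T' : measurableType e2) (U : T -> R) (V : T -> T') :
    indep2 P V U -> indep2 P V (fun w => - U w).
  move=> i B C mB mC; apply: (i B (-%R @^-1` C)) => //.
  by apply: (measurable_preimageT (@oppr_measurable _ setT)).
have flip (T : Type) (h h' : T -> R) (a : R) : (forall w, h' w = - h w) ->
    h @^-1` `]-oo, (- a)[ = h' @^-1` `]a, +oo[.
  by move=> E; apply/seteqP; split => w /=; rewrite !in_itv/= andbT E ltrNr.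
apply: same_law_tails.
- by apply: measurable_funM => //; exact: (measurableT_comp ms).
- apply: measurable_funM => //; apply: measurable_funV; apply: (measurableT_comp ms).
  exact: measurable_funM.
- move=> a apos; rewrite (normal_mixture_tail a0 a1 hX1 hG1 iX1G1.1 apos).
  by rewrite (laplace_quotient_tail hr r1 a0 a1 hS hA hB iAB iZS hL iVL apos).
move=> a apos.
rewrite (flip T1 _ (fun w => XN w * Num.sqrt (G1 w))); last by move=> w; rewrite /= mulNr.
rewrite (flip T3 _ (fun w => LN w / Num.sqrt (2 * stable_ratio alpha S3 Ga3 Gb3 w))); last first.
  by move=> w; rewrite /= mulNr.
have iXN : indep2 P1 XN G1 by apply: opp2; exact: iX1G1.1.
have iLN : indep2 P3 (stable_ratio alpha S3 Ga3 Gb3) LN by apply: opp2'.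
rewrite (normal_mixture_tail a0 a1 hXN hG1 iXN apos).
by rewrite (laplace_quotient_tail hr r1 a0 a1 hS hA hB iAB iZS hLN iLN apos).
Qed.

End representations.

(** * Test functions *)

Section logistic_test_functions.
Context {R : realType}.

(** The coefficients [a] and [b] stand for f'(u) and f''(u) / 2. The second-order remainder is
    bounded both quadratically and cubically, because the smaller of the two bounds is what remains
    integrable with only a second moment and still vanishes in the limit. *)
Definition lindeberg_test (f : R -> R) (L : R) :=
  [/\ measurable_fun setT f, forall u, 0 <= f u <= 1,
    forall u h, `|f (u + h) - f u| <= L * `|h| &
    forall u, exists a b : R, forall h,
      `|f (u + h) - f u - a * h - b * h ^+ 2| <= L * h ^+ 2 /\
      `|f (u + h) - f u - a * h - b * h ^+ 2| <= L * `|h| ^+ 3].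

(** By the mean value theorem g(h) = g'(c) h with |c| <= |h|. Iterating this down from the highest
    derivative yields Taylor bounds, without factorials. *)
Lemma mean_growth (g dg : R -> R) (K : R) m h :
  (forall t : R, is_derive t 1 g (dg t)) -> g 0 = 0 ->
  (forall t, `|dg t| <= K * `|t| ^+ m) -> `|g h| <= K * `|h| ^+ m.+1.
Proof.
move=> dgE g0 bdg.
have K0 : 0 <= K.
  have := bdg 1; rewrite normr1 expr1n mulr1; exact: le_trans.
have cg a b : {within `[a, b], continuous g}.
  apply: continuous_subspaceT => x; exact: is_derive_cvg.
have [c ch ->] : exists2 c, `|c| <= `|h| & g h = dg c * h.
  have [h0|h0] := leP 0 h.
    have [c] := MVT_segment h0 (fun x _ => dgE x) (@cg _ _).
    rewrite in_itv/= g0 !subr0 => /andP[c0 ch] E; exists c => //.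
    by rewrite !ger0_norm.
  have [c] := MVT_segment (ltW h0) (fun x _ => dgE x) (@cg _ _).
  rewrite in_itv/= g0 !sub0r => /andP[c0 ch] E; exists c.
    by rewrite (ler0_norm ch) (ler0_norm (ltW h0)) lerN2.
  by apply: oppr_inj; rewrite E mulrN.
rewrite normrM exprSr mulrA ler_wpM2r// (le_trans (bdg c))// ler_wpM2l//.
by rewrite lerXn2r// nnegrE.
Qed.

Lemma lindeberg_test_C3 (f f1 f2 f3 : R -> R) (K : R) :
  (forall u, 0 <= f u <= 1) ->
  (forall u : R, is_derive u 1 f (f1 u)) -> (forall u : R, is_derive u 1 f1 (f2 u)) ->
  (forall u : R, is_derive u 1 f2 (f3 u)) ->
  (forall u, `|f1 u| <= K) -> (forall u, `|f2 u| <= K) -> (forall u, `|f3 u| <= K) ->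
  lindeberg_test f (2 * K).
Proof.
move=> f01 df df1 df2 b1 b2 b3.
have K0 : 0 <= K by apply: le_trans (b1 0).
have shift (g dg : R -> R) (u : R) : (forall u : R, is_derive u 1 g (dg u)) ->
    forall t : R, is_derive t 1 (fun t => g (u + t)) (dg (u + t)).
  move=> H t; have Hs : is_derive t 1 (fun t : R => u + t) 1.
    by eapply is_derive_eq; [der|rewrite add0r].
  by have := is_derive1_comp (H (u + t)) Hs; rewrite mulr1.
split=> //.
- apply: continuous_measurable_fun => x; exact: is_derive_cvg.
- move=> u h; have := @mean_growth (fun t => f (u + t) - f u) (fun t => f1 (u + t)) (2 * K) 0 h.
  rewrite addr0 subrr expr1; apply => //.
    move=> t; eapply is_derive_eq; first by eapply derD; [exact: (shift _ _ u df)|der].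
    by rewrite addr0.
  by move=> t; rewrite expr0 mulr1 (le_trans (b1 _))// mulrDl mul1r lerDl.
move=> u; exists (f1 u), (f2 u / 2) => h.
have d2 (t : R) : is_derive t 1 (fun t => f2 (u + t) - f2 u) (f3 (u + t)).
  eapply is_derive_eq; first by eapply derD; [exact: (shift _ _ u df2)|der].
  by rewrite addr0.
have d1 (t : R) : is_derive t 1 (fun t => f1 (u + t) - f1 u - f2 u * t) (f2 (u + t) - f2 u).
  eapply is_derive_eq.
    eapply derD; last by der.
    by eapply derD; [exact: (shift _ _ u df1)|der].
  by ring.
have d0 (t : R) : is_derive t 1 (fun t => f (u + t) - f u - f1 u * t - f2 u / 2 * t ^+ 2)
    (f1 (u + t) - f1 u - f2 u * t).
  eapply is_derive_eq.
    eapply derD; last by der.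
    eapply derD; last by der.
    by eapply derD; [exact: (shift _ _ u df)|der].
  by rewrite expr1; field.
have l2 := mean_growth _ d2; have l1 := mean_growth _ d1; have l0 := mean_growth _ d0.
have z2 : f2 (u + 0) - f2 u = 0 by rewrite addr0 subrr.
have z1 : f1 (u + 0) - f1 u - f2 u * 0 = 0 by rewrite addr0 mulr0 !subr0 subrr.
have z0 : f (u + 0) - f u - f1 u * 0 - f2 u / 2 * 0 ^+ 2 = 0.
  by rewrite addr0 expr0n/= !mulr0 !subr0 subrr.
split.
  (* The quadratic bound starts from the oscillation of f'', at most 2 K, and climbs two levels; the
     cubic bound starts from f''' and climbs three. *)
  rewrite -[X in _ <= _ * X](real_normK (num_real h)); apply: l0 => // t; apply: l1 => // s.
  by rewrite expr0 mulr1 (le_trans (ler_normB _ _))// mulrDl mul1r lerD.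
apply: l0 => // t; apply: l1 => // s; apply: l2 => // v.
by rewrite expr0 mulr1 (le_trans (b3 _))// mulrDl mul1r lerDl.
Qed.

(** A smooth substitute for the indicator of ]-oo, x]: it decreases from 1 to 0 when c > 0, and more
    steeply for larger c. *)
Definition logistic (c x u : R) : R := (1 + expR (c * (u - x)))^-1.

Section logistic.
Variables (c x : R).
Hypothesis c0 : 0 < c.
Local Notation f := (logistic c x).

Lemma logistic_ge0 u : 0 <= f u.
Proof. by rewrite invr_ge0 addr_ge0// expR_ge0. Qed.

Lemma logistic_le1 u : f u <= 1.
Proof.
have p : 0 < 1 + expR (c * (u - x)) by rewrite ltr_pwDl// expR_ge0.
by rewrite /logistic invf_le1// lerDl expR_ge0.
Qed.

Lemma logistic_right (eta u : R) : x + eta <= u -> f u <= expR (- (c * eta)).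
Proof.
move=> xu; have p : 0 < 1 + expR (c * (u - x)) by rewrite ltr_pwDl// expR_ge0.
rewrite expRN lef_pV2 ?posrE ?expR_gt0//.
rewrite (@le_trans _ _ (expR (c * (u - x))))// ?lerDr// ler_expR ler_pM2l// lerBrDl//.
Qed.

Lemma logistic_left (eta u : R) : u <= x - eta -> 1 - expR (- (c * eta)) <= f u.
Proof.
move=> ux; set E := expR _.
have e0 : 0 < expR (c * (u - x)) by exact: expR_gt0.
have eE : expR (c * (u - x)) <= E.
  rewrite ler_expR -mulrN ler_pM2l//; lra.
rewrite /logistic -[_^-1]mul1r ler_pdivlMr ?addr_gt0//.
have : 0 <= E * expR (c * (u - x)) by rewrite mulr_ge0// expR_ge0.
by nra.
Qed.

(** Since f' = -c f (1 - f), each derivative is a power of c times a polynomial in f, and these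
    polynomials are bounded by 1 in absolute value for f in [0, 1]. *)
Lemma lindeberg_test_logistic : exists L, lindeberg_test f L.
Proof.
have p0 u : 0 < 1 + expR (c * (u - x)) by rewrite ltr_pwDl// expR_ge0.
have d1 (u : R) : is_derive u 1 f (- c * (f u * (1 - f u))).
  eapply is_derive_eq; first by rewrite /logistic; der; rewrite gt_eqF.
  rewrite /logistic; have := p0 u; set e := expR _ => e0; field.
  by rewrite gt_eqF.
have d2 (u : R) : is_derive u 1 (fun u => - c * (f u * (1 - f u)))
    (c ^+ 2 * (f u * (1 - f u) * (1 - 2 * f u))).
  eapply is_derive_eq.
    eapply derM; first by der.
    eapply derM; first exact: d1.
    by eapply derD; [der|eapply derN; exact: d1].
  by rewrite /=; ring.
have d3 (u : R) : is_derive u 1 (fun u => c ^+ 2 * (f u * (1 - f u) * (1 - 2 * f u)))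
    (- c ^+ 3 * (f u * (1 - f u) * (1 - 6 * f u + 6 * f u ^+ 2))).
  eapply is_derive_eq.
    eapply derM; first by der.
    eapply derM.
      eapply derM; first exact: d1.
      by eapply derD; [der|eapply derN; exact: d1].
    by eapply derD; [der|eapply derN; eapply derM; [der|exact: d1]].
  by rewrite /=; ring.
have f01 u : 0 <= f u <= 1 by rewrite logistic_ge0 logistic_le1.
have bd (k v : R) : 0 <= k -> `|v| <= 1 -> `|k * v| <= k.
  by move=> k0 v1; rewrite normrM (ger0_norm k0) ler_piMr.
have q01 u : 0 <= f u * (1 - f u) <= 1.
  have /andP[a b] := f01 u; apply/andP; split; nra.
exists (2 * (c + c ^+ 2 + c ^+ 3)).
have c20 : 0 <= c ^+ 2 by rewrite exprn_ge0// ltW.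
have c30 : 0 <= c ^+ 3 by rewrite exprn_ge0// ltW.
apply: (lindeberg_test_C3 f01 d1 d2 d3) => u; have /andP[a b] := f01 u; have /andP[qa qb] := q01 u.
- rewrite mulNr normrN; apply: (@le_trans _ _ c); last by rewrite -addrA lerDl addr_ge0.
  by apply: bd; [exact: ltW|rewrite ger0_norm].
- apply: (@le_trans _ _ (c ^+ 2)); last by rewrite addrAC lerDr addr_ge0// ltW.
  apply: bd => //; rewrite normrM ger0_norm//.
  have : `|1 - 2 * f u| <= 1 by rewrite ler_norml; apply/andP; split; lra.
  by move=> h; rewrite mulr_ile1.
- rewrite mulNr normrN; apply: (@le_trans _ _ (c ^+ 3)); last by rewrite lerDr addr_ge0// ltW.
  apply: bd => //; rewrite normrM ger0_norm//.
  have : `|1 - 6 * f u + 6 * f u ^+ 2| <= 1 by have := sqr_ge0 (f u - 2^-1); rewrite ler_norml !expr2 => sq; apply/andP; split; nra.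
  by move=> h; rewrite mulr_ile1.
Qed.

End logistic.
End logistic_test_functions.

Section bounded_expectation.
Context {R : realType} {d : measure_display} {T : measurableType d}.
Variable P : probability T R.

Lemma bounded_integrable (g : T -> R) (M : R) : measurable_fun setT g ->
  (forall w, `|g w| <= M) -> P.-integrable setT (EFin \o g).
Proof.
move=> mg gM; apply: measurable_bounded_integrable => //.
  by apply: (le_lt_trans (probability_le1 P measurableT)); rewrite ltry.
exists M; split; first exact: num_real.
by move=> x Mx w _; exact: le_trans (gM w) (ltW Mx).
Qed.

Lemma unit_integrable (g : T -> R) : measurable_fun setT g ->
  (forall w, 0 <= g w <= 1) -> P.-integrable setT (EFin \o g).
Proof.
move=> mg g01; apply: (@bounded_integrable _ 1) => // w.
by have /andP[a b] := g01 w; rewrite ger0_norm.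
Qed.

Lemma Rintegral_prob_cst (c : R) : (\int[P]_(w in setT) c)%R = c.
Proof. by rewrite Rintegral_cst// [X in fine X](probability_setT P) mulr1. Qed.

Lemma Rintegral_prob_indic (A : set T) : measurable A ->
  (\int[P]_(w in setT) (\1_A w : R))%R = fine (P A).
Proof. by move=> mA; rewrite /Rintegral integral_indic// setIT. Qed.

Lemma EFin_Rintegral_unit (g : T -> R) : measurable_fun setT g ->
  (forall w, 0 <= g w <= 1) ->
  ((\int[P]_(w in setT) g w)%R%:E = \int[P]_w (g w)%:E)%E.
Proof.
move=> mg g01; rewrite /Rintegral fineK//.
by apply: integrable_fin_num => //; exact: unit_integrable.
Qed.

Lemma Rintegral_unit (g : T -> R) : measurable_fun setT g ->
  (forall w, 0 <= g w <= 1) -> 0 <= (\int[P]_(w in setT) g w)%R <= 1.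
Proof.
move=> mg g01; apply/andP; split.
  by apply: Rintegral_ge0 => w _; have /andP[] := g01 w.
rewrite -[leRHS]Rintegral_prob_cst; apply: le_Rintegral => //.
- exact: unit_integrable.
- by apply: unit_integrable => // w; rewrite ler01 lexx.
- by move=> w _; have /andP[] := g01 w.
Qed.

Lemma Rintegral_near (g h : T -> R) (M e : R) :
  measurable_fun setT g -> measurable_fun setT h ->
  (forall w, `|g w| <= M) -> (forall w, `|h w| <= M) ->
  (forall w, `|g w - h w| <= e) ->
  `|(\int[P]_(w in setT) g w)%R - (\int[P]_(w in setT) h w)%R| <= e.
Proof.
move=> mg mh gM hM ghe.
have ig := bounded_integrable mg gM; have ih := bounded_integrable mh hM.
have igh : P.-integrable setT (EFin \o (fun w => g w - h w)).
  by apply: (@bounded_integrable _ e) => //; exact: measurable_funB.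
rewrite -RintegralB//; apply: le_trans (le_normr_Rintegral _ igh) _ => //.
rewrite -[leRHS]Rintegral_prob_cst; apply: le_Rintegral => //.
- apply: (@bounded_integrable _ e) => [|w]; last by rewrite normr_id.
  by apply: measurableT_comp => //; exact: measurable_funB.
- by apply: (@bounded_integrable _ `|e|).
Qed.

Lemma measurable_logistic (c x : R) : 0 < c -> measurable_fun setT (logistic c x).
Proof. by move=> c0; have [L []] := lindeberg_test_logistic x c0. Qed.

Lemma logistic01 (c x u : R) : 0 <= logistic c x u <= 1.
Proof. by rewrite logistic_ge0 logistic_le1. Qed.

Lemma cdf_le_logistic (c x eta : R) (Y : T -> R) : 0 < c -> measurable_fun setT Y ->
  cdfR P Y (x - eta) <= (\int[P]_(w in setT) logistic c x (Y w))%R + expR (- (c * eta)).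
Proof.
move=> c0 mY; rewrite /cdfR.
have mA : measurable (Y @^-1` `]-oo, (x - eta)]) by apply: (measurable_preimageT mY).
have mf : measurable_fun setT (logistic c x \o Y).
  by apply: measurableT_comp => //; exact: measurable_logistic.
have i1 := @unit_integrable (logistic c x \o Y) mf (fun w => logistic01 c x (Y w)).
have i2 : P.-integrable setT (EFin \o (fun _ : T => expR (- (c * eta)))).
  by apply: (@bounded_integrable _ `|expR (- (c * eta))|).
rewrite -(Rintegral_prob_indic mA) -[X in _ <= _ + X]Rintegral_prob_cst -RintegralD//.
apply: le_Rintegral => //.
- by apply: unit_integrable => [|w]; [exact: measurable_indic|rewrite indicE; case: (_ \in _); rewrite ler01 lexx].
- exact: (integrableD measurableT i1 i2).
move=> w _; rewrite indicE; case: (boolP (w \in _)) => [|_].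
  by rewrite inE/= in_itv/= => /(logistic_left c0); rewrite lerBlDr.
by rewrite addr_ge0 ?expR_ge0// logistic_ge0.
Qed.

Lemma logistic_le_cdf (c x eta : R) (Y : T -> R) : 0 < c -> measurable_fun setT Y ->
  (\int[P]_(w in setT) logistic c x (Y w))%R <= cdfR P Y (x + eta) + expR (- (c * eta)).
Proof.
move=> c0 mY; rewrite /cdfR.
have mA : measurable (Y @^-1` `]-oo, (x + eta)]) by apply: (measurable_preimageT mY).
have mf : measurable_fun setT (logistic c x \o Y).
  by apply: measurableT_comp => //; exact: measurable_logistic.
have i1 := @unit_integrable (logistic c x \o Y) mf (fun w => logistic01 c x (Y w)).
have i2 : P.-integrable setT (EFin \o (fun _ : T => expR (- (c * eta)))).
  by apply: (@bounded_integrable _ `|expR (- (c * eta))|).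
have i3 : P.-integrable setT (EFin \o (\1_(Y @^-1` `]-oo, (x + eta)]) : T -> R)).
  by apply: unit_integrable => [|w]; [exact: measurable_indic|rewrite indicE; case: (_ \in _); rewrite ler01 lexx].
rewrite -(Rintegral_prob_indic mA) -[X in _ <= _ + X]Rintegral_prob_cst -RintegralD//.
apply: le_Rintegral => //; first exact: (integrableD measurableT i3 i2).
move=> w _; rewrite indicE; case: (boolP (w \in _)) => [_|].
  by rewrite (le_trans (logistic_le1 _ _ _))// lerDl expR_ge0.
rewrite notin_setE/= in_itv/= => /negP; rewrite -ltNge => /ltW /(logistic_right c0).
by rewrite add0r.
Qed.

End bounded_expectation.

(** The distribution function at x is squeezed between logistic averages centred at x - eta and x +
    eta. Four errors arise on each side: two logistic tails, the assumed convergence, and the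
    continuity of the limit at distance 2 eta. *)
Lemma cvg_in_law_logistic {R : realType} {d d' : measure_display}
  {T : measurableType d} {T' : measurableType d'}
  (P : probability T R) (Y : nat -> T -> R) (P' : probability T' R) (Z : T' -> R) :
  (forall n, measurable_fun setT (Y n)) -> measurable_fun setT Z ->
  (forall c x : R, 0 < c ->
    (\int[P]_(w in setT) logistic c x (Y n w))%R @[n --> \oo] -->
    (\int[P']_(w in setT) logistic c x (Z w))%R) ->
  cvg_in_law P Y P' Z.
Proof.
move=> mY mZ H x cx; apply/cvgrPdist_lt => eps eps0.
have [de de0 eps4] : exists2 de, 0 < de & eps = 4 * de.
  by exists (eps / 4); [rewrite divr_gt0|field].
rewrite eps4 {eps4 eps0 eps}.
have : \forall t \near x, `|cdfR P' Z x - cdfR P' Z t| < de.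
  by move/cvgrPdist_lt : cx => /(_ _ de0).
rewrite nearE => /nbhs_ballP[r/= r0 near_x].
have [eta eta0 etar] : exists2 eta, 0 < eta & r = 4 * eta.
  by exists (r / 4); [rewrite divr_gt0|field].
(* Then c eta = 1 / de, and e^(-z) <= 1 / z makes the logistic tail at most [de]. *)
have [c c0 cE] : exists2 c, 0 < c & c = (eta * de)^-1.
  by exists (eta * de)^-1; rewrite // invr_gt0 mulr_gt0.
have ede : expR (- (c * eta)) <= de.
  rewrite expRN -[leRHS]invrK lef_pV2 ?posrE ?expR_gt0 ?invr_gt0//.
  apply: le_trans (expR_ge1Dx _).
  have -> : c * eta = de^-1 by rewrite cE -(mulrC de) invrM ?unitfE ?gt_eqF// mulrAC mulVf ?mul1r// gt_eqF.
  by rewrite lerDr.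
have E2 := expR_ge0 (- (c * eta)).
have nx1 : `|cdfR P' Z x - cdfR P' Z (x + eta + eta)| < de.
  apply: near_x; rewrite /ball/= -addrA opprD addNKr normrN ger0_norm ?addr_ge0 ?(ltW eta0)//.
  by rewrite etar; lra.
have nx2 : `|cdfR P' Z x - cdfR P' Z (x - eta - eta)| < de.
  apply: near_x; rewrite /ball/= -addrA opprD opprD !opprK addrA subrr add0r.
  by rewrite ger0_norm ?addr_ge0 ?(ltW eta0)// etar; lra.
have /cvgrPdist_lt/(_ _ de0) H1 := H c (x + eta) c0.
have /cvgrPdist_lt/(_ _ de0) H2 := H c (x - eta) c0.
apply: filterS2 H1 H2 => n h1 h2.
have a1 := @cdf_le_logistic _ _ _ P c (x + eta) eta _ c0 (mY n).
have a2 := @logistic_le_cdf _ _ _ P' c (x + eta) eta _ c0 mZ.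
have b1 := @logistic_le_cdf _ _ _ P c (x - eta) eta _ c0 (mY n).
have b2 := @cdf_le_logistic _ _ _ P' c (x - eta) eta _ c0 mZ.
rewrite addrK in a1; rewrite subrK in b1.
move: h1 h2 nx1 nx2; rewrite !ltr_norml => /andP[h11 h12] /andP[h21 h22] /andP[n11 n12] /andP[n21 n22].
move: a1 a2 b1 b2 h11 h12 h21 h22 n11 n12 n21 n22 ede E2.
move: (expR _) (\int[_]_(w in _) _)%R (\int[_]_(w in _) _)%R (\int[_]_(w in _) _)%R (\int[_]_(w in _) _)%R.
move: (cdfR _ _ _) (cdfR _ _ _) (cdfR _ _ _) (cdfR _ _ _) => *.
by apply/andP; split; lra.
Qed.

(** * Lindeberg replacement *)

(** With z = (s t - a x) / b, the sum z^2 + x^2 equals (s^2 (x^2 + t^2) - 2 a s x t) / b^2, which is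
    symmetric in x and t. *)
Lemma normal_pdf_exchange {R : realType} (a b s x t : R) : b != 0 -> s ^+ 2 = a ^+ 2 + b ^+ 2 ->
  normal_pdf 0 1 (s / b * t + - (a * x / b)) * normal_pdf 0 1 x =
  normal_pdf 0 1 (s / b * x + - (a * t / b)) * normal_pdf 0 1 t.
Proof.
move=> b0 s2; rewrite !std_normal_pdfE.
move: (normal_peak 1) => k.
have E (y z : R) : k * expR (- ((s / b * z + - (a * y / b)) ^+ 2 / 2)) * (k * expR (- (y ^+ 2 / 2))) =
    k * k * expR (- ((s ^+ 2 * (y ^+ 2 + z ^+ 2) - 2 * a * s * y * z) / (2 * b ^+ 2))).
  rewrite mulrACA -expRD; congr (_ * expR _).
  have -> : s ^+ 2 * (y ^+ 2 + z ^+ 2) = (a ^+ 2 + b ^+ 2) * y ^+ 2 + s ^+ 2 * z ^+ 2.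
    by rewrite -s2 mulrDr.
  by field.
rewrite (E x t) (E t x) [t ^+ 2 + _]addrC.
by have -> : 2 * a * s * t * x = 2 * a * s * x * t by ring.
Qed.

Section normal_variable.
Context {R : realType} {d : measure_display} {T : measurableType d}.
Variables (P : probability T R) (X : {RV P >-> R}).
Hypothesis hX : has_pdf P X (normal_pdf 0 1).
Local Notation mu := (@lebesgue_measure R).
Local Notation phi := (@normal_pdf R 0 1).

Let mX : measurable_fun setT X. Proof. exact: measurable_funPT. Qed.
Let mphi : measurable_fun setT (phi : R -> R). Proof. exact: measurable_normal_pdf. Qed.
Let phi0 (x : R) : 0 <= phi x. Proof. exact: normal_pdf_ge0. Qed.

Let mXN : measurable_fun setT (fun w => - X w). Proof. exact: measurableT_comp. Qed.
Let XN : {RV P >-> R} := HB.pack (fun w => - X w) (isMeasurableFun.Build _ _ _ _ _ mXN).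

Let hXN : has_pdf P XN phi.
Proof.
apply: has_pdf_opp hX => //.
by move=> x; rewrite !std_normal_pdfE sqrrN.
Qed.

Lemma normal_convolution (F : R -> \bar R) (a b : R) : 0 < b ->
  measurable_fun setT F -> (forall x, 0 <= F x)%E ->
  (\int[P]_w \int[P]_w' F (a * X w + b * X w')%R =
   \int[P]_w F (Num.sqrt (a ^+ 2 + b ^+ 2) * X w)%R)%E.
Proof.
move=> b0 mF F0; set s := Num.sqrt _.
have s2 : s ^+ 2 = a ^+ 2 + b ^+ 2 by rewrite sqr_sqrtr// addr_ge0 ?sqr_ge0.
have s0 : 0 < s by rewrite sqrtr_gt0 ltr_wpDl ?sqr_ge0// exprn_gt0.
(* F times the joint density of X and (a X + b X') / s, with X' an independent copy. By the exchange
   identity the other marginal can be integrated out as an affinely rescaled normal density. *)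
pose K (z : measurableTypeR R * measurableTypeR R) : \bar R :=
  (F (s * z.2)%R * ((s / b) * phi (s / b * z.2 + - (a * z.1 / b)) * phi z.1)%:E)%E.
have mlin (g : measurableTypeR R * measurableTypeR R -> R) (h : R -> R) :
   measurable_fun setT g -> measurable_fun setT h -> measurable_fun setT (h \o g).
  by move=> mg mh; exact: measurableT_comp.
have m1 : measurable_fun setT (fst : measurableTypeR R * measurableTypeR R -> R).
  exact: measurable_fst.
have m2 : measurable_fun setT (snd : measurableTypeR R * measurableTypeR R -> R).
  exact: measurable_snd.
have mK : measurable_fun setT K.
  apply: emeasurable_funM.
    by apply: (measurableT_comp mF); apply: measurable_funM.
  apply/measurable_EFinP; apply: measurable_funM; last exact: mlin.
  apply: measurable_funM => //; apply: (mlin _ phi) => //.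
  apply: measurable_funD; first exact: measurable_funM.
  apply: measurableT_comp => //; apply: measurable_funM => //; exact: measurable_funM.
have K0 z : (0 <= K z)%E.
  by rewrite mule_ge0// lee_fin mulr_ge0// mulr_ge0// divr_ge0// ltW.
have inner (x : R) : (\int[P]_w' F (a * x + b * X w')%R * (phi x)%:E = \int[mu]_t K (x, t))%E.
  have mFx : measurable_fun setT (fun z : R => F (a * x + b * z)%R).
    by apply: (measurableT_comp mF); apply: measurable_funD => //; exact: measurable_funM.
  rewrite (@has_pdf_integral _ _ _ P X phi (fun z => F (a * x + b * z)%R))//.
  rewrite (@ge0_integral_affine _ (s / b) (- (a * x / b))); last 3 first.
  - by rewrite divr_gt0.
  - by apply: emeasurable_funM => //; exact/measurable_EFinP.
  - by move=> z; rewrite mule_ge0 ?lee_fin.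
  have mi : measurable_fun setT (fun t : R => F (s * t)%R * (phi (s / b * t + - (a * x / b)))%:E)%E.
    apply: emeasurable_funM.
      have ms : measurable_fun setT (fun t : R => s * t) by exact: measurable_funM.
      exact: (measurableT_comp mF ms).
    apply/measurable_EFinP; apply: (measurableT_comp mphi).
    by apply: measurable_funD; [apply: measurable_funM; [exact: measurable_cst|exact: measurable_id]|exact: measurable_cst].
  transitivity ((s / b * phi x)%:E * \int[mu]_t (F (s * t)%R * (phi (s / b * t + - (a * x / b)))%:E))%E.
    rewrite muleAC -EFinM; congr (_ * _)%E; apply: eq_integral => t _; congr (F _ * _)%E.
    by field; rewrite gt_eqF.
  rewrite -ge0_integralZl//; last 2 first.
  - by move=> z _; rewrite mule_ge0 ?lee_fin.
  - by rewrite lee_fin mulr_ge0// divr_ge0 ?ltW.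
  apply: eq_integral => t _; rewrite /K /= muleCA -EFinM; congr (_ * _%:E)%E.
  by ring.
have outer (t : R) : (\int[mu]_x K (x, t) = F (s * t)%R * (phi t)%:E)%E.
  have ml : measurable_fun setT (fun x : R => phi (s / b * x + - (a * t / b))).
    apply: (measurableT_comp mphi).
    by apply: measurable_funD; [apply: measurable_funM; [exact: measurable_cst|exact: measurable_id]|exact: measurable_cst].
  transitivity (\int[mu]_x ((F (s * t)%R * (phi t)%:E) * ((s / b)%:E * (phi (s / b * x + - (a * t / b)))%:E)))%E.
    apply: eq_integral => x _; rewrite /K /= -!muleA -!EFinM; congr (_ * _%:E)%E.
    rewrite -mulrA (normal_pdf_exchange x t (lt0r_neq0 b0) s2).
    by rewrite [RHS]mulrCA [phi t * _]mulrC.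
  have sb0 : 0 < s / b by rewrite divr_gt0.
  rewrite ge0_integralZl//; last 3 first.
  - by apply: emeasurable_funM => //; exact/measurable_EFinP.
  - by move=> z _; rewrite mule_ge0 ?lee_fin// ltW.
  - by rewrite mule_ge0 ?lee_fin.
  rewrite ge0_integralZl//; last 3 first.
  - exact/measurable_EFinP.
  - by move=> z _; rewrite lee_fin.
  - by rewrite lee_fin ltW.
  rewrite -(@ge0_integral_affine _ (s / b) (- (a * t / b)) (fun z : R => (phi z)%:E))//; last first.
    exact/measurable_EFinP.
  by rewrite integral_normal_pdf ?oner_eq0// mule1.
rewrite (@has_pdf_integral _ _ _ P X phi (fun x => (\int[P]_w' F (a * x + b * X w')%R)%E))//; last 2 first.
- have mFz : measurable_fun setT (fun z : R * T => F (a * z.1 + b * X z.2)%R).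
    apply: (measurableT_comp mF); apply: measurable_funD; apply: measurable_funM => //.
    exact: (measurableT_comp mX measurable_snd).
  by apply: (@measurable_fun_fubini_tonelli_F _ _ _ _ _ P (fun z : R * T => F (a * z.1 + b * X z.2)%R)).
- by move=> x; apply: integral_ge0.
under eq_integral do rewrite inner.
rewrite (@fubini_tonelli _ _ _ _ _ mu mu K mK K0).
under eq_integral do rewrite outer.
rewrite (@has_pdf_integral _ _ _ P X phi (fun x => F (s * x)%R))//.
by apply: (measurableT_comp mF); apply: measurable_funM; [exact: measurable_cst|exact: measurable_id].
Qed.

(** The square is split into its parts on X > 0 and -X > 0. Each contributes the probability of a
    half line, and these probabilities add up to 1. *)
Lemma normal_variable_sqr : (\int[P]_w (X w ^+ 2)%:E = 1)%E.
Proof.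
pose g (x : R) : \bar R := (if 0 < x then x ^+ 2 else 0)%:E.
have mg : measurable_fun setT g.
  apply/measurable_EFinP; apply: measurable_fun_if => //; exact: measurable_fun_ltr.
have g0 x : (0 <= g x)%E by rewrite lee_fin; case: ifP => // _; exact: sqr_ge0.
have half (Z : {RV P >-> R}) : has_pdf P Z phi -> (\int[P]_w g (Z w) = P (Z @^-1` `]0%R, +oo[))%E.
  move=> hZ; rewrite (has_pdf_integral mphi phi0 hZ mg g0) hZ// -integral_sqr_normal_pdf.
  rewrite [RHS]integral_mkcond; apply: eq_integral => x _.
  rewrite patchE mem_setE in_itv/= andbT /g; case: ifP => _; first by rewrite EFinM.
  by rewrite mul0e.
transitivity (\int[P]_w (g (X w) + g (XN w)))%E.
  apply: eq_integral => w _; rewrite /g /= -EFinD; congr (_%:E); rewrite oppr_gt0 sqrrN.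
  by case: ltgtP => [_|_|<-]; rewrite ?add0r ?addr0// expr0n.
rewrite ge0_integralD//; last 2 first.
- exact: (measurableT_comp mg).
- exact: (measurableT_comp mg mXN).
rewrite (half X hX) (half XN hXN).
have -> : P (XN @^-1` `]0%R, +oo[) = P (X @^-1` `]-oo, 0%R]).
  transitivity (P (X @^-1` `]-oo, 0%R[)).
    by congr (P _); apply/seteqP; split => w /=; rewrite !in_itv/= andbT oppr_gt0.
  rewrite (hX (measurable_itv `]-oo, 0%R[)) (hX (measurable_itv `]-oo, 0%R])).
  by apply: integral_itv_bndo_bndc; apply/measurable_EFinP/measurable_funTS.
rewrite -measureU//=.
- rewrite -(probability_setT P); congr (P _); apply/seteqP; split => // w _ /=.
  by rewrite !in_itv/= andbT; have [|] := ltP 0 (X w); [left|right].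
- by apply: (measurable_preimageT mX).
- by apply: (measurable_preimageT mX).
apply/seteqP; split => // w [] /=; rewrite !in_itv/= andbT => x0.
by rewrite leNgt x0.
Qed.

Lemma integrable_sqr (Y : T -> R) : measurable_fun setT Y ->
  (\int[P]_w (Y w ^+ 2)%:E = 1)%E -> P.-integrable setT (EFin \o (fun w => Y w ^+ 2)).
Proof.
move=> mY Y2; apply/integrableP; split; first by apply/measurable_EFinP; exact: measurable_funX.
rewrite (@eq_integral _ _ _ P _ (fun w => (Y w ^+ 2)%:E)) ?Y2 ?ltry//.
by move=> w _; rewrite gee0_abs// lee_fin sqr_ge0.
Qed.

Lemma integrable_of_sqr (Y : T -> R) : measurable_fun setT Y ->
  (\int[P]_w (Y w ^+ 2)%:E = 1)%E -> P.-integrable setT (EFin \o Y).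
Proof.
move=> mY Y2.
have i0 : P.-integrable setT (EFin \o (fun _ : T => 1 : R)).
  by apply: (@bounded_integrable _ _ _ _ _ 1) => // w; rewrite normr1.
have i1 := integrableD measurableT i0 (integrable_sqr mY Y2).
apply: le_integrable i1 => //; first exact/measurable_EFinP.
move=> w _ /=; rewrite lee_fin [leRHS]ger0_norm ?addr_ge0 ?sqr_ge0//.
have := sqr_ge0 (`|Y w| - 2^-1); rewrite sqrrB real_normK ?num_real// => h.
by have : 0 <= `|Y w| by []; lra.
Qed.

Lemma normal_variable_mean : (\int[P]_w (X w)%:E = 0)%E.
Proof.
have iX := integrable_of_sqr mX normal_variable_sqr.
have sl : same_law P X P XN by move=> B mB; rewrite hX// hXN.
have mm : measurable_fun setT (fun x : R => (Order.max x 0)%:E).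
  by apply/measurable_EFinP; exact: measurable_maxr.
have m0 (x : R) : (0 <= (Order.max x 0)%:E)%E by rewrite lee_fin le_max lexx orbT.
rewrite integralE.
have -> : (\int[P]_w (fun w => (X w)%:E)^\- w = \int[P]_w (fun w => (X w)%:E)^\+ w)%E.
  transitivity (\int[P]_w (Order.max (XN w) 0)%:E)%E.
    by apply: eq_integral => w _; rewrite funenegE EFin_max.
  rewrite -(same_law_integral mX mXN sl mm m0); apply: eq_integral => w _.
  by rewrite funeposE EFin_max.
by rewrite subee//; exact: (integrable_pos_fin_num measurableT iX).
Qed.

End normal_variable.

Section mollify.
Context {R : realType}.
Variable f : R -> R.
Hypotheses (mf : measurable_fun setT f) (f01 : forall u, 0 <= f u <= 1).

(** The average of f over the law of U, as a function of the shift. Keeping the shift free makes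
    addition of an independent variable a composition of averages, and averages over different
    probability spaces commute by Tonelli. *)
Definition mollify d (T : measurableType d) (P : probability T R) (U : T -> R) (v : R) : R :=
  (\int[P]_(w in setT) f (v + U w))%R.

Section one_law.
Context d (T : measurableType d) (P : probability T R).
Variable U : T -> R.
Hypothesis mU : measurable_fun setT U.

Lemma measurable_shift v : measurable_fun setT (fun w => f (v + U w)).
Proof. by apply: (measurableT_comp mf); exact: measurable_funD. Qed.

Lemma EFin_mollify v : ((mollify P U v)%:E = \int[P]_w (f (v + U w))%:E)%E.
Proof. by apply: EFin_Rintegral_unit => //; exact: measurable_shift. Qed.

Lemma mollify01 v : 0 <= mollify P U v <= 1.
Proof. by apply: Rintegral_unit => //; exact: measurable_shift. Qed.

Lemma measurable_mollify : measurable_fun setT (mollify P U).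
Proof.
apply/measurable_EFinP.
rewrite (_ : EFin \o _ = fun v => (\int[P]_w (f (v + U w))%:E)%E); last first.
  by apply/funext => v; exact: EFin_mollify.
have m : measurable_fun setT (fun z : R * T => (f (z.1 + U z.2))%:E).
  apply/measurable_EFinP; apply: (measurableT_comp mf); apply: measurable_funD => //.
  exact: (measurableT_comp mU measurable_snd).
by apply: (@measurable_fun_fubini_tonelli_F _ _ _ _ _ P _ m) => z; rewrite lee_fin; have /andP[] := f01 (z.1 + U z.2).
Qed.

Lemma mollify_indep (V : T -> R) v : measurable_fun setT V -> indep2 P V U ->
  mollify P (fun w => V w + U w) v = (\int[P]_(w in setT) mollify P U (v + V w))%R.
Proof.
move=> mV iVU; apply: EFin_inj.
have m : measurable_fun setT (fun z : R * R => (f (v + (z.1 + z.2)))%:E).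
  by apply/measurable_EFinP; apply: (measurableT_comp mf); apply: measurable_funD => //; exact: measurable_funD.
rewrite [RHS]EFin_Rintegral_unit; last 2 first.
- by apply: (measurableT_comp measurable_mollify); exact: measurable_funD.
- by move=> w; exact: mollify01.
rewrite /mollify EFin_Rintegral_unit//; last first.
  by apply: (measurableT_comp mf); apply: measurable_funD => //; exact: measurable_funD.
rewrite (indep2_integral (f := fun z : R * R => (f (v + (z.1 + z.2)))%:E) mV mU iVU m); last first.
  by move=> z; rewrite lee_fin; have /andP[] := f01 (v + (z.1 + z.2)).
apply: eq_integral => w _; rewrite EFin_mollify; apply: eq_integral => w' _ /=.
by rewrite addrA.
Qed.

End one_law.

Lemma mollify_swap d (T : measurableType d) (P : probability T R) d' (T' : measurableType d')
    (P' : probability T' R) (U : T -> R) (V : T' -> R) v :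
  measurable_fun setT U -> measurable_fun setT V ->
  (\int[P]_(w in setT) mollify P' V (v + U w))%R = (\int[P']_(w in setT) mollify P U (v + V w))%R.
Proof.
move=> mU mV; apply: EFin_inj.
rewrite !EFin_Rintegral_unit; last 4 first.
- by apply: (measurableT_comp (measurable_mollify _ mU)); exact: measurable_funD.
- by move=> w; exact: mollify01.
- by apply: (measurableT_comp (measurable_mollify _ mV)); exact: measurable_funD.
- by move=> w; exact: mollify01.
pose K (z : T * T') : \bar R := (f (v + U z.1 + V z.2))%:E.
have mK : measurable_fun setT K.
  apply/measurable_EFinP; apply: (measurableT_comp mf); apply: measurable_funD.
    by apply: measurable_funD => //; exact: (measurableT_comp mU measurable_fst).
  exact: (measurableT_comp mV measurable_snd).
have K0 z : (0 <= K z)%E by rewrite lee_fin; have /andP[] := f01 (v + U z.1 + V z.2).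
transitivity (\int[P]_w \int[P']_w' K (w, w'))%E.
  by apply: eq_integral => w _; rewrite EFin_mollify.
rewrite (@fubini_tonelli _ _ _ _ _ P P' K mK K0).
apply: eq_integral => w' _; rewrite EFin_mollify//; apply: eq_integral => w _.
by rewrite /K /= addrAC.
Qed.

(** Only b must be positive: the replacement argument starts with a = 0, when no normal part has
    accumulated yet. *)
Lemma mollify_normal d (T : measurableType d) (P : probability T R) (Z : {RV P >-> R}) (a b v : R) :
  has_pdf P Z (normal_pdf 0 1) -> 0 < b ->
  (\int[P]_(w in setT) mollify P (fun w => b * Z w) (v + a * Z w))%R =
  mollify P (fun w => Num.sqrt (a ^+ 2 + b ^+ 2) * Z w) v.
Proof.
move=> hZ b0; apply: EFin_inj.
have mZ : measurable_fun setT Z by exact: measurable_funPT.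
have mcZ c : measurable_fun setT (fun w => c * Z w) by exact: measurable_funM.
rewrite EFin_Rintegral_unit; last 2 first.
- by apply: (measurableT_comp (measurable_mollify _ (mcZ b))); exact: measurable_funD.
- by move=> w; exact: mollify01.
rewrite EFin_mollify//.
have mF : measurable_fun setT (fun x : R => (f (v + x))%:E).
  by apply/measurable_EFinP; apply: (measurableT_comp mf); exact: measurable_funD.
rewrite -(@normal_convolution _ _ _ _ _ hZ (fun x => (f (v + x))%:E) a b b0 mF); last first.
  by move=> x; rewrite lee_fin; have /andP[] := f01 (v + x).
apply: eq_integral => w _; rewrite EFin_mollify//; apply: eq_integral => w' _.
by rewrite addrA.
Qed.

Lemma mollify_near (g h : R -> R) d (T : measurableType d) (P : probability T R) (U : T -> R) v e :
  measurable_fun setT U -> measurable_fun setT g -> measurable_fun setT h ->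
  (forall u, 0 <= g u <= 1) -> (forall u, 0 <= h u <= 1) ->
  (forall u, `|g u - h u| <= e) ->
  `|(\int[P]_(w in setT) g (v + U w))%R - (\int[P]_(w in setT) h (v + U w))%R| <= e.
Proof.
move=> mU mg mh g01 h01 gh; apply: (@Rintegral_near _ _ _ _ _ _ 1) => //.
- by apply: (measurableT_comp mg); exact: measurable_funD.
- by apply: (measurableT_comp mh); exact: measurable_funD.
- by move=> w; have /andP[a b] := g01 (v + U w); rewrite ger0_norm.
- by move=> w; have /andP[a b] := h01 (v + U w); rewrite ger0_norm.
Qed.

End mollify.

Section one_step.
Context {R : realType} {d : measure_display} {T : measurableType d}.
Variables (P : probability T R) (Y : T -> R).
Hypotheses (mY : measurable_fun setT Y) (Y1 : (\int[P]_w (Y w)%:E = 0)%E)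
  (Y2 : (\int[P]_w (Y w ^+ 2)%:E = 1)%E).

Definition lindeberg_tail (t : R) : R :=
  (\int[P]_(w in setT) Order.min (Y w ^+ 2) (t * `|Y w| ^+ 3))%R.

Let iY : P.-integrable setT (EFin \o Y). Proof. exact: integrable_of_sqr. Qed.

Let mY2 : measurable_fun setT (fun w => Y w ^+ 2). Proof. exact: measurable_funX. Qed.

Let iY2 : P.-integrable setT (fun w => (Y w ^+ 2)%:E). Proof. exact: integrable_sqr. Qed.

Let mtail t : measurable_fun setT (fun w => Order.min (Y w ^+ 2) (t * `|Y w| ^+ 3)).
Proof.
apply: measurable_minr => //; apply: measurable_funM => //; apply: measurable_funX.
exact: measurableT_comp.
Qed.

Let tail_ge0 t w : 0 <= t -> 0 <= Order.min (Y w ^+ 2) (t * `|Y w| ^+ 3).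
Proof. by move=> t0; rewrite le_min sqr_ge0 mulr_ge0// exprn_ge0. Qed.

Let itail t : 0 <= t -> P.-integrable setT (fun w => (Order.min (Y w ^+ 2) (t * `|Y w| ^+ 3))%:E).
Proof.
move=> t0; apply: le_integrable iY2 => //; first exact/measurable_EFinP.
move=> w _ /=; rewrite lee_fin (ger0_norm (tail_ge0 w t0)) (ger0_norm (sqr_ge0 _)).
by rewrite ge_min lexx.
Qed.

Lemma lindeberg_tail_ge0 t : 0 <= t -> 0 <= lindeberg_tail t.
Proof. by move=> t0; apply: Rintegral_ge0 => w _; exact: tail_ge0. Qed.

(** The cubic term makes the integrand vanish pointwise, and the square dominates it. This is the
    o(1) of the replacement, obtained without a third moment. *)
Lemma cvg_lindeberg_tail (a : nat -> R) : (forall n, 0 <= a n) -> a n @[n --> \oo] --> (0 : R) ->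
  lindeberg_tail (a n) @[n --> \oo] --> (0 : R).
Proof.
move=> a0 ca.
pose F n w := (Order.min (Y w ^+ 2) (a n * `|Y w| ^+ 3))%:E.
have mF n : measurable_fun setT (F n) by exact/measurable_EFinP.
have cF : {ae P, forall w, setT w -> F ^~ w @ \oo --> 0%E}.
  apply: aeW => w _; apply: cvg_EFin; first exact: nearW.
  apply: (@squeeze_cvgr _ _ _ _ (fun=> 0) (fun n => a n * `|Y w| ^+ 3)).
  - by apply: nearW => n /=; rewrite tail_ge0//= ge_min lexx orbT.
  - exact: cvg_cst.
  by rewrite -[X in _ --> X](mul0r (`|Y w| ^+ 3)); apply: cvgM => //; exact: cvg_cst.
have bF : {ae P, forall w n, setT w -> (`|F n w| <= (Y w ^+ 2)%:E)%E}.
  apply: aeW => w n _; rewrite /F gee0_abs ?lee_fin ?tail_ge0//.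
  by rewrite ge_min lexx.
have [_ _ H] := dominated_convergence measurableT mF (measurable_cst 0%E) cF iY2 bF.
rewrite integral0 in H; exact: fine_cvg H.
Qed.

(** The linear Taylor term averages to 0 and the quadratic one to b t^2, whatever the law of Y. The
    same term therefore appears for a summand and for a normal variable, and cancels in their
    comparison. *)
Lemma one_step (f : R -> R) (L u a b t : R) : lindeberg_test f L ->
  (forall h, `|f (u + h) - f u - a * h - b * h ^+ 2| <= L * h ^+ 2 /\
      `|f (u + h) - f u - a * h - b * h ^+ 2| <= L * `|h| ^+ 3) -> 0 <= t ->
  `|mollify f P (fun w => t * Y w) u - f u - b * t ^+ 2| <= L * t ^+ 2 * lindeberg_tail t.
Proof.
move=> [mf f01 Lip _] tay t0.
have mtY : measurable_fun setT (fun w => t * Y w) by exact: measurable_funM.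
have i0 : P.-integrable setT (fun w => (f (u + t * Y w))%:E).
  by apply: unit_integrable => //; exact: (measurable_shift mf mtY).
have i1 : P.-integrable setT (fun _ : T => (f u)%:E) by apply: (@bounded_integrable _ _ _ _ _ `|f u|).
have i2 : P.-integrable setT (fun w => (a * t * Y w)%:E) by exact: (integrableZl measurableT (a * t) iY).
have i3 : P.-integrable setT (fun w => (b * t ^+ 2 * Y w ^+ 2)%:E).
  exact: (integrableZl measurableT (b * t ^+ 2) iY2).
have i01 := integrableB measurableT i0 i1.
have i012 := integrableB measurableT i01 i2.
have i4 := integrableB measurableT i012 i3.
have -> : mollify f P (fun w => t * Y w) u - f u - b * t ^+ 2 =
    (\int[P]_(w in setT) (f (u + t * Y w) - f u - a * t * Y w - b * t ^+ 2 * Y w ^+ 2))%R.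
  rewrite RintegralB// RintegralB// RintegralB// Rintegral_prob_cst !RintegralZl//.
  by rewrite /Rintegral Y1 Y2 /= mulr0 mulr1 subr0.
apply: le_trans (le_normr_Rintegral _ i4) _ => //.
rewrite /lindeberg_tail -RintegralZl//; last exact: itail.
apply: le_Rintegral => //.
- exact: (integrable_norm i4).
- exact: (integrableZl measurableT (L * t ^+ 2) (itail t0)).
move=> w _; have [h1 h2] := tay (t * Y w).
have E : f (u + t * Y w) - f u - a * t * Y w - b * t ^+ 2 * Y w ^+ 2 =
    f (u + t * Y w) - f u - a * (t * Y w) - b * (t * Y w) ^+ 2 by rewrite exprMn; ring.
rewrite E /Order.min; case: ifP => _.
  by rewrite -mulrA -exprMn.
by rewrite -mulrA (mulrA (t ^+ 2)) -exprSr -[X in X ^+ 3](ger0_norm t0) -exprMn -normrM.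
Qed.

End one_step.

Section partial_sums.
Context {R : realType} {d : measure_display} {T : measurableType d}.
Variable P : probability T R.
Context (I : choiceType) (Y : I -> T -> R) (e : nat -> I).
Hypotheses (mY : forall i, measurable_fun setT (Y i)) (indepY : mutually_independent P Y).
Hypothesis inj_e : injective e.

Lemma measurable_partial_sum k : measurable_fun setT (fun w => \sum_(j < k) Y (e j) w).
Proof. exact: measurable_sum. Qed.

(** The injection [e] places the summands in a possibly larger family, so that the random index can
    be one of the outside coordinates. The list is reversed because coordinates are adjoined at its
    head. *)
Lemma indep_outside_sum k :
  indep_outside P Y [seq e j | j <- rev (iota 0 k)] (fun w => \sum_(j < k) Y (e j) w).
Proof.
elim: k => [|k IH].
  have -> : (fun w => \sum_(j < 0) Y (e j) w) = (fun=> 0).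
    by apply/funext => w; rewrite big_ord0.
  exact: indep_outside_cst.
have ek : e k \notin [seq e j | j <- rev (iota 0 k)].
  by rewrite mem_map// mem_rev mem_iota add0n ltnn andbF.
have := indep_outside_pair mY indepY (measurable_partial_sum k) IH ek.
move/(indep_outside_comp (g := fun z : R * R => z.1 + z.2)).
have -> : [seq e j | j <- rev (iota 0 k.+1)] = e k :: [seq e j | j <- rev (iota 0 k)].
  by rewrite -addn1 iotaD add0n rev_cat.
have -> : (fun w => \sum_(j < k.+1) Y (e j) w) =
    (fun z : R * R => z.1 + z.2) \o (fun w => (\sum_(j < k) Y (e j) w, Y (e k) w)).
  by apply/funext => w; rewrite big_ord_recr.
by apply; exact: measurable_funD.
Qed.

Lemma indep2_sum k i : (forall j, (j < k)%N -> i != e j) ->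
  indep2 P (fun w => \sum_(j < k) Y (e j) w) (Y i).
Proof.
move=> ine; apply: (indep_outside_indep2 (@indep_outside_sum k)).
apply/mapP => -[j]; rewrite mem_rev mem_iota add0n => /andP[_ jk] ij.
by have := ine _ jk; rewrite ij eqxx.
Qed.

End partial_sums.

Section lindeberg.
Context {R : realType} {d : measure_display} {T : measurableType d}.
Variables (P : probability T R) (Y : nat -> T -> R).
Hypotheses (mY : forall k, measurable_fun setT (Y k)) (indepY : mutually_independent P Y).
Hypothesis lawY : forall k, same_law P (Y k) P (Y 0%N).
Hypotheses (Y1 : (\int[P]_w (Y 0%N w)%:E = 0)%E) (Y2 : (\int[P]_w (Y 0%N w ^+ 2)%:E = 1)%E).
Context {d' : measure_display} {T' : measurableType d'}.
Variables (P' : probability T' R) (Z : {RV P' >-> R}).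
Hypothesis hZ : has_pdf P' Z (normal_pdf 0 1).
Variables (f : R -> R) (L t : R).
Hypotheses (tf : lindeberg_test f L) (t0 : 0 < t).

Let mf : measurable_fun setT f. Proof. by case: tf. Qed.
Let f01 u : 0 <= f u <= 1. Proof. by case: tf. Qed.
Let mZ : measurable_fun setT Z. Proof. exact: measurable_funPT. Qed.

(* Telescoping is done with the shift [u] universally quantified: conditionally on the last
   summand, the induction hypothesis applies at a shifted point. *)
Lemma lindeberg_sum k u :
  `|mollify f P (fun w => t * \sum_(j < k) Y j w) u -
    mollify f P' (fun w => Num.sqrt k%:R * t * Z w) u| <=
  k%:R * (L * t ^+ 2 * (lindeberg_tail P (Y 0%N) t + lindeberg_tail P' Z t)).
Proof.
set eps := L * _ * _.
have mcZ c : measurable_fun setT (fun w => c * Z w) by exact: measurable_funM.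
have mtY j : measurable_fun setT (fun w => t * Y j w) by exact: measurable_funM.
have mS j : measurable_fun setT (fun w => t * \sum_(i < j) Y i w).
  by apply: measurable_funM => //; exact: measurable_sum.
have M01 e (S : measurableType e) (Q : probability S R) (U : S -> R) : measurable_fun setT U ->
    forall v, 0 <= mollify f Q U v <= 1.
  by move=> mU v; exact: mollify01.
have mM e (S : measurableType e) (Q : probability S R) (U : S -> R) : measurable_fun setT U ->
    measurable_fun setT (mollify f Q U).
  exact: measurable_mollify.
elim: k u => [|k IH] u.
  rewrite mul0r /mollify.
  rewrite (_ : (fun w => f (u + t * \sum_(j < 0) Y j w)) = (fun=> f u)); last first.
    by apply/funext => w; rewrite big_ord0 mulr0 addr0.
  rewrite (_ : (fun w => f (u + Num.sqrt 0%:R * t * Z w)) = (fun=> f u)); last first.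
    by apply/funext => w; rewrite sqrtr0 !mul0r addr0.
  by rewrite !Rintegral_prob_cst subrr normr0.
have -> : (fun w => t * \sum_(j < k.+1) Y j w) = (fun w => t * Y k w + t * \sum_(j < k) Y j w).
  by apply/funext => w; rewrite big_ord_recr/= mulrDr addrC.
have i2 : indep2 P (fun w => t * Y k w) (fun w => t * \sum_(j < k) Y j w).
  have := @indep2_sum _ _ _ P nat Y id mY indepY (fun _ _ => id) k k.
  have nk j : (j < k)%N -> k != j by move=> jk; rewrite gtn_eqF.
  move=> /(_ nk) i2 A B mA mB; rewrite setIC.
  have mt C : measurable C -> measurable (( *%R t : R -> R) @^-1` C).
    move=> mC; rewrite -[X in measurable X]setTI.
    by apply: (measurable_funM (measurable_cst t) (@measurable_id _ _ setT)).
  by have := i2 _ _ (mt _ mB) (mt _ mA); rewrite muleC.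
rewrite (mollify_indep mf f01 (mS k) _ (mtY k) i2).
have s1 := @mollify_near _ (mollify f P (fun w => t * \sum_(j < k) Y j w))
  (mollify f P' (fun w => Num.sqrt k%:R * t * Z w)) _ _ P _ u _ (mtY k) (mM _ _ _ _ (mS k))
  (mM _ _ _ _ (mcZ _)) (M01 _ _ _ _ (mS k)) (M01 _ _ _ _ (mcZ _)) IH.
(* After the exchange the normal part is the outer shift and the last summand the inner variable,
   ready to be replaced by a normal one at every shift. *)
rewrite (mollify_swap mf f01 P P' u (mtY k) (mcZ _)) in s1.
have s2 : `|(\int[P']_(w in setT) mollify f P (fun w => t * Y k w) (u + Num.sqrt k%:R * t * Z w))%R -
    (\int[P']_(w in setT) mollify f P' (fun w => t * Z w) (u + Num.sqrt k%:R * t * Z w))%R| <= eps.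
  apply: mollify_near; [exact: mcZ|exact: mM|exact: mM|exact: M01|exact: M01|].
  move=> v; have -> : mollify f P (fun w => t * Y k w) v = mollify f P (fun w => t * Y 0%N w) v.
    have mF : measurable_fun setT (fun x : R => (f (v + t * x))%:E).
      apply/measurable_EFinP; apply: (measurable_shift mf).
      by apply: measurable_funM; [exact: measurable_cst|exact: measurable_id].
    apply: EFin_inj; rewrite !EFin_mollify//.
    apply: (same_law_integral (mY k) (mY 0%N) (lawY k) mF) => x.
    by rewrite lee_fin; have /andP[] := f01 (v + t * x).
  have [_ _ _ tay] := tf; have [a [b ab]] := tay v.
  have o1 := one_step (mY 0%N) Y1 Y2 tf ab (ltW t0).
  have o2 := one_step mZ (normal_variable_mean hZ) (normal_variable_sqr hZ) tf ab (ltW t0).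
  rewrite /eps mulrDr; move: o1 o2; rewrite !ler_norml.
  move=> /andP[p11 p12] /andP[p21 p22].
  by apply/andP; split; lra.
(* Variances add: k t^2 + t^2 = (k + 1) t^2. *)
have E : Num.sqrt ((Num.sqrt k%:R * t) ^+ 2 + t ^+ 2) = Num.sqrt k.+1%:R * t.
  rewrite exprMn sqr_sqrtr// -[X in _ + X]mul1r -mulrDl -natr1 sqrtrM ?addr_ge0//.
  by rewrite sqrtr_sqr gtr0_norm.
rewrite (mollify_normal mf f01 (Num.sqrt k%:R * t) u hZ t0) E in s2.
have := lerD s1 s2; move/(le_trans (ler_normD _ _)); rewrite addrA subrK.
by rewrite -natr1 mulrDl mul1r.
Qed.

End lindeberg.

(** * Poisson mixtures *)

Section poisson.
Context {R : realType}.

Definition poisson_weight (lambda : R) (k : nat) : R := expR (- lambda) * (lambda ^+ k / k`!%:R).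

Lemma poisson_weight_ge0 lambda k : 0 <= lambda -> 0 <= poisson_weight lambda k.
Proof. by move=> l0; rewrite mulr_ge0 ?expR_ge0// divr_ge0// exprn_ge0. Qed.

Lemma measurable_poisson_weight k : measurable_fun setT (poisson_weight ^~ k).
Proof.
apply: measurable_funM; first by apply: measurableT_comp.
by apply: measurable_funM => //; exact: measurable_funX.
Qed.

Lemma poisson_weightS lambda k :
  k.+1%:R * poisson_weight lambda k.+1 = lambda * poisson_weight lambda k.
Proof.
rewrite /poisson_weight factS natrM exprS.
have k0 : k`!%:R != 0 :> R by rewrite pnatr_eq0 -lt0n fact_gt0.
have : k.+1%:R != 0 :> R by rewrite pnatr_eq0.
move: (k`!%:R) k0 (k.+1%:R) (lambda ^+ k) (expR _) => x x0 y z e y0.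
by field; rewrite x0 y0.
Qed.

Lemma EFin_nneseries (u : nat -> R) (l : R) :
  \sum_(0 <= k < n) u k @[n --> \oo] --> l -> (\sum_(k <oo) (u k)%:E = l%:E)%E.
Proof.
move=> ul; apply/cvg_lim => //.
under eq_fun do rewrite sumEFin.
by apply: cvg_EFin ul; exact: nearW.
Qed.

Lemma cvg_poisson_mass lambda : \sum_(0 <= k < n) poisson_weight lambda k @[n --> \oo] --> (1 : R).
Proof.
have -> : (fun n => \sum_(0 <= k < n) poisson_weight lambda k) =
    (fun n => expR (- lambda) * series (exp_coeff lambda) n).
  by apply/funext => n; rewrite /series/= mulr_sumr.
rewrite [X in _ --> X](_ : _ = expR (- lambda) * expR lambda); last by rewrite -expRD addNr expR0.
apply: cvgM; first exact: cvg_cst.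
exact: is_cvg_series_exp_coeff.
Qed.

(** Mean and variance are both lambda. The first two factorial moments of the truncated sums are
    lambda and lambda^2 times the mass truncated one and two terms earlier, hence the shift by 2
    before passing to the limit. *)
Lemma poisson_quadratic (lambda a b c : R) :
  (\sum_(k <oo) (poisson_weight lambda k * (a + b * k%:R + c * (k%:R - lambda) ^+ 2))%:E =
   (a + b * lambda + c * lambda)%:E)%E.
Proof.
set w := poisson_weight lambda; pose W n := \sum_(0 <= k < n) w k.
have m1 n : \sum_(0 <= k < n.+1) k%:R * w k = lambda * W n.
  rewrite big_nat_recl// mul0r add0r mulr_sumr; apply: eq_bigr => k _.
  exact: poisson_weightS.
have m2 n : \sum_(0 <= k < n.+2) k%:R * (k%:R - 1) * w k = lambda ^+ 2 * W n.
  rewrite big_nat_recl// !mul0r add0r expr2 -mulrA -m1 mulr_sumr; apply: eq_bigr => k _.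
  rewrite -[in X in _ * X * _]natr1 addrK mulrAC poisson_weightS /w; ring.
apply: EFin_nneseries; rewrite -(cvg_shiftn 2).
have -> : [sequence \sum_(0 <= k < n + 2) w k * (a + b * k%:R + c * (k%:R - lambda) ^+ 2)]_n =
  (fun n => a * W (n + 2)%N + (b + c * (1 - 2 * lambda)) * (lambda * W (n + 1)%N) +
    c * (lambda ^+ 2 * W n) + c * lambda ^+ 2 * W (n + 2)%N).
  apply/funext => n /=; rewrite addn1 -m1 -m2 addn2 /W !mulr_sumr -!big_split/=.
  by apply: eq_bigr => k _; ring.
have cW N : W (n + N)%N @[n --> \oo] --> (1 : R).
  by have := @cvg_poisson_mass lambda; rewrite -(cvg_shiftn N).
have c0 : W n @[n --> \oo] --> (1 : R) by exact: cvg_poisson_mass.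
have -> : a + b * lambda + c * lambda = a * 1 + (b + c * (1 - 2 * lambda)) * (lambda * 1) +
    c * (lambda ^+ 2 * 1) + c * lambda ^+ 2 * 1 by ring.
apply: cvgD; last by apply: cvgM => //; exact: cvg_cst.
apply: cvgD; last by apply: cvgM; [exact: cvg_cst|apply: cvgM => //; exact: cvg_cst].
apply: cvgD; first by apply: cvgM => //; exact: cvg_cst.
by apply: cvgM; [exact: cvg_cst|apply: cvgM => //; exact: cvg_cst].
Qed.

Lemma poisson_mass lambda : (\sum_(k <oo) (poisson_weight lambda k)%:E = 1)%E.
Proof. exact/EFin_nneseries/cvg_poisson_mass. Qed.

Lemma poisson_weight_le1 lambda k : 0 <= lambda -> poisson_weight lambda k <= 1.
Proof.
move=> l0; rewrite -lee_fin -(poisson_mass lambda).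
have h n : (0 <= n)%N -> xpredT n -> (0 <= (poisson_weight lambda n)%:E)%E.
  by move=> _ _; rewrite lee_fin poisson_weight_ge0.
apply: le_trans (nneseries_lim_ge k.+1 h).
rewrite big_nat_recr//= leeDr// sume_ge0// => i _.
by rewrite lee_fin poisson_weight_ge0.
Qed.

Section average.
Variables (q : nat -> R) (lambda : R).
Hypotheses (q01 : forall k, 0 <= q k <= 1) (l0 : 0 <= lambda).

Definition poisson_average : \bar R := (\sum_(k <oo) (poisson_weight lambda k * q k)%:E)%E.

Let w0 k : 0 <= poisson_weight lambda k. Proof. exact: poisson_weight_ge0. Qed.
Let q0 k : 0 <= q k. Proof. by have /andP[] := q01 k. Qed.

Lemma poisson_average_ge0 : (0 <= poisson_average)%E.
Proof. by apply: nneseries_ge0 => k _ _; rewrite lee_fin (mulr_ge0 (w0 k) (q0 k)). Qed.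

Lemma poisson_average_le1 : (poisson_average <= 1)%E.
Proof.
rewrite -(poisson_mass lambda); apply: lee_nneseries => [k _ _|k _]; rewrite lee_fin ?(mulr_ge0 (w0 k) (q0 k))//.
by rewrite ler_piMr//; have /andP[] := q01 k.
Qed.

Lemma fin_num_poisson_average : poisson_average \is a fin_num.
Proof.
rewrite ge0_fin_numE ?poisson_average_ge0//.
by rewrite (le_lt_trans poisson_average_le1)// ltry.
Qed.

(** Each inequality is arranged as a comparison of series with nonnegative terms, avoiding
    differences of extended sums: average <= h + error, and h <= average + error. *)
Lemma poisson_average_near (h a b c : R) : 0 <= h -> 0 <= a -> 0 <= b -> 0 <= c ->
  (forall k, `|q k - h| <= a + b * k%:R + c * (k%:R - lambda) ^+ 2) ->
  `|fine poisson_average - h| <= a + b * lambda + c * lambda.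
Proof.
move=> h0 a0 b0 c0 H; set B := a + b * _ + _.
have e0 k : 0 <= a + b * k%:R + c * (k%:R - lambda) ^+ 2.
  by rewrite !addr_ge0// mulr_ge0// sqr_ge0.
have up : (poisson_average <= (h + B)%:E)%E.
  have -> : h + B = (h + a) + b * lambda + c * lambda by rewrite /B !addrA.
  rewrite -poisson_quadratic; apply: lee_nneseries => [k _ _|k _]; rewrite lee_fin ?(mulr_ge0 (w0 k) (q0 k))//.
  rewrite ler_wpM2l//; have := H k; rewrite ler_norml => /andP[_]; lra.
have lo : (h%:E <= poisson_average + B%:E)%E.
  have -> : h = h + 0 * lambda + 0 * lambda by rewrite !mul0r !addr0.
  rewrite -{1}poisson_quadratic -poisson_quadratic -nneseriesD; last 2 first.
  - by move=> k _ _; rewrite lee_fin (mulr_ge0 (w0 k) (q0 k)).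
  - by move=> k _ _; rewrite lee_fin (mulr_ge0 (w0 k) (e0 k)).
  apply: lee_nneseries => [k _ _|k _]; first by rewrite lee_fin !mul0r !addr0 (mulr_ge0 (w0 k) h0).
  rewrite -EFinD lee_fin -mulrDr ler_wpM2l// !mul0r !addr0.
  by have := H k; rewrite ler_norml => /andP[+ _]; lra.
move: up lo; rewrite -(fineK fin_num_poisson_average) -EFinD !lee_fin => up lo.
by rewrite ler_norml; apply/andP; split; lra.
Qed.

End average.
End poisson.

Section mixed_poisson.
Context {R : realType} {d : measure_display} {T : measurableType d}.
Variables (P : probability T R) (G : {RV P >-> R}) (r alpha : R).
Hypothesis hG : has_pdf P G (gg_pdf r alpha 1).
Local Notation mu := (@lebesgue_measure R).

Lemma gg_pdf_scale (n x : R) : 0 < n -> gg_pdf r alpha (n `^ alpha)^-1 (n * x) * n = gg_pdf r alpha 1 x.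
Proof.
move=> n0; rewrite /gg_pdf.
have -> : (0 < n * x) = (0 < x) by exact: pmulr_rgt0.
have [x0|_] := ltP 0 x; last by rewrite mul0r.
have nx : 0 <= n by exact: ltW.
have E1 : (n `^ alpha)^-1 `^ r * (n * x) `^ (alpha * r - 1) * n = x `^ (alpha * r - 1).
  have nz (p : bool) : p ==> (n != 0) by rewrite gt_eqF// implybT.
  have EN : n `^ (- alpha * r) * n `^ (alpha * r - 1) * n = 1.
    rewrite -[X in _ * X = _](powRr1 nx) -!powRD//.
    have -> : - alpha * r + (alpha * r - 1) + 1 = 0 by ring.
    exact: powRr0.
  rewrite powRM// ?ltW// -powRN -powRrM.
  transitivity (n `^ (- alpha * r) * n `^ (alpha * r - 1) * n * x `^ (alpha * r - 1)); first by ring.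
  by rewrite EN mul1r.
have E2 : (n `^ alpha)^-1 * (n * x) `^ alpha = x `^ alpha.
  by rewrite powRM ?ltW// mulrA mulVf ?mul1r// gt_eqF// powR_gt0.
rewrite !mulNr E2 mul1r powR1 mulr1 -E1.
by move: (_ `^ _) (_ `^ _) (expR _) (GammaF r)^-1 => *; ring.
Qed.

(** The parameter n^(-alpha) is the law of n G, by the substitution z = n x. The absolute value
    keeps the Poisson parameter nonnegative at every point; it changes nothing almost surely, since
    the density of G lives on x > 0. *)
Lemma gnb_pmf_mixture (n : R) k : 0 < n ->
  ((gnb_pmf r alpha (n `^ alpha)^-1 k)%:E = \int[P]_w (poisson_weight (n * `|G w|) k)%:E)%E.
Proof.
move=> n0.
have mg : measurable_fun setT (fun x : R => poisson_weight (n * `|x|) k).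
  apply: (measurableT_comp (measurable_poisson_weight k)).
  by apply: measurable_funM => //; exact: normr_measurable.
have w0 (x : R) : 0 <= poisson_weight (n * `|x|) k by rewrite poisson_weight_ge0// mulr_ge0// ltW.
have w1 (x : R) : poisson_weight (n * `|x|) k <= 1 by rewrite poisson_weight_le1// mulr_ge0// ltW.
have mG : measurable_fun setT G by exact: measurable_funPT.
set I := RHS.
have fI : I \is a fin_num.
  apply: integrable_fin_num => //; apply: unit_integrable => [|w]; last by rewrite w0 w1.
  exact: (measurableT_comp mg).
have kf : k`!%:R != 0 :> R by rewrite pnatr_eq0 -lt0n fact_gt0.
have IE : (\int[mu]_(z in `]0%R, +oo[) (expR (- z) * z ^+ k * gg_pdf r alpha (n `^ alpha)^-1 z)%:E =
    (k`!%:R)%:E * I)%E.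
  have mgE : measurable_fun setT (fun x : R => (poisson_weight (n * `|x|) k)%:E) by exact/measurable_EFinP.
  have g0 (x : R) : (0 <= (poisson_weight (n * `|x|) k)%:E)%E by rewrite lee_fin.
  rewrite /I (has_pdf_integral (measurable_gg_pdf r alpha 1) (gg_pdf_ge0 r alpha 1) hG mgE g0).
  have mh : measurable_fun setT (fun z : R => (poisson_weight `|z| k * gg_pdf r alpha (n `^ alpha)^-1 z)%:E).
    apply/measurable_EFinP; apply: measurable_funM; last exact: measurable_gg_pdf.
    by apply: (measurableT_comp (measurable_poisson_weight k)); exact: normr_measurable.
  have pw0 (z : R) : 0 <= poisson_weight `|z| k by exact: poisson_weight_ge0.
  have h0 (z : R) : 0 <= poisson_weight `|z| k * gg_pdf r alpha (n `^ alpha)^-1 z.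
    by rewrite (mulr_ge0 (pw0 z))// gg_pdf_ge0.
  transitivity ((k`!%:R)%:E * \int[mu]_z (poisson_weight `|z| k * gg_pdf r alpha (n `^ alpha)^-1 z)%:E)%E.
    rewrite -ge0_integralZl//; last first.
      by move=> z _; rewrite lee_fin.
    rewrite [LHS]integral_mkcond; apply: eq_integral => z _.
    rewrite patchE mem_setE in_itv/= andbT -EFinM; case: ifP => z0.
      congr (_%:E); rewrite (gtr0_norm z0) /poisson_weight.
      move: (gg_pdf _ _ _ _) (expR _) (z ^+ k) (k`!%:R) kf => u v x y y0.
      by field.
    by rewrite /gg_pdf z0 !mulr0.
  congr (_ * _)%E; rewrite (@ge0_integral_affine _ n 0)//.
  pose H (x : R) := (poisson_weight `|n * x + 0| k * gg_pdf r alpha (n `^ alpha)^-1 (n * x + 0))%:E.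
  have mH : measurable_fun setT H.
    apply: (measurableT_comp mh); apply: measurable_funD; last exact: measurable_cst.
    by apply: measurable_funM; [exact: measurable_cst|exact: measurable_id].
  have H0 (x : R) : (0 <= H x)%E by rewrite lee_fin.
  transitivity (\int[mu]_x (n%:E * H x))%E.
    by rewrite ge0_integralZl// lee_fin ltW.
  apply: eq_integral => x _; rewrite /H addr0 -!EFinM; congr (_%:E).
  by rewrite normrM (gtr0_norm n0) -(gg_pdf_scale x n0); ring.
rewrite /gnb_pmf /Rintegral IE fineM// -(fineK fI) /=.
by rewrite mulrA mulVf// mul1r.
Qed.

End mixed_poisson.

(** * Random sums *)

Section random_sums.
Context {R : realType} {d : measure_display} {T : measurableType d}.
Variables (P : probability T R) (N : {RV P >-> R}) (S : nat -> T -> R).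
Hypothesis mS : forall k, measurable_fun setT (S k).

Let mN : measurable_fun setT N. Proof. exact: measurable_funPT. Qed.

Lemma measurable_truncn_eq k : measurable [set x : R | Num.truncn x = k].
Proof.
have H j : measurable [set x : R | (j <= Num.truncn x)%N].
  case: j => [|j]; first by rewrite (_ : [set _ | _] = setT)//; apply/seteqP; split.
  rewrite (_ : [set _ | _] = `[j.+1%:R, +oo[%classic)//.
  by apply/seteqP; split => x /=; rewrite in_itv/= andbT truncn_gt_nat.
have -> : [set x : R | Num.truncn x = k] =
    [set x : R | (k <= Num.truncn x)%N] `\` [set x : R | (k.+1 <= Num.truncn x)%N].
  apply/seteqP; split => x /=; first by move=> ->; split; rewrite ?ltnn.
  by move=> [k1 /negP]; rewrite -leqNgt => k2; apply/eqP; rewrite eqn_leq k2.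
exact: measurableD.
Qed.

Lemma measurable_random_index : measurable_fun setT (fun w => S (Num.truncn (N w)) w).
Proof.
pose E k := N @^-1` [set x : R | Num.truncn x = k].
have mE k : measurable (E k).
  exact: (measurable_preimageT mN (measurable_truncn_eq k)).
have -> : [set: T] = \bigcup_k E k.
  by apply/seteqP; split => // w _; exists (Num.truncn (N w)).
apply/measurable_fun_bigcup => // k.
apply: (eq_measurable_fun (S k)); last exact: measurable_funTS.
by move=> w; rewrite inE /E /= => ->.
Qed.

Variable p : nat -> R.
Hypotheses (Np : forall k, P (N @^-1` [set k%:R]) = (p k)%:E)
  (p1 : (\sum_(k <oo) (p k)%:E = 1)%E) (iSN : forall k, indep2 P (S k) N).
Variable g : R -> R.
Hypotheses (mg : measurable_fun setT g) (g01 : forall u, 0 <= g u <= 1).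

(** The masses sum to 1, so up to a null event N is a natural number, on which truncation is exact.
    On each event N = k, independence of S k and N factors the integral. *)
Lemma random_sum_expectation :
  (\int[P]_w (g (S (Num.truncn (N w)) w))%:E =
   \sum_(k <oo) (p k * (\int[P]_(w in setT) g (S k w))%R)%:E)%E.
Proof.
pose A k := N @^-1` [set k%:R : R].
have mA k : measurable (A k).
  exact: (measurable_preimageT mN (measurable_set1 _)).
have tA : trivIset setT A.
  apply/trivIsetP => i j _ _ ij; apply/seteqP; split => // w [Ni Nj].
  have /eqP : i%:R = j%:R :> R by rewrite -(Ni : N w = _) -(Nj : N w = _).
  by rewrite eqr_nat (negbTE ij).
have mU : measurable (\bigcup_k A k) by exact: bigcup_measurable.
have PU : P (\bigcup_k A k) = 1%E.
  rewrite measure_semi_bigcup// -p1; apply: eq_eseriesr => k _; exact: Np.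
have PC : P (~` \bigcup_k A k) = 0%E.
  by have := probability_setC P mU; rewrite PU => ->; rewrite subee.
have mF : measurable_fun setT (fun w => (g (S (Num.truncn (N w)) w))%:E).
  by apply/measurable_EFinP; apply: (measurableT_comp mg); exact: measurable_random_index.
have g0 u : 0 <= g u by have /andP[] := g01 u.
have F00 w : setT w -> (0 <= (g (S (Num.truncn (N w)) w))%:E)%E by rewrite lee_fin.
rewrite (ge0_negligible_integral (measurableC mU) measurableT mF F00 PC) setTD setCK.
rewrite (ge0_integral_bigcup P mA (measurable_funTS mF) (fun w _ => F00 w I) tA).
apply: eq_eseriesr => k _.
have mgk : measurable_fun setT (fun w => g (S k w)) by exact: measurableT_comp.
pose F (z : R * R) : \bar R := (g z.1 * \1_([set k%:R : R]) z.2)%:E.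
have mFF : measurable_fun setT F.
  apply/measurable_EFinP; apply: measurable_funM.
    exact: (measurableT_comp mg measurable_fst).
  have m1 : measurable_fun setT (\1_([set k%:R : R]) : R -> R) by exact: measurable_indic.
  exact: (measurableT_comp m1 measurable_snd).
have F0 z : (0 <= F z)%E by rewrite lee_fin mulr_ge0.
transitivity (\int[P]_w F (S k w, N w))%E.
  rewrite integral_mkcond; apply: eq_integral => w _.
  rewrite patchE /F /= indicE; case: (boolP (w \in A k)) => wA.
    have Nw : N w = k%:R by move: wA; rewrite inE.
    by rewrite Nw natrK mem_set// mulr1.
  rewrite memNset ?mulr0// => Nw; move/negP: wA; apply; by rewrite inE.
rewrite (indep2_integral (f := F) (mS k) mN (iSN k) mFF F0).
rewrite mulrC EFinM EFin_Rintegral_unit// -ge0_integralZr//; last 3 first.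
- exact/measurable_EFinP.
- by move=> w _; rewrite lee_fin.
- by rewrite -Np.
apply: eq_integral => w _; rewrite -Np.
transitivity (\int[P]_w' ((g (S k w))%:E * (\1_(A k) w')%:E))%E.
  by apply: eq_integral => w' _; rewrite /F /= EFinM.
rewrite ge0_integralZl//; last 2 first.
- by apply/measurable_EFinP; exact: measurable_indic.
- by rewrite lee_fin.
by rewrite integral_indic// setIT.
Qed.

End random_sums.

Section normal_scale.
Context {R : realType} {d : measure_display} {T : measurableType d}.
Variables (P : probability T R) (Z : {RV P >-> R}) (f : R -> R) (L : R).
Hypotheses (hZ : has_pdf P Z (normal_pdf 0 1)) (tf : lindeberg_test f L).

Let mZ : measurable_fun setT Z. Proof. exact: measurable_funPT. Qed.
Let mf : measurable_fun setT f. Proof. by case: tf. Qed.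
Let f01 u : 0 <= f u <= 1. Proof. by case: tf. Qed.

Lemma lindeberg_test_ge0 : 0 <= L.
Proof.
have [_ _ H _] := tf; have := H 0 1; rewrite normr1 mulr1; exact: le_trans.
Qed.

(** The Lipschitz bound on f together with E|Z| <= (1 + E Z^2) / 2 = 1. *)
Lemma mollify_normal_lip a b v :
  `|mollify f P (fun w => a * Z w) v - mollify f P (fun w => b * Z w) v| <= L * `|a - b|.
Proof.
have [_ _ Lip _] := tf; have L0 := lindeberg_test_ge0.
have mcZ c : measurable_fun setT (fun w => c * Z w) by exact: measurable_funM.
have i c : P.-integrable setT (fun w => (f (v + c * Z w))%:E).
  by apply: unit_integrable => //; exact: (measurable_shift mf (mcZ c)).
have iab : P.-integrable setT (EFin \o (fun w => f (v + a * Z w) - f (v + b * Z w))).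
  exact: (integrableB measurableT (i a) (i b)).
have iZ2 := integrable_sqr mZ (normal_variable_sqr hZ).
have i1 : P.-integrable setT (EFin \o (fun _ : T => 1 : R)).
  by apply: (@bounded_integrable _ _ _ _ _ 1) => // w; rewrite normr1.
have i2 : P.-integrable setT (EFin \o (fun w => 1 + Z w ^+ 2)) by exact: (integrableD measurableT i1 iZ2).
have E1 : (\int[P]_(w in setT) (1 + Z w ^+ 2))%R = 2.
  by rewrite RintegralD// Rintegral_prob_cst /Rintegral normal_variable_sqr.
have -> : L * `|a - b| = (\int[P]_(w in setT) (L * `|a - b| / 2 * (1 + Z w ^+ 2)))%R.
  by rewrite RintegralZl// E1 divfK.
have ia := i a; have ib := i b.
rewrite /mollify -RintegralB//; apply: le_trans (le_normr_Rintegral _ iab) _ => //.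
apply: le_Rintegral => //.
- exact: (integrable_norm iab).
- exact: (integrableZl measurableT (L * `|a - b| / 2) i2).
move=> w _ /=.
have -> : f (v + a * Z w) - f (v + b * Z w) = f (v + b * Z w + (a - b) * Z w) - f (v + b * Z w).
  by congr (f _ - _); ring.
apply: le_trans (Lip _ _) _; rewrite normrM -!mulrA ler_wpM2l// ler_wpM2l//.
have := sqr_ge0 (`|Z w| - 1); rewrite sqrrB1 real_normK ?num_real// => h.
by lra.
Qed.

Lemma cvg_inv_sqrtn : (Num.sqrt (n%:R : R))^-1 @[n --> \oo] --> (0 : R).
Proof.
rewrite -(cvg_shiftn 1).
have -> : [sequence (Num.sqrt ((n + 1)%N%:R : R))^-1]_n = Num.sqrt \o (@harmonic R).
  by apply/funext => n /=; rewrite addn1 sqrtrV.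
have := @sqrt_continuous R 0; rewrite /continuous_at sqrtr0 => cs.
exact: (cvg_comp (@harmonic R) Num.sqrt (@cvg_harmonic R) cs).
Qed.

Variables (q : nat -> nat -> R) (tau : nat -> R).
Hypotheses (q01 : forall n k, 0 <= q n k <= 1) (tau0 : forall n, 0 <= tau n)
  (ctau : tau n @[n --> \oo] --> (0 : R)).
Hypothesis q_normal : forall n k, (0 < n)%N ->
  `|q n k - mollify f P (fun w => Num.sqrt (k%:R / n%:R) * Z w) 0| <= k%:R * (L * n%:R^-1 * tau n).

(* A Poisson variable of mean [n * y] is within [O(sqrt n)] of its mean; the error
   [|k - n y| / n <= (t + t^3 (k - n y)^2) / 2] with [t = n^(-1/2)] is averaged by [poisson_quadratic]. *)
Lemma cvg_poisson_average_normal y : 0 < y ->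
  fine (poisson_average (q n) (n%:R * y)) @[n --> \oo] -->
  mollify f P (fun w => Num.sqrt y * Z w) 0.
Proof.
move=> y0; have L0 := lindeberg_test_ge0.
have s0 : 0 < Num.sqrt y by rewrite sqrtr_gt0.
set h := mollify _ _ _ _.
have h0 : 0 <= h by have /andP[] := mollify01 mf f01 P (measurable_funM (measurable_cst (Num.sqrt y)) mZ) 0.
pose t n : R := (Num.sqrt (n%:R : R))^-1.
pose K := L / (2 * Num.sqrt y).
have K0 : 0 <= K by rewrite divr_ge0// mulr_ge0// ltW.
(* The bound of [poisson_average_near] at mean n y with coefficients K t, L t^2 tau and K t^3,
   simplified by n t^2 = 1. *)
pose B n : R := K * t n + L * tau n * y + K * t n * y.
have cB : B n @[n --> \oo] --> (0 : R).
  have -> : 0 = K * 0 + L * 0 * y + K * 0 * y :> R by rewrite !mulr0 !mul0r !addr0.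
  apply: cvgD; first apply: cvgD.
  - by apply: cvgM; [exact: cvg_cst|exact: cvg_inv_sqrtn].
  - by apply: cvgM; [apply: cvgM => //; exact: cvg_cst|exact: cvg_cst].
  - by apply: cvgM; [apply: cvgM; [exact: cvg_cst|exact: cvg_inv_sqrtn]|exact: cvg_cst].
have key n : (0 < n)%N -> `|fine (poisson_average (q n) (n%:R * y)) - h| <= B n.
  move=> n0; have nR : 0 < n%:R :> R by rewrite ltr0n.
  have t0 : 0 < t n by rewrite invr_gt0 sqrtr_gt0.
  have t2 : n%:R^-1 = t n ^+ 2 :> R by rewrite /t exprVn sqr_sqrtr// ltW.
  have tn : t n ^+ 2 * n%:R = 1 by rewrite -t2 mulVf// gt_eqF.
  have -> : B n = K * t n + (L * t n ^+ 2 * tau n) * (n%:R * y) + (K * t n ^+ 3) * (n%:R * y).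
    rewrite /B; congr (_ + _ + _).
      by rewrite -[LHS]mul1r -[X in X * _]tn; ring.
    by rewrite -[LHS]mul1r -[X in X * _]tn; ring.
  apply: poisson_average_near => //.
  - by rewrite mulr_ge0// ltW.
  - by rewrite mulr_ge0// ltW.
  - by rewrite mulr_ge0// mulr_ge0// exprn_ge0// ltW.
  - by rewrite mulr_ge0// exprn_ge0// ltW.
  move=> k; have := q_normal k n0; rewrite [X in L * X]t2.
  have := mollify_normal_lip (Num.sqrt (k%:R / n%:R)) (Num.sqrt y) 0; rewrite -/h.
  set m := mollify _ _ _ _; set u := Num.sqrt _ => H1 H2.
  have u0 : 0 <= u by exact: sqrtr_ge0.
  have u2 : u ^+ 2 = k%:R * t n ^+ 2 by rewrite /u sqr_sqrtr ?divr_ge0// t2.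
  (* Replacing sqrt(y) by u + sqrt(y) turns the left side into |u^2 - y|. The division by sqrt(y)
     explains the constant [K], and the need for y > 0. *)
  have H3 : `|u - Num.sqrt y| * Num.sqrt y <= `|k%:R - n%:R * y| * t n ^+ 2.
    apply: (@le_trans _ _ (`|u - Num.sqrt y| * (u + Num.sqrt y))).
      by rewrite ler_wpM2l// lerDr.
    rewrite -[X in _ * X]ger0_norm ?addr_ge0 ?sqrtr_ge0// -normrM -subr_sqr u2.
    have -> : Num.sqrt y ^+ 2 = t n ^+ 2 * n%:R * y by rewrite tn mul1r sqr_sqrtr// ltW.
    rewrite -[X in _ <= _ * X]ger0_norm ?sqr_ge0// -normrM.
    by rewrite le_eqVlt; apply/orP; left; apply/eqP; congr `|_|; ring.
  have H4 : `|k%:R - n%:R * y| * t n ^+ 2 <= (t n + t n ^+ 3 * (k%:R - n%:R * y) ^+ 2) / 2.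
    (* Expanding t (z t - 1)^2 >= 0 gives 2 z t^2 <= t + t^3 z^2. *)
    have := mulr_ge0 (ltW t0) (sqr_ge0 (`|k%:R - n%:R * y| * t n - 1)).
    rewrite -(real_normK (num_real (k%:R - n%:R * y))); move: `|_| => z.
    by rewrite !exprS !expr0 => ?; lra.
  have H5 : L * `|u - Num.sqrt y| <= K * (t n + t n ^+ 3 * (k%:R - n%:R * y) ^+ 2).
    have -> : K * (t n + t n ^+ 3 * (k%:R - n%:R * y) ^+ 2) =
        L * ((t n + t n ^+ 3 * (k%:R - n%:R * y) ^+ 2) / 2 / Num.sqrt y).
      by rewrite /K; move: (t n) (_ ^+ 2) => c e; field; rewrite gt_eqF.
    rewrite ler_wpM2l// ler_pdivlMr//; exact: le_trans H3 H4.
  have := ler_normD (q n k - m) (m - h); rewrite addrA subrK => /le_trans; apply.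
  apply: le_trans (lerD H2 (le_trans H1 H5)) _.
  by rewrite le_eqVlt; apply/orP; left; apply/eqP; ring.
apply: (@squeeze_cvgr _ _ _ _ (fun n => h - B n) (fun n => h + B n)).
- near=> n; have n0 : (0 < n)%N by near: n; exact: nbhs_infty_gt.
  by have := key n n0; rewrite ler_norml => /andP[? ?]; apply/andP; split; lra.
- by rewrite -[X in _ --> X]subr0; apply: cvgB => //; exact: cvg_cst.
- by rewrite -[X in _ --> X]addr0; apply: cvgD => //; exact: cvg_cst.
Unshelve. all: end_near. Qed.

End normal_scale.

(** * The transfer theorem for random sums *)

Section transfer.
Context {R : realType} (r alpha : R).
Context {d : measure_display} {T : measurableType d}.
Variables (P : probability T R) (X : nat -> {RV P >-> R}) (N : nat -> {RV P >-> R}) (sigma : R).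
Hypotheses (indepX : mutually_independent P (fun k => X k : T -> R))
  (lawX : forall k (B : set R), measurable B -> P (X k @^-1` B) = P (X 0%N @^-1` B))
  (intX : P.-integrable setT (EFin \o X 0%N)) (meanX : ('E_P[X 0%N] = 0)%E)
  (sigma0 : 0 < sigma) (varX : 'V_P[X 0%N] = (sigma ^+ 2)%:E)
  (lawN : forall n : nat, (0 < n)%N ->
     forall k : nat, P (N n @^-1` [set k%:R]) = (gnb_pmf r alpha (n%:R `^ alpha)^-1 k)%:E)
  (indepN : forall n : nat, (0 < n)%N ->
     mutually_independent P
       (fun o : option nat => match o with
                              | None => N n : T -> R
                              | Some k => X k : T -> R end)).
Context {d' : measure_display} {T' : measurableType d'}.
Variables (P' : probability T' R) (Xl G : {RV P' >-> R}).
Hypotheses (hXl : has_pdf P' Xl (normal_pdf 0 1)) (hG : has_pdf P' G (gg_pdf r alpha 1))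
  (indepG : mutually_independent P' (fun b : bool => if b then Xl : T' -> R else G : T' -> R)).

Let Y k w := X k w / sigma.
Let S k w := \sum_(j < k) X j w.

Let mX k : measurable_fun setT (X k). Proof. exact: measurable_funPT. Qed.
Let mN n : measurable_fun setT (N n). Proof. exact: measurable_funPT. Qed.
Let mXl : measurable_fun setT Xl. Proof. exact: measurable_funPT. Qed.
Let mG : measurable_fun setT G. Proof. exact: measurable_funPT. Qed.
Let mY k : measurable_fun setT (Y k). Proof. exact: measurable_funM. Qed.
Let mS k : measurable_fun setT (S k). Proof. exact: measurable_sum. Qed.

Let mscale (B : set R) : measurable B -> measurable ((fun x => x / sigma) @^-1` B).
Proof.
move=> mB; rewrite -[X in measurable X]setTI.
by apply: (measurable_funM (@measurable_id _ _ setT) (measurable_cst sigma^-1)).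
Qed.

Let indepY : mutually_independent P Y.
Proof.
move=> J B uJ mB.
exact: (indepX (B := fun k => (fun x => x / sigma) @^-1` B k) uJ (fun k => mscale (mB k))).
Qed.

Let lawY k : same_law P (Y k) P (Y 0%N).
Proof. by move=> B mB; exact: (lawX k (mscale mB)). Qed.

Let Y1 : (\int[P]_w (Y 0%N w)%:E = 0)%E.
Proof.
transitivity ((sigma^-1)%:E * \int[P]_w (X 0%N w)%:E)%E.
  rewrite -integralZl//; apply: eq_integral => w _.
  by rewrite -EFinM mulrC.
by move: meanX; rewrite unlock => ->; rewrite mule0.
Qed.

Let Y2 : (\int[P]_w (Y 0%N w ^+ 2)%:E = 1)%E.
Proof.
have H : (\int[P]_w (X 0%N w ^+ 2)%:E = (sigma ^+ 2)%:E)%E.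
  rewrite -varX /variance covariance.unlock meanX expectation.unlock; apply: eq_integral => w _.
  by transitivity ((X 0%N w - 0) * (X 0%N w - 0))%:E; first by rewrite subr0 expr2.
transitivity ((sigma ^- 2)%:E * \int[P]_w (X 0%N w ^+ 2)%:E)%E.
  rewrite -ge0_integralZl//; last 3 first.
  - by apply/measurable_EFinP; exact: measurable_funX.
  - by move=> w _; rewrite lee_fin sqr_ge0.
  - by rewrite lee_fin invr_ge0 sqr_ge0.
  by apply: eq_integral => w _; rewrite -EFinM /Y expr_div_n mulrC.
by rewrite H -EFinM mulVf// expf_neq0// gt_eqF.
Qed.

Section test.
Variables (f : R -> R) (L : R).
Hypothesis tf : lindeberg_test f L.

Let mf : measurable_fun setT f. Proof. by case: tf. Qed.
Let f01 u : 0 <= f u <= 1. Proof. by case: tf. Qed.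
Let f0 u : 0 <= f u. Proof. by have /andP[] := f01 u. Qed.

Let t (n : nat) : R := (Num.sqrt (n%:R : R))^-1.
Let q n k := mollify f P (fun w => t n * \sum_(j < k) Y j w) 0.
Let tau n := lindeberg_tail P (Y 0%N) (t n) + lindeberg_tail P' Xl (t n).
Let Q n w := poisson_average (q n) (n%:R * `|G w|).

Let t_ge0 n : 0 <= t n. Proof. by rewrite invr_ge0 sqrtr_ge0. Qed.

Let mtS n k : measurable_fun setT (fun w => t n * \sum_(j < k) Y j w).
Proof. by apply: measurable_funM => //; exact: measurable_sum. Qed.

Let q01 n k : 0 <= q n k <= 1. Proof. exact: mollify01. Qed.

Let l0 n w : 0 <= n%:R * `|G w|. Proof. by rewrite mulr_ge0. Qed.

Let mw n k : measurable_fun setT (fun w => (poisson_weight (n%:R * `|G w|) k * q n k)%:E).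
Proof.
apply/measurable_EFinP; apply: measurable_funM => //.
apply: (measurableT_comp (measurable_poisson_weight k)); apply: measurable_funM => //.
exact: (measurableT_comp (@normr_measurable R setT)).
Qed.

Let w0 n k w : (0 <= (poisson_weight (n%:R * `|G w|) k * q n k)%:E)%E.
Proof. by have /andP[a _] := q01 n k; rewrite lee_fin mulr_ge0 ?poisson_weight_ge0. Qed.

Let mQ n : measurable_fun setT (Q n).
Proof. by apply: ge0_emeasurable_sum => // k w _ _; exact: w0. Qed.

Let cvg_Q : (\int[P']_w Q n w @[n --> \oo] -->
  \int[P']_w (mollify f P' (fun w' => Num.sqrt (G w) * Xl w') 0)%:E)%E.
Proof.
have tau_ge0 n : 0 <= tau n by rewrite addr_ge0// lindeberg_tail_ge0.
have ctau : tau n @[n --> \oo] --> (0 : R).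
  rewrite -[X in _ --> X](addr0 (0 : R)); apply: cvgD.
    by apply: (cvg_lindeberg_tail (mY 0%N) Y2 t_ge0); exact: cvg_inv_sqrtn.
  by apply: (cvg_lindeberg_tail mXl (normal_variable_sqr hXl) t_ge0); exact: cvg_inv_sqrtn.
have q_normal n k : (0 < n)%N ->
    `|q n k - mollify f P' (fun w => Num.sqrt (k%:R / n%:R) * Xl w) 0| <= k%:R * (L * n%:R^-1 * tau n).
  move=> n0; have nR : 0 < n%:R :> R by rewrite ltr0n.
  have t0 : 0 < t n by rewrite invr_gt0 sqrtr_gt0.
  have := lindeberg_sum mY indepY lawY Y1 Y2 hXl tf t0 k 0.
  rewrite /t exprVn (sqr_sqrtr (ltW nR)) => H.
  rewrite sqrtrM// sqrtrV; last exact: ltW.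
  exact: H.
have PG : P' (G @^-1` `]-oo, 0%R]) = 0%E.
  rewrite hG// integral0_eq// => x /=; rewrite in_itv/= => x0.
  by rewrite /gg_pdf ltNge x0.
have cF : {ae P', forall w, setT w -> Q ^~ w @ \oo -->
    (mollify f P' (fun w' => Num.sqrt (G w) * Xl w') 0)%:E}.
  exists (G @^-1` `]-oo, 0%R]); split => //.
    by apply: (measurable_preimageT mG).
  move=> w /= nw; rewrite in_itv/= leNgt; apply/negP => G0; apply: nw => _.
  apply: cvg_EFin; first by apply: nearW => n; exact: fin_num_poisson_average.
  have := cvg_poisson_average_normal hXl tf q01 tau_ge0 ctau q_normal G0.
  by rewrite /Q (gtr0_norm G0).
have bF : {ae P', forall w n, setT w -> (`|Q n w| <= 1)%E}.
  apply: aeW => w n _; rewrite gee0_abs; first exact: poisson_average_le1.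
  exact: poisson_average_ge0.
have i1 : P'.-integrable setT (fun _ : T' => 1%E : \bar R).
  by apply: (@bounded_integrable _ _ _ P' (fun=> 1) 1) => // w; rewrite normr1.
have mh : measurable_fun setT (fun w => (mollify f P' (fun w' => Num.sqrt (G w) * Xl w') 0)%:E).
  have ms := @measurable_sqrt R.
  have mK : measurable_fun setT (fun z : T' * T' => (f (0 + Num.sqrt (G z.1) * Xl z.2))%:E).
    apply/measurable_EFinP; apply: (measurableT_comp mf); apply: measurable_funD => //.
    apply: measurable_funM; last exact: (measurableT_comp mXl measurable_snd).
    exact: (measurableT_comp ms (measurableT_comp mG measurable_fst)).
  have K0 (z : T' * T') : (0 <= (f (0 + Num.sqrt (G z.1) * Xl z.2))%:E)%E by rewrite lee_fin.
  have := @measurable_fun_fubini_tonelli_F _ _ _ _ _ P' _ mK K0.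
  apply: eq_measurable_fun => w _; rewrite EFin_mollify//.
  exact: measurable_funM.
by have [_ _] := dominated_convergence measurableT mQ mh cF i1 bF.
Qed.

Let mollify_product :
  (\int[P']_w (mollify f P' (fun w' => Num.sqrt (G w) * Xl w') 0)%:E =
   \int[P']_w (f (Xl w * Num.sqrt (G w)))%:E)%E.
Proof.
have ms := @measurable_sqrt R.
have mF : measurable_fun setT (fun z : R * R => (f (z.2 * Num.sqrt z.1))%:E).
  apply/measurable_EFinP; apply: (measurableT_comp mf); apply: measurable_funM => //.
  exact: (measurableT_comp ms measurable_fst).
have mYb b : measurable_fun setT (if b then Xl : T' -> R else G : T' -> R) by case: b.
have iGX : indep2 P' G Xl.
  by have := indep_outside_indep2 (@indep_outside1 _ _ _ _ _ _ mYb indepG false) (_ : true \notin [:: false]); apply.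
rewrite (indep2_integral (f := fun z : R * R => (f (z.2 * Num.sqrt z.1))%:E) mG mXl iGX mF); last first.
  by move=> z; rewrite lee_fin.
apply: eq_integral => w _; rewrite EFin_mollify//; last exact: measurable_funM.
by apply: eq_integral => w' _; rewrite add0r mulrC.
Qed.

(** An exact identity for each n: the masses of N are averaged Poisson weights, so summing over k
    and averaging over G can be exchanged. It links the space of the summands to the space of the
    limit. *)
Let random_sum_average n : (0 < n)%N ->
  (\int[P]_w (f (random_sum (fun k => X k : T -> R) (N n) w / (sigma * Num.sqrt n%:R)))%:E =
   \int[P']_w Q n w)%E.
Proof.
move=> n0; have nR : 0 < n%:R :> R by rewrite ltr0n.
have iSN k : indep2 P (S k) (N n).
  have mO (o : option nat) : measurable_fun setT
    (match o with None => N n : T -> R | Some k => X k : T -> R end) by case: o.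
  exact: (@indep2_sum _ _ _ P _ _ (@Some nat) mO (indepN n0) (fun _ _ e => Some_inj e) k None).
have mwk k : measurable_fun setT (fun w => (poisson_weight (n%:R * `|G w|) k)%:E).
  apply/measurable_EFinP; apply: (measurableT_comp (measurable_poisson_weight k)).
  by apply: measurable_funM => //; exact: (measurableT_comp (@normr_measurable R setT)).
have w00 k w : (0 <= (poisson_weight (n%:R * `|G w|) k)%:E)%E by rewrite lee_fin poisson_weight_ge0.
pose p k := gnb_pmf r alpha (n%:R `^ alpha)^-1 k.
have pE k : ((p k)%:E = \int[P']_w (poisson_weight (n%:R * `|G w|) k)%:E)%E.
  exact: gnb_pmf_mixture.
have p1 : (\sum_(k <oo) (p k)%:E = 1)%E.
  transitivity (\sum_(k <oo) \int[P']_w (poisson_weight (n%:R * `|G w|) k)%:E)%E.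
    by apply: eq_eseriesr => k _; exact: pE.
  rewrite -integral_nneseries//.
  under eq_integral do rewrite poisson_mass.
  by rewrite integral_cst// mul1e; exact: probability_setT.
pose g u := f (u / (sigma * Num.sqrt n%:R)).
have mg : measurable_fun setT g by apply: (measurableT_comp mf); exact: measurable_funM.
have g01 u : 0 <= g u <= 1 by exact: f01.
transitivity (\int[P]_w (g (S (Num.truncn (N n w)) w))%:E)%E; first by [].
rewrite (random_sum_expectation mS (lawN n0) p1 iSN mg g01).
rewrite /Q /poisson_average (integral_nneseries P' measurableT (mw n) (fun k w _ => w0 n k w)).
apply: eq_eseriesr => k _.
have -> : (\int[P]_(w in setT) g (S k w))%R = q n k.
  apply: eq_Rintegral => w _; rewrite /g add0r; congr f.
  by rewrite /S /Y -mulr_suml /t invfM; ring.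
have /andP[qk _] := q01 n k.
rewrite EFinM pE -ge0_integralZr//.
Qed.

Lemma cvg_random_sum_test :
  (\int[P]_(w in setT) f (random_sum (fun k => X k : T -> R) (N n) w / (sigma * Num.sqrt n%:R)))%R
    @[n --> \oo] --> (\int[P']_(w in setT) f (Xl w * Num.sqrt (G w)))%R.
Proof.
have H := cvg_Q; rewrite mollify_product in H.
have : fine (\int[P']_w Q n w)%E @[n --> \oo] --> (\int[P']_(w in setT) f (Xl w * Num.sqrt (G w)))%R.
  apply: fine_cvg; rewrite EFin_Rintegral_unit//.
  apply: (measurableT_comp mf); apply: measurable_funM => //.
  exact: (measurableT_comp (@measurable_sqrt R) mG).
apply: cvg_trans; apply: near_eq_cvg; near=> n.
have n0 : (0 < n)%N by near: n; exact: nbhs_infty_gt.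
by rewrite /= -(random_sum_average n0).
Unshelve. all: end_near. Qed.

End test.

Lemma random_sum_cvg_in_law :
  cvg_in_law P
    (fun n w => random_sum (fun k => X k : T -> R) (N n) w / (sigma * Num.sqrt n%:R))
    P' (fun w => Xl w * Num.sqrt (G w)).
Proof.
have ms := @measurable_sqrt R.
apply: cvg_in_law_logistic.
- by move=> n; apply: measurable_funM => //; exact: (measurable_random_index (N n) mS).
- by apply: measurable_funM => //; exact: (measurableT_comp ms).
move=> c x c0; have [L tf] := lindeberg_test_logistic x c0.
exact: (cvg_random_sum_test tf).
Qed.

End transfer.

Theorem theorem8 (R : realType) (r alpha : R) (hr : 0 < r) (ha : alpha != 0) :
  (* (i) transfer theorem for random sums with generalized negative binomial index *)
  (forall (d : measure_display) (T : measurableType d) (P : probability T R)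
          (X : nat -> {RV P >-> R}) (N : nat -> {RV P >-> R}) (sigma : R),
      (* X_1, X_2, ... i.i.d. *)
      mutually_independent P (fun k => X k : T -> R) ->
      (forall k (B : set R), measurable B -> P (X k @^-1` B) = P (X 0%N @^-1` B)) ->
      P.-integrable setT (EFin \o X 0%N) ->
      ('E_P[X 0%N] = 0)%E ->
      0 < sigma -> 'V_P[X 0%N] = (sigma ^+ 2)%:E ->
      (* N_n ~ generalized negative binomial (r, alpha, n^{-alpha}),
         independent of X_1, X_2, ... *)
      (forall n : nat, (0 < n)%N ->
         forall k : nat, P (N n @^-1` [set k%:R]) = (gnb_pmf r alpha (n%:R `^ alpha)^-1 k)%:E) ->
      (forall n : nat, (0 < n)%N ->
         mutually_independent P
           (fun o : option nat => match o with
                                  | None => N n : T -> R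
                                  | Some k => X k : T -> R end)) ->
      (* limit: X * sqrt(G*_{r,alpha,1}) with X ~ N(0,1) and G* independent *)
      forall (d' : measure_display) (T' : measurableType d') (P' : probability T' R)
             (Xl G : {RV P' >-> R}),
        has_pdf P' Xl (normal_pdf 0 1) ->
        has_pdf P' G (gg_pdf r alpha 1) ->
        mutually_independent P' (fun b : bool => if b then Xl : T' -> R else G : T' -> R) ->
        cvg_in_law P
          (fun n w => random_sum (fun k => X k : T -> R) (N n) w / (sigma * Num.sqrt n%:R))
          P' (fun w => Xl w * Num.sqrt (G w)))
  /\
  (* (ii) representations of the limit law for 0 < r <= 1, 0 < alpha <= 1 *)
  (r <= 1 -> 0 < alpha -> alpha <= 1 ->
   forall (d1 : measure_display) (T1 : measurableType d1) (P1 : probability T1 R)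
          (X1 G1 : {RV P1 >-> R})
          (d2 : measure_display) (T2 : measurableType d2) (P2 : probability T2 R)
          (X2 W2 S2 Ga2 Gb2 : {RV P2 >-> R})
          (d3 : measure_display) (T3 : measurableType d3) (P3 : probability T3 R)
          (L3 S3 Ga3 Gb3 : {RV P3 >-> R}),
     (* term 1: X * sqrt(G*_{r,alpha,1}) *)
     has_pdf P1 X1 (normal_pdf 0 1) -> has_pdf P1 G1 (gg_pdf r alpha 1) ->
     mutually_independent P1 (fun b : bool => if b then X1 : T1 -> R else G1 : T1 -> R) ->
     (* term 2: X * sqrt(W_1 / (S_{alpha,1} Z_{r,1}^{1/alpha})),
        Z_{r,1} = (G_{r,1} + G_{1-r,1}) / G_{r,1} *)
     has_pdf P2 X2 (normal_pdf 0 1) -> has_pdf P2 W2 exp1_pdf ->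
     has_stable_cf P2 S2 alpha -> is_gamma P2 Ga2 r -> is_gamma P2 Gb2 (1 - r) ->
     mutually_independent P2 (fun i : 'I_5 =>
        nth (X2 : T2 -> R) [:: X2 : T2 -> R; W2 : T2 -> R; S2 : T2 -> R;
                               Ga2 : T2 -> R; Gb2 : T2 -> R] i) ->
     (* term 3: Lambda / sqrt(2 S_{alpha,1} Z_{r,1}^{1/alpha}) *)
     has_pdf P3 L3 laplace_pdf ->
     has_stable_cf P3 S3 alpha -> is_gamma P3 Ga3 r -> is_gamma P3 Gb3 (1 - r) ->
     mutually_independent P3 (fun i : 'I_4 =>
        nth (L3 : T3 -> R) [:: L3 : T3 -> R; S3 : T3 -> R; Ga3 : T3 -> R; Gb3 : T3 -> R] i) ->
     same_law P1 (fun w => X1 w * Num.sqrt (G1 w))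
              P2 (fun w => X2 w * Num.sqrt (W2 w /
                     (S2 w * ((Ga2 w + Gb2 w) / Ga2 w) `^ alpha^-1)))
     /\
     same_law P2 (fun w => X2 w * Num.sqrt (W2 w /
                     (S2 w * ((Ga2 w + Gb2 w) / Ga2 w) `^ alpha^-1)))
              P3 (fun w => L3 w / Num.sqrt (2 * S3 w * ((Ga3 w + Gb3 w) / Ga3 w) `^ alpha^-1))).
Proof.
split.
  move=> d T P X N sigma iX lX intX mX s0 vX lN iN d' T' P' Xl G hXl hG iG.
  exact: (random_sum_cvg_in_law iX lX intX mX s0 vX lN iN hXl hG iG).
move=> r1 a0 a1 d1 T1 P1 X1 G1 d2 T2 P2 X2 W2 S2 Ga2 Gb2 d3 T3 P3 L3 S3 Ga3 Gb3.
move=> hX1 hG1 i1 hX2 hW2 hS2 hA2 hB2 i2 hL hS3 hA3 hB3 i3.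
have e12 := gamma_mixture_exponential hr r1 a0 a1 hX1 hG1 i1 hX2 hW2 hS2 hA2 hB2 i2.
have e13 := gamma_mixture_laplace hr r1 a0 a1 hX1 hG1 i1 hL hS3 hA3 hB3 i3.
(* The second equality of laws passes through the first term X sqrt(G), to which both others have
   been compared. *)
by split=> // B mB; rewrite -(e12 B mB) (e13 B mB).
Qed.
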